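(* Assume hypotheses (a)–(f) of the context, and let $\mu_t$, $t\ge 0$, be the limiting empirical eigenvalue distribution of $D_n+\sqrt t\,X_n$ as $n\to\infty$. Then for any $z\in\mathbb{C}\setminus\mathbb{R}$, $$\frac{\partial}{\partial t}\Big|_{t=0}\int\frac{d\mu_t(\lambda)}{z-\lambda}=-\int_{\mathbb{R}}\frac{F(\lambda)}{(z-\lambda)^2}\,d\lambda=-\int_{\mathbb{R}}F(\lambda)\,\frac{\partial}{\partial\lambda}\Big(\frac1{z-\lambda}\Big)\,d\lambda .$$
   Context: Model. For each $n\ge1$, $D_n=\operatorname{diag}(\lambda_n(1),\dots,\lambda_n(n))$ is a real diagonal matrix, $X_n=\frac1{\sqrt n}[x^n_{i,j}]_{1\le i,j\le n}$ is a Hermitian random matrix, and $\varepsilon_n>0$ (the sequence $\varepsilon_n$ enters here only through $\eta_n$ in hypothesis (b)). Hypotheses. (a) The entries $x^n_{i,j}$ of $\sqrt nX_n$ are independent (up to the Hermitian symmetry), centered, with variance $\sigma_n^2(i,j)=\mathbb{E}|x^n_{i,j}|^2$, and $\mathbb{E}|x^n_{i,j}|^8$ is bounded uniformly in $n,i,j$. (b) There are real functions $f,\sigma_{\mathrm d}$ on $[0,1]$ and $\sigma$ on $[0,1]^2$ such that, for each $x\in[0,1]$, $\lambda_n(\lfloor nx\rfloor)\to f(x)$ and $\sigma_n^2(\lfloor nx\rfloor,\lfloor nx\rfloor)\to\sigma_{\mathrm d}(x)^2$, and for each $x\neq y\in[0,1]$, $\sigma_n^2(\lfloor nx\rfloor,\lfloor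 ny\rfloor)\to\sigma^2(x,y)$ (an index equal to $0$ is read as $1$). Moreover $$\eta_n:=\max\{n\varepsilon_n,1\}\times\sup_{1\le i\ne j\le n}\big(|\sigma_n^2(i,j)-\sigma^2(i/n,j/n)|+|\lambda_n(i)-f(i/n)|\big)\to0.$$ (c) $f$ is bounded and the push-forward of the uniform measure on $[0,1]$ by $f$ has a density $\rho$ with respect to Lebesgue measure on $\mathbb{R}$ and a compact support, denoted $\mathcal S$. (d) There is a symmetric function $\tau$ on $\mathbb{R}^2$ such that $\sigma^2(x,y)=\tau(f(x),f(y))$ for all $x\ne y$. (e) There exist $\eta_0>0$, $\alpha>0$, $C<\infty$ such that for almost all $s\in\mathbb{R}$ and all $t\in[s-\eta_0,s+\eta_0]$, $|\tau(s,t)\rho(t)-\tau(s,s)\rho(s)|\le C|t-s|^\alpha$. (f) There is a compact set $\widetilde{\mathcal S}\subset\mathbb{R}$ such that $\max_{1\le i\le n}\operatorname{dist}(\lambda_n(i),\widetilde{\mathcal S})\to0$. For each fixed $t\ge0$, the uniform distribution on the eigenvalues (with multiplicity) of $D_n+\sqrt tX_n$ converges weakly (in probability) as $n\to\infty$ to a deterministic probability measure; this is a known result, and the limit is denoted $\mu_t$ (so $\mu_0$ has density $\rho$). The derivative at $t=0$ is the right derivative. The Hilbert transform of a function $u$ is $H[u](s):=\mathrm{p.v.}\int_{\mathbb{R}}\frac{u(t)}{s-t}\,dt$, and $$F(s):=-\rho(s)\,H[\tau(s,\cdot)\rho(\cdot)](s).$$ *)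

(* Defs.v *)
From HB Require Import structures.
From mathcomp Require Import all_boot all_order all_algebra.
From mathcomp Require Import all_classical all_reals all_analysis.
From mathcomp Require Import complex.

Set Implicit Arguments.
Unset Strict Implicit.
Unset Printing Implicit Defensive.
Import Order.TTheory GRing.Theory Num.Theory.
Import numFieldNormedType.Exports.
Local Open Scope classical_set_scope.
Local Open Scope ring_scope.

Notation normc := ComplexField.Normc.normc.

Notation toC := (real_complex_def (Phant _)).

(* R[i] carries no measurable structure in the library: a complex random
   variable is handled through its pair of real coordinates, and the Borel
   sigma-algebra of the complex plane is the product one. *)
Definition coords (R : realType) (z : R[i]) : R * R := (complex.Re z, complex.Im z).

Definition mutually_independent d d' (T : measurableType d)
    (U : measurableType d') (R : realType) (P : probability T R)
    (I : finType) (A : {set I}) (X : I -> T -> U) : Prop :=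
  forall (J : {set I}) (B : I -> set U),
    J \subset A -> (forall i, i \in J -> measurable (B i)) ->
    P (\bigcap_(i in [set` J]) (X i @^-1` B i)) =
    (\prod_(i in J) P (X i @^-1` B i))%E.

(* Integral of the library on each coordinate. It is unaffected by changes on a
   null set, even when the integrand is then no longer Borel measurable. *)
Definition Cintegral d (T : measurableType d) (R : realType)
    (mu : {measure set T -> \bar R}) (g : T -> R[i]) : R[i] :=
  Complex (\int[mu]_x complex.Re (g x)) (\int[mu]_x complex.Im (g x)).

Definition Cderive (R : realType) (g : R -> R[i]) (x : R) : R[i] :=
  lim ((toC h^-1 * (g (x + h) - g x) : R[i]^o) @[h --> 0^']).

Definition is_right_Cderive (R : realType) (g : R -> R[i]) (x : R) (l : R[i]) :
    Prop :=
  (toC h^-1 * (g (x + h) - g x) : R[i]^o) @[h --> 0^'+] --> (l : R[i]^o).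

Definition stieltjes (R : realType) (mu : {measure set R -> \bar R}) (z : R[i]) :
    R[i] :=
  Cintegral mu (fun l => (z - toC l)^-1).

Section size_n.
Context (R : realType) (n : nat).
(* The matrices have size n.+1; i : 'I_n.+1 stands for the one-based i.+1. *)

Definition gridpt (i : 'I_n.+1) : R := i.+1%:R / n.+1%:R.

(* ord0 is the one-based index 1, so .-1 also reads the index 0 as 1. *)
Definition grididx (x : R) : 'I_n.+1 := inord (Num.truncn (n.+1%:R * x)).-1.

Definition perturbed (lam : 'I_n.+1 -> R) (x : 'M[R[i]]_n.+1) (t : R) :
    'M[R[i]]_n.+1 :=
  diag_mx (\row_i toC (lam i)) +
  toC (Num.sqrt t) *: (toC (Num.sqrt n.+1%:R)^-1 *: x).

(* For A Hermitian: spectral_diag lists the eigenvalues with multiplicity, and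
   they are real. *)
Definition eigval (A : 'M[R[i]]_n.+1) (k : nat) : R :=
  complex.Re (spectral_diag A 0 (inord k)).

Definition esd (A : 'M[R[i]]_n.+1) : {measure set R -> \bar R} :=
  mscale (n.+1%:R^-1)%:nng (msum (fun k => \d_(eigval A k)) n.+1).

Definition variance_profile d (T : measurableType d) (P : probability T R)
    (x : T -> 'M[R[i]]_n.+1) (i j : 'I_n.+1) : R :=
  fine 'E_P[fun w => normc (x w i j) ^+ 2].

Definition profile_gap (eps : R) (s2 : 'I_n.+1 -> 'I_n.+1 -> R) (lam : 'I_n.+1 -> R)
    (sigma : R -> R -> R) (f : R -> R) : R :=
  Num.max (n.+1%:R * eps) 1 *
  \big[Num.max/0]_(p : 'I_n.+1 * 'I_n.+1 | p.1 != p.2)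
    (`|s2 p.1 p.2 - sigma (gridpt p.1) (gridpt p.2) ^+ 2| +
     `|lam p.1 - f (gridpt p.1)|).

End size_n.

(* The limit is deterministic, so each index may have its own probability
   space. *)
Definition weakly_cvg_in_prob (R : realType) (d : nat -> measure_display)
    (T : forall n, measurableType (d n)) (P : forall n, probability (T n) R)
    (nu : forall n, T n -> {measure set R -> \bar R})
    (mu : {measure set R -> \bar R}) : Prop :=
  forall g : R -> R, continuous g -> (exists M : R, forall x : R, `|g x| <= M) ->
  forall e : R, 0 < e ->
    P n [set w | e <= `|\int[nu n w]_x g x - \int[mu]_x g x|]
      @[n --> \oo] --> 0%E.

Definition has_density (R : realType) (nu : set R -> \bar R) (rho : R -> R) :
    Prop :=
  [/\ measurable_fun setT rho, forall s : R, 0 <= rho s &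
      forall A, measurable A ->
        nu A = (\int[lebesgue_measure]_(s in A) (rho s)%:E)%E].

Definition support_of (R : realType) (nu : set R -> \bar R) : set R :=
  [set s | forall U, open U -> U s -> (0 < nu U)%E].

(* Principal value at the singularity t = s; [lim] is a default value at the
   points s where the principal value does not exist. *)
Definition hilbert (R : realType) (u : R -> R) (s : R) : R :=
  lim ((\int[lebesgue_measure]_(t in [set t | (e < `|s - t|)%R])
          (u t / (s - t)))%R @[e --> 0^'+]).

Definition Fvel (R : realType) (tau : R -> R -> R) (rho : R -> R) (s : R) : R :=
  - rho s * hilbert (fun t => tau s t * rho t) s.

(* Main.v *)
Require Import Defs.
From HB Require Import structures.
From mathcomp Require Import all_boot all_order all_algebra.
From mathcomp Require Import all_classical all_reals all_analysis.
From mathcomp Require Import measurable_realfun complex.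
From mathcomp Require Import ring lra.

Set Implicit Arguments.
Unset Strict Implicit.
Unset Printing Implicit Defensive.
Import Order.TTheory GRing.Theory Num.Theory.
Import numFieldNormedType.Exports.
Local Open Scope classical_set_scope.
Local Open Scope ring_scope.

(* Write X for the noise divided by sqrt n, G for the resolvent of D + sqrt t X
   and r = (z - D)^-1 (diagonal). Then
     G = r + sqrt t r X r + t r X r X r + t^(3/2) r X r X r X G.
   In expectation the trace of the second term vanishes and that of the third is
   n^-1 sum_ij r_i^2 r_j E|x_ij|^2. The last term is bounded through Frobenius
   norms: E |X r X|_F^2 is O(n), since by independence and centering only
   matching pairs of entries contribute. So
     E tr G / n = a_n + t b_n + O(t^(3/2))
   uniformly in n, where b_n is a Riemann sum. As n grows, the normalised traces
   converge to the Stieltjes transforms of mu_t and mu_0, and b_n to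
     B = int int tau(s,u) rho(s) rho(u) (z-s)^-2 (z-u)^-1 ds du,
   so that B is the right derivative at 0. Symmetrizing B in (s,u) turns its kernel
   into the divided difference of (z-s)^-2, and cutting off |s - u| <= e and letting
   e tend to 0 gives - int F(s) (z-s)^-2 ds; the principal value exists, with a
   uniform bound, by the Hoelder condition.

   sigma^2 is only known to be a pointwise limit, so tau (f x) (f y) is known only
   on the range of f; a measurable right inverse of f, obtained from Lusin's theorem,
   provides a jointly measurable version of tau almost everywhere. *)

(** * Resolvents of complex matrices *)

(** Taking the limit in n and differentiating in t need not commute. The expansion is therefore kept
    as an inequality at fixed t with a constant independent of n; n tends to infinity in it first,
    and t tends to 0 afterwards, t^(3/2) being o(t). Operator norms of X are never estimated. The
    trace of the remainder is split as (r X)(r X r X G): both factors have squared Frobenius norm of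
    order n in expectation, and G costs at most a factor 1/|Im z| in norm, however it depends on X.
    Complex quantities are tested through the real part of their product with a constant c. The
    choices c = 1 and c = -i give the two coordinates, so that all integrals and limits are taken in
    the reals. Two points shape the measure theory. The field F is not known to be measurable, only
    equal almost everywhere to a measurable function, so integrals are compared off null sets. And
    [tau] is tied to variances only at images of distinct points; its measurable version is set to 0
    on the diagonal, which has measure 0 because the limit law has no atoms. *)

Section complex_coordinates.
Context {R : realType}.
Implicit Types u v w z : R[i].

Lemma CReD u v : complex.Re (u + v) = complex.Re u + complex.Re v.
Proof. by case: u v => [a b] [c e]. Qed.

Lemma CImD u v : complex.Im (u + v) = complex.Im u + complex.Im v.
Proof. by case: u v => [a b] [c e]. Qed.

Lemma CReN u : complex.Re (- u) = - complex.Re u.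
Proof. by case: u. Qed.

Lemma CImN u : complex.Im (- u) = - complex.Im u.
Proof. by case: u. Qed.

Lemma CReM u v :
  complex.Re (u * v) = complex.Re u * complex.Re v - complex.Im u * complex.Im v.
Proof. by case: u v => [a b] [c e]. Qed.

Lemma CImM u v :
  complex.Im (u * v) = complex.Re u * complex.Im v + complex.Im u * complex.Re v.
Proof. by case: u v => [a b] [c e]. Qed.

Lemma CRe_sum I (r : seq I) (Q : pred I) (F : I -> R[i]) :
  complex.Re (\sum_(i <- r | Q i) F i) = \sum_(i <- r | Q i) complex.Re (F i).
Proof. by apply: (big_morph _ CReD). Qed.

Lemma CIm_sum I (r : seq I) (Q : pred I) (F : I -> R[i]) :
  complex.Im (\sum_(i <- r | Q i) F i) = \sum_(i <- r | Q i) complex.Im (F i).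
Proof. by apply: (big_morph _ CImD). Qed.

Lemma Complex_eq u v :
  complex.Re u = complex.Re v -> complex.Im u = complex.Im v -> u = v.
Proof. by case: u v => [a b] [c e] /= -> ->. Qed.

Lemma CRe_conj u : complex.Re u^* = complex.Re u.
Proof. by case: u. Qed.

Lemma CIm_conj u : complex.Im u^* = - complex.Im u.
Proof. by case: u. Qed.

Lemma normc_ge0 u : 0 <= normc u.
Proof. by case: u => a b; exact: sqrtr_ge0. Qed.

Lemma normc_sqr u : normc u ^+ 2 = complex.Re u ^+ 2 + complex.Im u ^+ 2.
Proof. by case: u => a b /=; rewrite sqr_sqrtr// addr_ge0// sqr_ge0. Qed.

Lemma CRe_le_normc u : `|complex.Re u| <= normc u.
Proof.
rewrite -(@ler_pXn2r _ 2%N)// ?nnegrE ?normc_ge0// normc_sqr real_normK ?num_real//.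
by rewrite lerDl sqr_ge0.
Qed.

Lemma CIm_le_normc u : `|complex.Im u| <= normc u.
Proof.
rewrite -(@ler_pXn2r _ 2%N)// ?nnegrE ?normc_ge0// normc_sqr real_normK ?num_real//.
by rewrite lerDr sqr_ge0.
Qed.

Lemma normc_conj u : normc u^* = normc u.
Proof. by case: u => a b /=; rewrite sqrrN. Qed.

Lemma normc_toC (r : R) : normc (toC r) = `|r|.
Proof. by rewrite /= expr0n/= addr0 sqrtr_sqr. Qed.

Lemma normcX u k : normc (u ^+ k) = normc u ^+ k.
Proof.
elim: k => [|k ih]; first by rewrite !expr0 ComplexField.Normc.normc1.
by rewrite !exprS ComplexField.Normc.normcM ih.
Qed.

Lemma mulc_conj u : u * u^* = toC (normc u ^+ 2).
Proof.
apply: Complex_eq; rewrite ?CReM ?CImM CRe_conj CIm_conj/=.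
  by rewrite normc_sqr; ring.
by ring.
Qed.

Lemma toCM (r s : R) : toC (r * s) = toC r * toC s.
Proof. exact: (rmorphM (real_complex R)). Qed.

Lemma toC_sum I (r : seq I) (Q : pred I) (F : I -> R) :
  toC (\sum_(i <- r | Q i) F i) = \sum_(i <- r | Q i) toC (F i).
Proof. exact: (rmorph_sum (real_complex R)). Qed.

Lemma CReZ (r : R) u : complex.Re (toC r * u) = r * complex.Re u.
Proof. by rewrite CReM /= mul0r subr0. Qed.

Lemma CImZ (r : R) u : complex.Im (toC r * u) = r * complex.Im u.
Proof. by rewrite CImM /= mul0r addr0. Qed.

Lemma normc_subC_ge z (l : R) : `|complex.Im z| <= normc (z - toC l).
Proof.
by have := CIm_le_normc (z - toC l); rewrite CImD CImN/= subr0.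
Qed.

Lemma subC_neq0 z (l : R) : complex.Im z != 0 -> z - toC l != 0.
Proof.
move=> z0; apply: contra z0 => /eqP zl.
have := normc_subC_ge z l; rewrite zl ComplexField.Normc.normc0.
by rewrite normr_le0.
Qed.

Lemma normc_resolvent z (l : R) : complex.Im z != 0 ->
  normc (z - toC l)^-1 <= `|complex.Im z|^-1.
Proof.
move=> z0; have y0 : 0 < `|complex.Im z| by rewrite normr_gt0.
rewrite ComplexField.Normc.normcV lef_pV2 ?posrE//; first exact: normc_subC_ge.
exact: lt_le_trans (normc_subC_ge _ l).
Qed.

End complex_coordinates.

Lemma mxtrace_inv_conj_diag (F : fieldType) n (Q : 'M[F]_n) (e : 'rV[F]_n) :
  Q \in unitmx -> (forall k, e 0 k != 0) ->
  \tr (invmx (invmx Q *m diag_mx e *m Q)) = \sum_k (e 0 k)^-1.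
Proof.
move=> uQ e0; set M := _ *m Q.
pose G := invmx Q *m diag_mx (\row_k (e 0 k)^-1) *m Q.
have MG : M *m G = 1%:M.
  rewrite /M /G !mulmxA mulmxK// -[_ *m diag_mx _ *m diag_mx _]mulmxA mulmx_diag.
  have -> : diag_mx (\row_j (e 0 j * (\row_k (e 0 k)^-1) 0 j)) = 1%:M :> 'M[F]_n.
    by apply/matrixP => i j; rewrite !mxE; case: eqP => // ->; rewrite mulfV.
  by rewrite mulmx1 mulVmx.
have [uM _] := mulmx1_unit MG.
have -> : invmx M = G by rewrite -[LHS]mulmx1 -MG mulKmx.
rewrite /G mxtrace_mulC mulmxA mulmxV// mul1mx mxtrace_diag.
by apply: eq_bigr => k _; rewrite mxE.
Qed.

(** Three substitutions of the hypothesis into itself. The last product is bracketed as (D X)(D X D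
    X G), the splitting in which its trace will be bounded. *)
Lemma neumann_expansion3 (F : comNzRingType) n (D X G : 'M[F]_n) s :
  G = D + s *: (D *m X *m G) ->
  G = D + s *: (D *m X *m D) + (s * s) *: (D *m X *m (D *m X *m D))
      + (s * (s * s)) *: (D *m X *m (D *m X *m (D *m X) *m G)).
Proof.
move=> GE; rewrite {1}GE {1}GE {1}GE !mulmxDr -!scalemxAr !mulmxDr -!scalemxAr.
by rewrite !scalerDr !scalerA !mulmxA !mulrA -!addrA.
Qed.

Lemma scalar_mx_sub_conj (F : fieldType) n (Q B : 'M[F]_n) (a : F) :
  Q \in unitmx -> a%:M - invmx Q *m B *m Q = invmx Q *m (a%:M - B) *m Q.
Proof.
by move=> uQ; rewrite mulmxBr mulmxBl mul_mx_scalar -scalemxAl mulVmx// scalemx1.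
Qed.

Lemma mxtrace_diag1 (F : comNzRingType) n (d : 'rV[F]_n) (X : 'M[F]_n) :
  \tr (diag_mx d *m X *m diag_mx d) = \sum_i d 0 i ^+ 2 * X i i.
Proof.
by apply: eq_bigr => i _; rewrite mul_mx_diag mul_diag_mx !mxE; ring.
Qed.

Lemma mxtrace_diag2 (F : comNzRingType) n (d : 'rV[F]_n) (X : 'M[F]_n) :
  \tr (diag_mx d *m X *m (diag_mx d *m X *m diag_mx d)) =
  \sum_i \sum_j d 0 i ^+ 2 * d 0 j * (X i j * X j i).
Proof.
apply: eq_bigr => i _; rewrite mxE; apply: eq_bigr => j _.
by rewrite !mul_mx_diag !mul_diag_mx !mxE; ring.
Qed.

Lemma mxtrace_neumann (F : comNzRingType) n (d : 'rV[F]_n) (X G : 'M[F]_n) s :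
  let D := diag_mx d in
  G = D + s *: (D *m X *m G) ->
  \tr G = \sum_i d 0 i + s * (\sum_i d 0 i ^+ 2 * X i i)
    + (s * s) * (\sum_i \sum_j d 0 i ^+ 2 * d 0 j * (X i j * X j i))
    + (s * (s * s)) * \tr (D *m X *m (D *m X *m (D *m X) *m G)).
Proof.
move=> D /neumann_expansion3 {1}->.
by rewrite !mxtraceD !mxtraceZ mxtrace_diag1 mxtrace_diag2 mxtrace_diag.
Qed.

(** Arithmetic for [resolvent_expansion]: c is |Im z|^-2, a and b are the squared Frobenius norms of
    X and X D X, and f1, f2, f3 are those of D X, D X D X and D X D X G. *)
Lemma remainder_bound (F : realFieldType) (c a b f1 f2 f3 : F) :
  0 <= c -> 0 <= a -> 0 <= b -> f1 <= c * a -> f2 <= c * b -> f3 <= c * f2 ->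
  (f1 + f3) / 2 <= c * (a + c * b).
Proof.
move=> c0 a0 b0 h1 h2 h3.
have h4 : c * f2 <= c * (c * b) by exact: ler_wpM2l.
have h5 : 0 <= c * a by exact: mulr_ge0.
have h6 : 0 <= c * (c * b) by rewrite !mulr_ge0.
rewrite mulrDr; lra.
Qed.

Section resolvent.
Context {R : realType}.
Implicit Types z : R[i].

Definition frob2 m n (A : 'M[R[i]]_(m, n)) : R :=
  \sum_i \sum_j normc (A i j) ^+ 2.

Lemma frob2_ge0 m n (A : 'M[R[i]]_(m, n)) : 0 <= frob2 A.
Proof. by apply: sumr_ge0 => i _; apply: sumr_ge0 => j _; exact: sqr_ge0. Qed.

Lemma frob2_row m n (A : 'M[R[i]]_(m, n)) : frob2 A = \sum_i frob2 (row i A).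
Proof.
by apply: eq_bigr => i _; rewrite /frob2 big_ord1; apply: eq_bigr => j _; rewrite mxE.
Qed.

(** For Hermitian A the number v A v^* is real, so with u = v (z - A) the imaginary part of u v^* is
    Im z |v|^2. This forces u to be large. *)
Lemma resolvent_row_le n (A : 'M[R[i]]_n) z (v : 'rV[R[i]]_n) :
  A \is hermsymmx ->
  complex.Im z ^+ 2 * frob2 v <= frob2 (v *m (z%:M - A)).
Proof.
move=> hA; set u := v *m _.
have hAij i j : (A i j)^* = A j i.
  have /is_hermitianmxP := hA; rewrite expr0 scale1r => /matrixP/(_ j i) ->.
  by rewrite !mxE.
set S := frob2 v; pose q := \sum_j (v *m A) 0 j * (v 0 j)^*.
have Imq : complex.Im q = 0.
  suff qq : q^* = q.
    by have /eqP := CIm_conj q; rewrite qq -addr_eq0 -mulr2n mulrn_eq0 => /eqP.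
  rewrite /q rmorph_sum/=.
  under eq_bigr do rewrite rmorphM/= conjCK mxE rmorph_sum/= mulr_suml.
  under [RHS]eq_bigr do rewrite mxE mulr_suml.
  rewrite exchange_big/=; apply: eq_bigr => i _; apply: eq_bigr => j _.
  rewrite rmorphM/= hAij; ring.
have Eu : \sum_j u 0 j * (v 0 j)^* = z * toC S - q.
  rewrite /S /frob2 big_ord1 toC_sum /q mulr_sumr -sumrB; apply: eq_bigr => j _.
  by rewrite -mulc_conj /u mulmxBr mul_mx_scalar !mxE; ring.
have ImS : complex.Im (\sum_j u 0 j * (v 0 j)^*) = complex.Im z * S.
  by rewrite Eu CImD CImN Imq CImM /= mulr0 add0r subr0.
set y := complex.Im z.
(* Young's inequality with a free real parameter; c = Im z gives the claim without dividing by the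
   norm of v. *)
have h (c : R) : 2 * c * complex.Im (\sum_j u 0 j * (v 0 j)^*) <= frob2 u + c ^+ 2 * S.
  rewrite CIm_sum /S /frob2 !big_ord1 !mulr_sumr -big_split/=; apply: ler_sum => j _.
  rewrite !normc_sqr CImM CRe_conj CIm_conj.
  set a := complex.Re _; set b := complex.Im _; set d := complex.Im _.
  set e := complex.Re _.
  have := sqr_ge0 (a + c * b); have := sqr_ge0 (d - c * e); nra.
have := h y; rewrite ImS -/y; nra.
Qed.

Lemma resolvent_unitmx n (A : 'M[R[i]]_n) z :
  A \is hermsymmx -> complex.Im z != 0 -> z%:M - A \in unitmx.
Proof.
move=> hA z0; rewrite -row_free_unit; apply/row_freeP/row_freeP.
rewrite -kermx_eq0; apply/eqP/row_matrixP => i; rewrite row0.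
have := resolvent_row_le z (row i (kermx (z%:M - A))) hA.
rewrite -row_mul mulmx_ker row0 {2}/frob2.
rewrite big1 => [|k _]; last first.
  by rewrite big1// => j _; rewrite mxE ComplexField.Normc.normc0 expr0n.
rewrite pmulr_rle0 ?exprn_even_gt0//= => v0.
apply/rowP => j; rewrite [RHS]mxE; apply/ComplexField.Normc.eq0_normc/eqP.
rewrite -sqrf_eq0 eq_le sqr_ge0 andbT (le_trans _ v0)// /frob2 big_ord1.
by rewrite (bigD1 j)//= lerDl; apply: sumr_ge0 => k _; exact: sqr_ge0.
Qed.

(** [resolvent_row_le] on each row of B G, where G is the resolvent, since B G (z - A) = B. This
    stands in for the operator norm bound on G. *)
Lemma frob2_mul_resolvent m n (A : 'M[R[i]]_n) z (B : 'M[R[i]]_(m, n)) :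
  A \is hermsymmx -> complex.Im z != 0 ->
  complex.Im z ^+ 2 * frob2 (B *m invmx (z%:M - A)) <= frob2 B.
Proof.
move=> hA z0; rewrite frob2_row [leRHS]frob2_row mulr_sumr; apply: ler_sum => i _.
apply: le_trans (resolvent_row_le _ _ hA) _.
by rewrite row_mul mulmxKV// resolvent_unitmx.
Qed.

(** Triangle inequality and a b <= (a^2 + b^2) / 2 entry by entry. Unlike a product of norms, a sum
    of squared norms can be integrated term by term. *)
Lemma normc_mxtrace_mul m n (A : 'M[R[i]]_(m, n)) (B : 'M[R[i]]_(n, m)) :
  normc (\tr (A *m B)) <= (frob2 A + frob2 B) / 2.
Proof.
have -> : frob2 B = \sum_j \sum_i normc (B i j) ^+ 2 by rewrite /frob2 exchange_big.
rewrite /frob2 /mxtrace -big_split/= mulr_suml.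
have nsum k (F : 'I_k -> R[i]) : normc (\sum_i F i) <= \sum_i normc (F i).
  apply: (big_ind2 (fun a b => normc a <= b)) => [|a b c d h1 h2|//].
    by rewrite ComplexField.Normc.normc0.
  by rewrite (le_trans (le_normcD _ _))// lerD.
apply: le_trans (nsum _ _) _; apply: ler_sum => i _.
rewrite mxE -big_split/= mulr_suml; apply: le_trans (nsum _ _) _.
apply: ler_sum => j _; rewrite ComplexField.Normc.normcM.
have := sqr_ge0 (normc (A i j) - normc (B j i)); nra.
Qed.

(** Diagonalization by the spectral theorem. The eigenvalues are real, so taking their real parts,
    as [eigval] does, loses nothing. *)
Lemma resolvent_trace n (A : 'M[R[i]]_n) z :
  A \is hermsymmx -> complex.Im z != 0 ->
  \sum_k (z - toC (complex.Re (spectral_diag A 0 k)))^-1 = \tr (invmx (z%:M - A)).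
Proof.
move=> hA z0; set sp := spectral_diag A; set Q := spectralmx A.
have uQ : Q \in unitmx by exact: spectral_unit.
have /orthomx_spectralP AE := hermitian_normalmx hA.
have spr k : toC (complex.Re (sp 0 k)) = sp 0 k.
  have /mxOverP/(_ 0 k) := hermitian_spectral_diag_real hA.
  by rewrite -/sp => /RRe_real.
have -> : z%:M - A = invmx Q *m diag_mx (\row_k (z - sp 0 k)) *m Q.
  have -> : diag_mx (\row_k (z - sp 0 k)) = z%:M - diag_mx sp.
    by apply/matrixP => i j; rewrite !mxE; case: eqP => [->|_]; rewrite ?subr0.
  by rewrite {1}AE; exact: scalar_mx_sub_conj.
rewrite mxtrace_inv_conj_diag//; first by apply: eq_bigr => k _; rewrite mxE spr.
by move=> k; rewrite mxE -spr subC_neq0.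
Qed.

(** The coefficient of s^3 in the expanded trace; it still depends on s through the full
    resolvent. *)
Definition resolvent_remainder n (l : 'I_n -> R) (X : 'M[R[i]]_n) z s : R[i] :=
  let D := diag_mx (\row_i (z - toC (l i))^-1) in
  \tr (D *m X *m (D *m X *m (D *m X)
         *m invmx (z%:M - (diag_mx (\row_i toC (l i)) + toC s *: X)))).

Lemma resolvent_expansion n (l : 'I_n -> R) (X : 'M[R[i]]_n) z s :
  X \is hermsymmx -> complex.Im z != 0 ->
  let A := diag_mx (\row_i toC (l i)) + toC s *: X in
  let r i := (z - toC (l i))^-1 in
  [/\ A \is hermsymmx,
   \tr (invmx (z%:M - A)) =
     \sum_i r i + toC s * \sum_i r i ^+ 2 * X i i
     + toC (s ^+ 2) * (\sum_i \sum_j r i ^+ 2 * r j * toC (normc (X i j) ^+ 2))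
     + toC (s ^+ 3) * resolvent_remainder l X z s &
   normc (resolvent_remainder l X z s) <=
     `|complex.Im z| ^- 2 *
     (frob2 X + `|complex.Im z| ^- 2 *
        (\sum_i \sum_j normc (\sum_k X i k * r k * X k j) ^+ 2))].
Proof.
move=> hX z0 A r.
have hXij i j : X j i = (X i j)^*.
  have /is_hermitianmxP := hX; rewrite expr0 scale1r => /matrixP/(_ j i) ->.
  by rewrite !mxE.
have hA : A \is hermsymmx.
  apply/is_hermitianmxP; rewrite expr0 scale1r; apply/matrixP => i j.
  rewrite !mxE (eq_sym j i) (hXij i j) [(_ + _)^*]rmorphD/= [(_ * _)^*]rmorphM/= conjCK.
  congr (_ + _ * _).
    case: eqP => [->|_]; rewrite ?mulr1n ?mulr0n ?conjC0//.
    by apply: Complex_eq; rewrite ?CRe_conj ?CIm_conj//= oppr0.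
  by apply: Complex_eq; rewrite ?CRe_conj ?CIm_conj//= oppr0.
split=> //.
- rewrite /resolvent_remainder -/A; cbv zeta; set D := diag_mx _; set G := invmx _.
  have uA := resolvent_unitmx hA z0.
  have DE : D *m (z%:M - diag_mx (\row_i toC (l i))) = 1%:M.
    apply/matrixP => i j; rewrite mul_diag_mx !mxE; case: eqP => [->|_].
      by rewrite mulr1n mulVf// subC_neq0.
    by rewrite !mulr0n subr0 mulr0.
  (* Resolvent identity: D inverts z - diag(l), so multiplying (z - A) G = 1 by D on the left
     isolates G. *)
  have GE : G = D + toC s *: (D *m X *m G).
    have : D *m ((z%:M - A) *m G) = D by rewrite mulmxV// mulmx1.
    rewrite /A opprD addrA mulmxBl mulmxBr mulmxA DE mul1mx.
    by rewrite -scalemxAl -scalemxAr mulmxA => /eqP; rewrite subr_eq => /eqP.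
  rewrite (mxtrace_neumann GE) !exprS expr0 mulr1 !toCM.
  congr (_ + _ * _ + _ * _ + _).
  + by apply: eq_bigr => i _; rewrite mxE.
  + by apply: eq_bigr => i _; rewrite mxE.
  + apply: eq_bigr => i _; apply: eq_bigr => j _.
    by rewrite !mxE (hXij i j) -mulc_conj mulrA.
- rewrite /resolvent_remainder -/A; cbv zeta; set D := diag_mx _; set G := invmx _.
  set y := `|complex.Im z|.
  have y0 : 0 < y by rewrite normr_gt0.
  have y2 : complex.Im z ^+ 2 = y ^+ 2 by rewrite real_normK// num_real.
  (* The diagonal entries of D are resolvents at real points, of modulus at most 1/|Im z|. *)
  have DB k (B : 'M[R[i]]_(n, k)) : frob2 (D *m B) <= y ^- 2 * frob2 B.
    rewrite /frob2 mulr_sumr; apply: ler_sum => i _; rewrite mulr_sumr.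
    apply: ler_sum => j _; rewrite mul_diag_mx !mxE ComplexField.Normc.normcM exprMn.
    apply: ler_wpM2r; first exact: sqr_ge0.
    by rewrite -exprVn ler_pXn2r ?nnegrE ?normc_ge0 ?invr_ge0 ?(ltW y0)// normc_resolvent.
  have XDX : frob2 (X *m (D *m X)) =
      \sum_i \sum_j normc (\sum_k X i k * r k * X k j) ^+ 2.
    apply: eq_bigr => i _; apply: eq_bigr => j _; congr (normc _ ^+ 2).
    rewrite mxE; apply: eq_bigr => k _; rewrite mul_diag_mx !mxE -/(r k); ring.
  rewrite -XDX; apply: le_trans (normc_mxtrace_mul _ _) _.
  have h1 := DB _ X; have h2 := DB _ (X *m (D *m X)).
  have h3 : frob2 (D *m X *m (D *m X) *m G) <= y ^- 2 * frob2 (D *m X *m (D *m X)).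
    by rewrite mulrC ler_pdivlMr ?exprn_gt0// mulrC -y2 frob2_mul_resolvent.
  rewrite -[X in _ <= _ * frob2 X]mulmxA in h3.
  apply: (remainder_bound _ (frob2_ge0 _) (frob2_ge0 _) h1 h2 h3).
  by rewrite invr_ge0 exprn_ge0// ltW.
Qed.

End resolvent.

Lemma mfun_exists d d' (T : measurableType d) (U : measurableType d') (f : T -> U) :
  measurable_fun setT f -> exists g : {mfun T >-> U}, g = f :> (T -> U).
Proof.
move=> mf; pose m := isMeasurableFun.Build _ _ _ _ f mf.
by exists (HB.pack f m : {mfun T >-> U}).
Qed.
(** * Independence and complex random variables *)

Section independence.
Local Open Scope ereal_scope.
Context {R : realType}.

(** The measure structure on a pushforward requires the measurability proof; the existential form
    hides that proof and passes on only the equality of set functions. *)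
Lemma pushforward_measureE d d' (T : measurableType d) (U : measurableType d')
    (m : {measure set T -> \bar R}) (f : T -> U) : measurable_fun setT f ->
  exists m' : {measure set U -> \bar R}, m' = pushforward m f :> (set U -> \bar R).
Proof.
move=> mf; unshelve eexists.
  by refine (pushforward m f : {measure set _ -> \bar _}); exact: mf.
by [].
Qed.

Lemma pushforward_probabilityE d d' (T : measurableType d) (U : measurableType d')
    (P : probability T R) (f : T -> U) : measurable_fun setT f ->
  exists P' : probability U R, P' = pushforward P f :> (set U -> \bar R).
Proof.
move=> /mfun_exists[g <-]; by exists (distribution P g).
Qed.

(** Rectangles are stable under intersection and generate the product sigma-algebra; as [m1] is
    finite, the constant sequence [setT] serves as exhaustion. *)
Lemma measure_rectangle_unique d d' (U : measurableType d) (V : measurableType d')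
    (m1 m2 : {measure set (U * V) -> \bar R}) :
  m1 setT < +oo ->
  (forall B C, measurable B -> measurable C -> m1 (B `*` C) = m2 (B `*` C)) ->
  forall D, measurable D -> m1 D = m2 D.
Proof.
move=> m1oo m12 D mD.
apply: (measure_unique [set A `*` B | A in measurable & B in measurable]
  (fun=> setT)) => //.
- exact: measurable_prod_measurableType.
- move=> _ _ [A1 mA1 [B1 mB1 <-]] [A2 mA2 [B2 mB2 <-]].
  exists (A1 `&` A2); first exact: measurableI.
  by exists (B1 `&` B2); [exact: measurableI|rewrite setXI].
- by move=> _; exists setT => //; exists setT => //; rewrite setXTT.
- by apply/seteqP; split=> // x _; exists 0%N.
- by move=> _ [A mA [B mB <-]]; exact: m12.
Qed.

(** Extends a factorization from rectangles to all measurable sets of pairs, c being the mass of the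
    independent event E. It is stated for a finite measure m, so that it also applies to a
    probability restricted to an event. *)
Lemma independence_pair d d1 d2 (T : measurableType d) (U : measurableType d1)
    (V : measurableType d2) (m : {measure set T -> \bar R}) (E : set T)
    (c : {nonneg R}) (Y : T -> U) (Z : T -> V) :
  m setT < +oo -> measurable E -> measurable_fun setT Y -> measurable_fun setT Z ->
  (forall B C, measurable B -> measurable C ->
     m (E `&` (Y @^-1` B `&` Z @^-1` C)) = c%:num%:E * m (Y @^-1` B `&` Z @^-1` C)) ->
  forall D, measurable D ->
     m (E `&` (fun w => (Y w, Z w)) @^-1` D) =
     c%:num%:E * m ((fun w => (Y w, Z w)) @^-1` D).
Proof.
move=> moo mE mY mZ h D mD.
have mYZ : measurable_fun setT (fun w => (Y w, Z w)) by exact: measurable_fun_pair.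
have [m1 m1E] := pushforward_measureE (mrestr m mE) mYZ.
have [m2 m2E] := pushforward_measureE m mYZ.
have m1oo : m1 setT < +oo.
  apply: le_lt_trans moo; rewrite m1E /pushforward /mrestr.
  have -> : (fun w => (Y w, Z w)) @^-1` setT = setT by [].
  by apply: le_measure; rewrite ?inE//; apply: measurableI.
have m12 B C : measurable B -> measurable C ->
    m1 (B `*` C) = mscale c m2 (B `*` C).
  move=> mB mC; transitivity (c%:num%:E * m2 (B `*` C)) => //.
  rewrite m1E m2E; apply: etrans (h B C mB mC); rewrite [in RHS]setIC.
  by rewrite /pushforward /mrestr.
have eD : m1 D = c%:num%:E * m2 D := measure_rectangle_unique m1oo m12 mD.
by rewrite m1E m2E in eD; rewrite setIC; exact: eD.
Qed.

Lemma integral_mul_centered d d1 d2 (T : measurableType d) (U : measurableType d1)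
    (V : measurableType d2) (P : probability T R) (Y : T -> U) (Z : T -> V)
    (a : U -> R) (b : V -> R) :
  measurable_fun setT Y -> measurable_fun setT Z ->
  measurable_fun setT a -> measurable_fun setT b ->
  (forall B C, measurable B -> measurable C ->
     P (Y @^-1` B `&` Z @^-1` C) = P (Y @^-1` B) * P (Z @^-1` C)) ->
  P.-integrable setT (EFin \o (a \o Y)) ->
  P.-integrable setT (fun w => (a (Y w) * b (Z w))%:E) ->
  \int[P]_w (a (Y w))%:E = 0 ->
  \int[P]_w (a (Y w) * b (Z w))%:E = 0.
Proof.
move=> mY mZ ma mb ind ia iab a0.
have mYZ : measurable_fun setT (fun w => (Y w, Z w)) by exact: measurable_fun_pair.
have [Q QE] := pushforward_measureE P mYZ.
have [m1 m1E] := pushforward_probabilityE P mY.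
have [m2 m2E] := pushforward_probabilityE P mZ.
pose h (p : U * V) : R := (a p.1 * b p.2)%R.
have mh : measurable_fun setT h.
  by apply: measurable_funM; exact: measurableT_comp.
pose g := EFin \o h.
have mg : measurable_fun setT g by exact/measurable_EFinP.
(* Independence makes the joint law of (Y, Z) the product of the two laws; Fubini then integrates
   the centered factor first. *)
have prodQ : forall X, measurable X -> (m1 \x m2) X = Q X.
  apply: product_measure_unique => B C mB mC.
  have : Q (B `*` C) = m1 B * m2 C by rewrite QE m1E m2E; exact: ind.
  by [].
have ig : Q.-integrable setT g by rewrite QE; exact: integrable_pushforward.
have ig' : (m1 \x m2).-integrable setT g.
  apply/integrableP; split => //; case/integrableP: ig => _.
  have -> // : \int[m1 \x m2]_x `|g x| = \int[Q]_x `|g x|.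
  by apply: eq_measure_integral => X mX _; exact: prodQ.
transitivity (\int[Q]_p g p); first by rewrite QE integral_pushforward.
transitivity (\int[m1 \x m2]_p g p).
  by apply: eq_measure_integral => X mX _; rewrite -prodQ.
rewrite -integral21_prod_meas1//.
rewrite -[RHS](@integral0 _ _ _ m2 setT); apply: eq_integral => y _.
rewrite /fubini_G /g /h /=.
under eq_integral do rewrite EFinM.
have ia1 : m1.-integrable setT (EFin \o a).
  by rewrite m1E; apply: integrable_pushforward => //; exact/measurable_EFinP.
have a10 : \int[m1]_x (a x)%:E = 0.
  by rewrite m1E integral_pushforward//; exact/measurable_EFinP.
by rewrite integralZr// a10 mul0e.
Qed.

End independence.

Section complex_measurable.
Context d (T : measurableType d) (R : realType).
Implicit Types f g : T -> R[i].

Definition Cmeasurable f :=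
  measurable_fun setT (fun w => complex.Re (f w)) /\
  measurable_fun setT (fun w => complex.Im (f w)).

Lemma Cmeasurable_eq f g : f =1 g -> Cmeasurable f -> Cmeasurable g.
Proof. by move=> /funext ->. Qed.

Lemma Cmeasurable_coords f :
  measurable_fun setT (fun w => coords (f w)) -> Cmeasurable f.
Proof.
move=> mf; split.
- by have := measurableT_comp (@measurable_fst _ _ R R) mf; apply.
- by have := measurableT_comp (@measurable_snd _ _ R R) mf; apply.
Qed.

Lemma Cmeasurable_cst c : Cmeasurable (fun=> c).
Proof. by split; exact: measurable_cst. Qed.

Lemma CmeasurableD f g :
  Cmeasurable f -> Cmeasurable g -> Cmeasurable (fun w => f w + g w).
Proof.
move=> [f1 f2] [g1 g2]; split.
- by under eq_fun do rewrite CReD; exact: (measurable_funD f1 g1).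
- by under eq_fun do rewrite CImD; exact: (measurable_funD f2 g2).
Qed.

Lemma CmeasurableM f g :
  Cmeasurable f -> Cmeasurable g -> Cmeasurable (fun w => f w * g w).
Proof.
move=> [f1 f2] [g1 g2]; split.
- under eq_fun do rewrite CReM.
  exact: (measurable_funB (measurable_funM f1 g1) (measurable_funM f2 g2)).
- under eq_fun do rewrite CImM.
  exact: (measurable_funD (measurable_funM f1 g2) (measurable_funM f2 g1)).
Qed.

Lemma CmeasurableN f : Cmeasurable f -> Cmeasurable (fun w => - f w).
Proof.
move=> mf; apply: (@Cmeasurable_eq (fun w => (-1) * f w)).
  by move=> w; rewrite mulN1r.
by apply: CmeasurableM => //; exact: Cmeasurable_cst.
Qed.

Lemma Cmeasurable_conj f : Cmeasurable f -> Cmeasurable (fun w => (f w)^*).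
Proof.
move=> [f1 f2]; split.
- by under eq_fun do rewrite CRe_conj.
- by under eq_fun do rewrite CIm_conj; exact: (measurable_funN f2).
Qed.

Lemma Cmeasurable_sum I (r : seq I) (Q : pred I) (F : I -> T -> R[i]) :
  (forall i, Q i -> Cmeasurable (F i)) ->
  Cmeasurable (fun w => \sum_(i <- r | Q i) F i w).
Proof.
move=> mF; elim: r => [|i r ih].
  by under eq_fun do rewrite big_nil; exact: Cmeasurable_cst.
under eq_fun do rewrite big_cons.
case: (boolP (Q i)) => // Qi.
exact: CmeasurableD (mF _ Qi) ih.
Qed.

Lemma Cmeasurable_prod I (r : seq I) (Q : pred I) (F : I -> T -> R[i]) :
  (forall i, Q i -> Cmeasurable (F i)) ->
  Cmeasurable (fun w => \prod_(i <- r | Q i) F i w).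
Proof.
move=> mF; elim: r => [|i r ih].
  by under eq_fun do rewrite big_nil; exact: Cmeasurable_cst.
under eq_fun do rewrite big_cons.
case: (boolP (Q i)) => // Qi.
exact: CmeasurableM (mF _ Qi) ih.
Qed.

Lemma Cmeasurable_normc f :
  Cmeasurable f -> measurable_fun setT (fun w => normc (f w)).
Proof.
move=> [f1 f2].
have -> : (fun w => normc (f w)) =
    Num.sqrt \o (fun w => complex.Re (f w) ^+ 2 + complex.Im (f w) ^+ 2).
  by apply/funext => w /=; rewrite -normc_sqr sqrtr_sqr ger0_norm// normc_ge0.
apply: measurableT_comp; first exact: (continuous_measurable_fun (@sqrt_continuous R)).
exact: (measurable_funD (measurable_funX 2 f1) (measurable_funX 2 f2)).
Qed.

Lemma CmeasurableV f : Cmeasurable f -> Cmeasurable (fun w => (f w)^-1).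
Proof.
move=> mf; have mn := Cmeasurable_normc mf; move: (mf) => [f1 f2].
(* The real inverse is routed through the power function, with which it agrees on nonnegative reals,
   0 included. *)
have minv : measurable_fun setT (fun w => (normc (f w) ^+ 2)^-1).
  have -> : (fun w => (normc (f w) ^+ 2)^-1) =
      (fun u : R => u `^ (-1)) \o (fun w => normc (f w) ^+ 2).
    by apply/funext => w /=; rewrite powR_inv1// sqr_ge0.
  by apply: measurableT_comp; [exact: (measurable_powR (-1))|exact: measurable_funX].
split.
- have -> : (fun w => complex.Re (f w)^-1) =
      (fun w => complex.Re (f w) * (normc (f w) ^+ 2)^-1).
    by apply/funext => w; rewrite normc_sqr; case: (f w).
  exact: (measurable_funM f1 minv).
- have -> : (fun w => complex.Im (f w)^-1) =
      (fun w => - (complex.Im (f w) * (normc (f w) ^+ 2)^-1)).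
    by apply/funext => w; rewrite normc_sqr; case: (f w).
  exact: (measurable_funN (measurable_funM f2 minv)).
Qed.

Lemma Cmeasurable_det n (A : T -> 'M[R[i]]_n) :
  (forall i j, Cmeasurable (fun w => A w i j)) -> Cmeasurable (fun w => \det (A w)).
Proof.
move=> mA; apply: Cmeasurable_sum => s _.
apply: CmeasurableM; first exact: Cmeasurable_cst.
by apply: Cmeasurable_prod => i _; exact: mA.
Qed.

(** By the adjugate formula, the trace of the inverse is a rational function of the entries. *)
Lemma Cmeasurable_mxtrace_inv n (A : T -> 'M[R[i]]_n) :
  (forall i j, Cmeasurable (fun w => A w i j)) -> (forall w, A w \in unitmx) ->
  Cmeasurable (fun w => \tr (invmx (A w))).
Proof.
move=> mA uA; apply: Cmeasurable_sum => i _.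
apply: (@Cmeasurable_eq (fun w => (\det (A w))^-1 * cofactor (A w) i i)).
  by move=> w; rewrite /invmx uA !mxE.
apply: CmeasurableM; first by apply: CmeasurableV; exact: Cmeasurable_det.
apply: CmeasurableM; first exact: Cmeasurable_cst.
apply: Cmeasurable_det => k l.
by apply: (@Cmeasurable_eq (fun w => A w (lift i k) (lift i l))) => // w; rewrite !mxE.
Qed.

End complex_measurable.

Section Rintegral_complements.
Context d (T : measurableType d) (R : realType).
Variable mu : {measure set T -> \bar R}.

Lemma Rintegral_sum (D : set T) (I : Type) (r : seq I) (Q : pred I)
    (F : I -> T -> R) :
  measurable D -> (forall i, Q i -> mu.-integrable D (EFin \o F i)) ->
  mu.-integrable D (EFin \o (fun w => \sum_(i <- r | Q i) F i w)) /\
  \int[mu]_(w in D) (\sum_(i <- r | Q i) F i w) =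
  \sum_(i <- r | Q i) \int[mu]_(w in D) F i w.
Proof.
move=> mD iF; elim: r => [|i r [ih1 ih2]].
  have -> : (fun w => \sum_(i <- [::] | Q i) F i w) = cst 0.
    by apply/funext => w; rewrite big_nil.
  by rewrite big_nil; split; [exact: integrable0|rewrite /Rintegral integral0].
case: (boolP (Q i)) => Qi; last first.
  have -> : (fun w => \sum_(j <- i :: r | Q j) F j w) =
      (fun w => \sum_(j <- r | Q j) F j w).
    by apply/funext => w; rewrite big_cons (negbTE Qi).
  by rewrite big_cons (negbTE Qi).
have -> : (fun w => \sum_(j <- i :: r | Q j) F j w) =
    (fun w => F i w + \sum_(j <- r | Q j) F j w).
  by apply/funext => w; rewrite big_cons Qi.
rewrite big_cons Qi; split; last by rewrite RintegralD ?ih2//; exact: iF.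
exact: (integrableD mD (iF _ Qi) ih1).
Qed.

Lemma Rintegrable_le (D : set T) (f g : T -> R) : measurable D ->
  measurable_fun D f -> mu.-integrable D (EFin \o g) ->
  (forall w, D w -> `|f w| <= g w) -> mu.-integrable D (EFin \o f).
Proof.
move=> mD mf ig fg; apply: le_integrable ig => //; first exact/measurable_EFinP.
by move=> w Dw /=; rewrite lee_fin (le_trans (fg w Dw))// ler_norm.
Qed.

Lemma normr_Rintegral_le (D : set T) (f g : T -> R) : measurable D ->
  measurable_fun D f -> mu.-integrable D (EFin \o g) ->
  (forall w, D w -> `|f w| <= g w) ->
  `|\int[mu]_(w in D) f w| <= \int[mu]_(w in D) g w.
Proof.
move=> mD mf ig fg; have iF := Rintegrable_le mD mf ig fg.
apply: le_trans (le_normr_Rintegral mD iF) _; apply: le_Rintegral => //.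
exact: integrable_norm.
Qed.

End Rintegral_complements.

(** Reduces the expectation of a product of four entries to fourth moments. *)
Lemma prod4_le (R : realFieldType) (a b c e : R) :
  a * b * c * e <= (a ^+ 4 + b ^+ 4 + c ^+ 4 + e ^+ 4) / 4.
Proof.
have h (u v : R) : u * v <= (u ^+ 2 + v ^+ 2) / 2.
  have := sqr_ge0 (u - v); lra.
have h1 := h (a * b) (c * e); have h2 := h (a ^+ 2) (b ^+ 2).
have h3 := h (c ^+ 2) (e ^+ 2).
have e1 (u v : R) : (u * v) ^+ 2 = u ^+ 2 * v ^+ 2 by rewrite exprMn.
have e2 (u : R) : u ^+ 4 = (u ^+ 2) ^+ 2 by rewrite -exprM.
rewrite !e1 in h1; rewrite !e2 -mulrA; lra.
Qed.

(** * Moments of the noise and the second-order expansion *)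

Section hermitian_entries.
Context d (T : measurableType d) (R : realType) (P : probability T R) (n : nat).
Variable x : T -> 'M[R[i]]_n.+1.
Hypothesis x_herm : forall w, x w \is hermsymmx.
Hypothesis x_meas : forall i j, measurable_fun setT (fun w => coords (x w i j)).
Hypothesis x_indep : mutually_independent P
  [set p : 'I_n.+1 * 'I_n.+1 | (p.1 <= p.2)%N]%SET
  (fun p w => coords (x w p.1 p.2)).
Hypothesis x_centered : forall i j,
  ('E_P[fun w => complex.Re (x w i j)] = 0)%E /\
  ('E_P[fun w => complex.Im (x w i j)] = 0)%E.
Variable K : R.
Hypothesis x_moment4 : forall i j,
  (\int[P]_w (normc (x w i j) ^+ 4)%:E <= K%:E)%E.

Implicit Types e : 'I_n.+1 * 'I_n.+1.

Let X e w := coords (x w e.1 e.2).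

(** Independence is assumed on and above the diagonal only. A position and its transpose carry
    conjugate entries and share this representative. *)
Definition upper_index e := if (e.1 <= e.2)%N then e else (e.2, e.1).

Let conj_pair (u : R * R) : R * R := (u.1, - u.2).

Lemma x_conj w i j : x w j i = (x w i j)^*.
Proof.
have /is_hermitianmxP := x_herm w; rewrite expr0 scale1r => /matrixP/(_ j i) ->.
by rewrite !mxE.
Qed.

Lemma measurable_conj_pair : measurable_fun setT conj_pair.
Proof.
apply: measurable_fun_pair; first exact: measurable_fst.
exact: (measurable_funN (@measurable_snd _ _ R R)).
Qed.

(** Restates an event about entry e as an event about its representative, reflecting the set by
    conjugation below the diagonal. *)
Let upper_set e (B : set (R * R)) :=
  if (e.1 <= e.2)%N then B else conj_pair @^-1` B.

Lemma measurable_upper_set e B : measurable B -> measurable (upper_set e B).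
Proof.
rewrite /upper_set; case: ifP => // _ mB.
by rewrite -[X in measurable X]setTI; exact: measurable_conj_pair.
Qed.

Lemma preimage_entry e B :
  X e @^-1` B = X (upper_index e) @^-1` (upper_set e B).
Proof.
rewrite /upper_set /upper_index; case: ifP => // _.
by rewrite /X /preimage/= /conj_pair; apply/funext => w /=; rewrite x_conj; case: (x w _ _).
Qed.

Lemma upper_index_in e :
  upper_index e \in [set p : 'I_n.+1 * 'I_n.+1 | (p.1 <= p.2)%N]%SET.
Proof.
by rewrite inE /upper_index; case: ifP => //= /negbT; rewrite -ltnNge => /ltnW.
Qed.

Lemma entries4_independent e1 e2 e3 e4 B1 B2 B3 B4 :
  uniq [:: upper_index e1; upper_index e2; upper_index e3; upper_index e4] ->
  measurable B1 -> measurable B2 -> measurable B3 -> measurable B4 ->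
  (P (X e1 @^-1` B1 `&` (X e2 @^-1` B2 `&` (X e3 @^-1` B3 `&` X e4 @^-1` B4))) =
   P (X e1 @^-1` B1) * (P (X e2 @^-1` B2) *
     (P (X e3 @^-1` B3) * P (X e4 @^-1` B4))))%E.
Proof.
move=> u mB1 mB2 mB3 mB4; rewrite (preimage_entry e1) (preimage_entry e2) (preimage_entry e3) (preimage_entry e4).
set p1 := upper_index e1 in u *; set p2 := upper_index e2 in u *.
set p3 := upper_index e3 in u *; set p4 := upper_index e4 in u *.
move: u; rewrite /= !inE !negb_or -!andbA ?andbT => /and4P[h12 h13 h14 /and3P[h23 h24 h34]].
(* Independence takes a single family of sets indexed by positions; distinctness of the four
   representatives lets one family carry the four given sets. *)
pose B p := if p == p1 then upper_set e1 B1 else if p == p2 then upper_set e2 B2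
  else if p == p3 then upper_set e3 B3 else upper_set e4 B4.
have b1 : B p1 = upper_set e1 B1 by rewrite /B eqxx.
have b2 : B p2 = upper_set e2 B2 by rewrite /B eq_sym (negbTE h12) eqxx.
have b3 : B p3 = upper_set e3 B3.
  by rewrite /B [p3 == p1]eq_sym (negbTE h13) [p3 == p2]eq_sym (negbTE h23) eqxx.
have b4 : B p4 = upper_set e4 B4.
  by rewrite /B [p4 == p1]eq_sym (negbTE h14) [p4 == p2]eq_sym (negbTE h24)
    [p4 == p3]eq_sym (negbTE h34).
have := @x_indep [set p1; p2; p3; p4]%SET B.
have -> : \bigcap_(i in [set` [set p1; p2; p3; p4]%SET]) (X i @^-1` B i) =
    X p1 @^-1` upper_set e1 B1 `&` (X p2 @^-1` upper_set e2 B2 `&`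
      (X p3 @^-1` upper_set e3 B3 `&` X p4 @^-1` upper_set e4 B4)).
  rewrite -b1 -b2 -b3 -b4; apply/seteqP; split => w /=.
    by move=> h; do !split; apply: h; rewrite /= !inE eqxx ?orbT.
  move=> [h1 [h2 [h3 h4]]] p /=; rewrite !inE -!orbA.
  by move=> /or4P[] /eqP ->.
move=> -> //; last first.
- by move=> p _; rewrite /B; do !case: ifP => _; exact: measurable_upper_set.
- apply/fintype.subsetP => p; rewrite !finset.in_setU !finset.in_set1 -!orbA.
  by move=> /or4P[] /eqP ->; exact: upper_index_in.
rewrite -!finset.setUA !big_setU1 ?big_set1/= ?b1 ?b2 ?b3 ?b4//.
- by rewrite !inE.
- by rewrite !inE negb_or h23.
- by rewrite !inE !negb_or h12 h13.
Qed.

Lemma Cmeasurable_entry i j : Cmeasurable (fun w => x w i j).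
Proof. exact: Cmeasurable_coords. Qed.

Lemma integrable_normc4 i j :
  P.-integrable setT (EFin \o (fun w => normc (x w i j) ^+ 4)).
Proof.
apply/integrableP; split.
  by apply/measurable_EFinP; apply: measurable_funX; exact: Cmeasurable_normc (Cmeasurable_entry i j).
apply: le_lt_trans (ltry K); apply: le_trans (x_moment4 i j).
by rewrite le_eqVlt; apply/orP; left; apply/eqP; apply: eq_integral => w _;
  rewrite gee0_abs// lee_fin exprn_ge0// normc_ge0.
Qed.

Lemma Rintegral_normc4 i j : \int[P]_w (normc (x w i j) ^+ 4) <= K.
Proof.
rewrite -lee_fin /Rintegral fineK; first exact: x_moment4.
by apply: integrable_fin_num => //; exact: integrable_normc4.
Qed.

(** 1 + |x|^4 is the common dominating function for the first and second powers of |x|. *)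
Lemma integrable_1normc4 i j :
  P.-integrable setT (EFin \o (fun w => 1 + normc (x w i j) ^+ 4)).
Proof.
have := integrableD measurableT (finite_measure_integrable_cst P 1 measurableT)
  (integrable_normc4 i j).
by apply.
Qed.

Lemma integrable_entry i j :
  P.-integrable setT (EFin \o (fun w => complex.Re (x w i j))) /\
  P.-integrable setT (EFin \o (fun w => complex.Im (x w i j))).
Proof.
have [m1 m2] := Cmeasurable_entry i j.
have h w : normc (x w i j) <= 1 + normc (x w i j) ^+ 4.
  have n0 := normc_ge0 (x w i j).
  have := sqr_ge0 (normc (x w i j) ^+ 2 - 1); have := sqr_ge0 (normc (x w i j) - 1).
  rewrite (_ : normc (x w i j) ^+ 4 = (normc (x w i j) ^+ 2) ^+ 2) -?exprM//; nra.
split; apply: (Rintegrable_le _ _ (integrable_1normc4 i j)) => // w _.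
- exact: le_trans (CRe_le_normc _) (h w).
- exact: le_trans (CIm_le_normc _) (h w).
Qed.

Lemma integrable_normc2 i j :
  P.-integrable setT (EFin \o (fun w => normc (x w i j) ^+ 2)) /\
  \int[P]_w (normc (x w i j) ^+ 2) <= 1 + K.
Proof.
have h w : `|normc (x w i j) ^+ 2| <= 1 + normc (x w i j) ^+ 4.
  rewrite ger0_norm ?sqr_ge0// (_ : _ ^+ 4 = (normc (x w i j) ^+ 2) ^+ 2) -?exprM//.
  have := sqr_ge0 (normc (x w i j) ^+ 2 - 1); nra.
have m : measurable_fun setT (fun w => normc (x w i j) ^+ 2).
  by apply: measurable_funX; exact: Cmeasurable_normc (Cmeasurable_entry i j).
split; first exact: (Rintegrable_le _ m (integrable_1normc4 i j)).
apply: le_trans (ler_norm _) _.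
apply: le_trans (normr_Rintegral_le _ m (integrable_1normc4 i j) (fun w _ => h w)) _ => //.
rewrite RintegralD//; [|exact: (finite_measure_integrable_cst P 1)|exact: integrable_normc4].
rewrite Rintegral_cst// mul1r lerD ?Rintegral_normc4//.
by have /(congr1 fine)/= -> := probability_setT P.
Qed.

Let bound4 (c : R) e1 e2 e3 e4 w : R := c * ((normc (x w e1.1 e1.2) ^+ 4
  + normc (x w e2.1 e2.2) ^+ 4 + normc (x w e3.1 e3.2) ^+ 4
  + normc (x w e4.1 e4.2) ^+ 4) / 4).

Lemma integrable_bound4 c e1 e2 e3 e4 :
  P.-integrable setT (EFin \o bound4 c e1 e2 e3 e4) /\
  \int[P]_w bound4 c e1 e2 e3 e4 w = c * ((\int[P]_w (normc (x w e1.1 e1.2) ^+ 4)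
  + \int[P]_w (normc (x w e2.1 e2.2) ^+ 4) + \int[P]_w (normc (x w e3.1 e3.2) ^+ 4)
  + \int[P]_w (normc (x w e4.1 e4.2) ^+ 4)) / 4).
Proof.
have i4 e := integrable_normc4 e.1 e.2.
pose F i w := normc (x w (nth e1 [:: e1; e2; e3; e4] i).1
                         (nth e1 [:: e1; e2; e3; e4] i).2) ^+ 4.
have [iS ES] := @Rintegral_sum _ _ _ P setT nat (iota 0 4) predT F measurableT
  (fun i _ => i4 _).
have bE : bound4 c e1 e2 e3 e4 =
    (fun w => (c / 4) * \sum_(i <- iota 0 4) F i w).
  by apply/funext => w; rewrite /bound4 !big_cons big_nil /F/=; ring.
rewrite bE; split.
  exact: integrableZl iS.
by rewrite RintegralZl// ES !big_cons big_nil /F/=; ring.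
Qed.

(** A term of the expansion of |sum_k x_ik r_k x_kj|^2. The first entry is set apart as the factor
    to be integrated out by centering. *)
Let quad c e1 e2 e3 e4 w : R[i] :=
  x w e1.1 e1.2 * (c * x w e2.1 e2.2 * (x w e3.1 e3.2)^* * (x w e4.1 e4.2)^*).

Lemma normc_quad_le c e1 e2 e3 e4 w :
  normc (quad c e1 e2 e3 e4 w) <= bound4 (normc c) e1 e2 e3 e4 w.
Proof.
rewrite /quad !ComplexField.Normc.normcM !normc_conj /bound4.
set a := normc (x w e1.1 _); set b := normc (x w e2.1 _).
set u := normc (x w e3.1 _); set v := normc (x w e4.1 _).
rewrite (_ : _ * _ = normc c * (a * b * u * v)); last by ring.
by apply: ler_wpM2l; [exact: normc_ge0|exact: prod4_le].
Qed.

Lemma Cmeasurable_quad c e1 e2 e3 e4 : Cmeasurable (quad c e1 e2 e3 e4).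
Proof.
apply: CmeasurableM; first exact: Cmeasurable_entry.
apply: CmeasurableM; last by apply: Cmeasurable_conj; exact: Cmeasurable_entry.
apply: CmeasurableM; last by apply: Cmeasurable_conj; exact: Cmeasurable_entry.
by apply: CmeasurableM; [exact: Cmeasurable_cst|exact: Cmeasurable_entry].
Qed.

Lemma integrable_quad c e1 e2 e3 e4 :
  P.-integrable setT (EFin \o (fun w => complex.Re (quad c e1 e2 e3 e4 w))).
Proof.
have [ib _] := integrable_bound4 (normc c) e1 e2 e3 e4.
apply: (Rintegrable_le _ _ ib) => //.
  by have [] := Cmeasurable_quad c e1 e2 e3 e4.
by move=> w _; exact: le_trans (CRe_le_normc _) (normc_quad_le _ _ _ _ _ _).
Qed.

Lemma expectation_quad_le c e1 e2 e3 e4 :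
  `|\int[P]_w complex.Re (quad c e1 e2 e3 e4 w)| <= normc c * K.
Proof.
have [ib Eb] := integrable_bound4 (normc c) e1 e2 e3 e4.
apply: le_trans (normr_Rintegral_le _ _ ib _) _ => //.
- by have [] := Cmeasurable_quad c e1 e2 e3 e4.
- by move=> w _; exact: le_trans (CRe_le_normc _) (normc_quad_le _ _ _ _ _ _).
rewrite Eb ler_wpM2l ?normc_ge0//.
have h e := Rintegral_normc4 e.1 e.2.
have := h e1; have := h e2; have := h e3; have := h e4; lra.
Qed.

Lemma measurable_X e : measurable_fun setT (X e).
Proof. exact: x_meas. Qed.

(** The first entry is independent of the triple of the others: [independence_pair] is used once for
    the last two entries, under P restricted to an event on the second, and once more to join the
    second to them. *)
Lemma entries_independent_tail e1 e2 e3 e4 :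
  uniq [:: upper_index e1; upper_index e2; upper_index e3; upper_index e4] ->
  forall B C, measurable B -> measurable C ->
  (P (X e1 @^-1` B `&` (fun w => (X e2 w, (X e3 w, X e4 w))) @^-1` C) =
   P (X e1 @^-1` B) * P ((fun w => (X e2 w, (X e3 w, X e4 w))) @^-1` C))%E.
Proof.
move=> u B C mB mC.
have mpre e A : measurable A -> measurable (X e @^-1` A).
  by move=> mA; rewrite -[Y in measurable Y]setTI; exact: measurable_X.
have fE : (0 <= fine (P (X e1 @^-1` B)))%R by rewrite fine_ge0.
pose c := NngNum fE.
have cE : (c%:num%:E = P (X e1 @^-1` B))%E 
  by rewrite [LHS]fineK//; apply: fin_num_measure; exact: mpre.
have P3 B2 B3 B4 : measurable B2 -> measurable B3 -> measurable B4 ->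
    (P (X e2 @^-1` B2 `&` (X e3 @^-1` B3 `&` X e4 @^-1` B4)) =
     P (X e2 @^-1` B2) * (P (X e3 @^-1` B3) * P (X e4 @^-1` B4)))%E.
  move=> m2 m3 m4.
  have := entries4_independent u measurableT m2 m3 m4.
  by rewrite preimage_setT setTI probability_setT mul1e.
have Poo : (P setT < +oo)%E by rewrite probability_setT ltry.
have step B2 : measurable B2 -> forall D, measurable D ->
   (P (X e1 @^-1` B `&` (X e2 @^-1` B2 `&` (fun w => (X e3 w, X e4 w)) @^-1` D)) =
    c%:num%:E * P (X e2 @^-1` B2 `&` (fun w => (X e3 w, X e4 w)) @^-1` D))%E.
  move=> m2 D mD.
  have moo : (mrestr P (mpre e2 _ m2) setT < +oo)%E.
    rewrite /mrestr (le_lt_trans _ Poo)// le_measure ?inE//.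
    by apply: measurableI => //; exact: mpre.
  have h B3 B4 : measurable B3 -> measurable B4 ->
     (mrestr P (mpre e2 _ m2) (X e1 @^-1` B `&` (X e3 @^-1` B3 `&` X e4 @^-1` B4)) =
      c%:num%:E * mrestr P (mpre e2 _ m2) (X e3 @^-1` B3 `&` X e4 @^-1` B4))%E.
    move=> m3 m4; rewrite /mrestr.
    rewrite -setIA [X e3 @^-1` _ `&` _ `&` _]setIC cE P3//.
    by rewrite entries4_independent.
  have eD := @independence_pair R _ _ _ T _ _ (mrestr P (mpre e2 _ m2))
    (X e1 @^-1` B) c (X e3) (X e4) moo (mpre e1 _ mB) (measurable_X e3)
    (measurable_X e4) h D mD.
  by rewrite [X e2 @^-1` B2 `&` _]setIC setIA; exact: eD.
rewrite -cE.
exact: (@independence_pair R _ _ _ T _ _ P (X e1 @^-1` B) c (X e2)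
    (fun w => (X e3 w, X e4 w)) Poo (mpre e1 _ mB) (measurable_X e2)
    (measurable_fun_pair (measurable_X e3) (measurable_X e4))
    (fun B2 D m2 mD => step B2 m2 D mD) C mC).
Qed.

Let cx (u : R * R) : R[i] := Complex u.1 u.2.

(** With four distinct representatives the first entry is centered and independent of the rest W.
    The real part of the product is a difference of two real products, each of which has mean
    zero. *)
Lemma expectation_quad0 c e1 e2 e3 e4 :
  uniq [:: upper_index e1; upper_index e2; upper_index e3; upper_index e4] ->
  \int[P]_w complex.Re (quad c e1 e2 e3 e4 w) = 0.
Proof.
move=> u.
pose Z w := (X e2 w, (X e3 w, X e4 w)).
have mZ : measurable_fun setT Z.
  by apply: measurable_fun_pair; [exact: measurable_X|
    apply: measurable_fun_pair; exact: measurable_X].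
pose W (v : (R * R) * ((R * R) * (R * R))) :=
  c * cx v.1 * (cx v.2.1)^* * (cx v.2.2)^*.
have mcx d' (V : measurableType d') (g : V -> R * R) : measurable_fun setT g ->
    Cmeasurable (fun v => cx (g v)).
  by move=> mg; split; [exact: measurableT_comp measurable_fst mg|
    exact: measurableT_comp measurable_snd mg].
have mW : Cmeasurable W.
  apply: CmeasurableM; last first.
    by apply: Cmeasurable_conj; apply: mcx; exact: measurableT_comp.
  apply: CmeasurableM; last first.
    by apply: Cmeasurable_conj; apply: mcx; exact: measurableT_comp.
  by apply: CmeasurableM; [exact: Cmeasurable_cst|apply: mcx; exact: measurable_fst].
have qE w : quad c e1 e2 e3 e4 w = x w e1.1 e1.2 * W (Z w).
  have xE e : cx (X e w) = x w e.1 e.2 by rewrite /cx /X /coords; case: (x w e.1 e.2).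
  by rewrite /quad -(xE e2) -(xE e3) -(xE e4).
have [ib _] := integrable_bound4 (normc c) e1 e2 e3 e4.
have nW w : normc (x w e1.1 e1.2) * normc (W (Z w)) <= bound4 (normc c) e1 e2 e3 e4 w.
  by rewrite -ComplexField.Normc.normcM -qE; exact: normc_quad_le.
have [mx1 mx2] := Cmeasurable_entry e1.1 e1.2.
have [mW1 mW2] := mW.
have [i1 i2] := integrable_entry e1.1 e1.2.
have iRe : P.-integrable setT
    (EFin \o (fun w => complex.Re (x w e1.1 e1.2) * complex.Re (W (Z w)))).
  apply: (Rintegrable_le _ _ ib) => //.
    exact: (measurable_funM mx1 (measurableT_comp mW1 mZ)).
  move=> w _; apply: le_trans (nW w); rewrite normrM.
  by apply: ler_pM => //; exact: CRe_le_normc.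
have iIm : P.-integrable setT
    (EFin \o (fun w => complex.Im (x w e1.1 e1.2) * complex.Im (W (Z w)))).
  apply: (Rintegrable_le _ _ ib) => //.
    exact: (measurable_funM mx2 (measurableT_comp mW2 mZ)).
  move=> w _; apply: le_trans (nW w); rewrite normrM.
  by apply: ler_pM => //; exact: CIm_le_normc.
under eq_Rintegral do rewrite qE CReM.
rewrite RintegralB//.
have [c1 c2] := x_centered e1.1 e1.2; rewrite unlock in c1; rewrite unlock in c2.
have ind := entries_independent_tail u.
have z1 := @integral_mul_centered R _ _ _ T _ _ P (X e1) Z fst (fun v => complex.Re (W v))
  (measurable_X e1) mZ measurable_fst mW1 ind i1 iRe c1.
have z2 := @integral_mul_centered R _ _ _ T _ _ P (X e1) Z snd (fun v => complex.Im (W v))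
  (measurable_X e1) mZ measurable_snd mW2 ind i2 iIm c2.
by rewrite /Rintegral z1 z2 subrr.
Qed.

Lemma upper_index_eq e e' :
  upper_index e = upper_index e' -> e = e' \/ e = (e'.2, e'.1).
Proof.
case: e e' => [i k] [j l]; rewrite /upper_index /=.
by case: ifP => _; case: ifP => _ [-> ->]; [left|right|right|left].
Qed.

(** Any coincidence among the representatives of these four positions forces i = j, k = l or {k, l}
    = {i, j}. *)
Lemma uniq_upper_index i j k l : i != j -> k != l ->
  ~~ ((k == i) && (l == j)) -> ~~ ((k == j) && (l == i)) ->
  uniq [:: upper_index (i, k); upper_index (k, j);
           upper_index (i, l); upper_index (l, j)].
Proof.
move=> ij kl h1 h2; rewrite /= !inE !negb_or andbT -!andbA.
apply/and5P; split; last (apply/andP; split);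
  apply/negP => /eqP/upper_index_eq[] []; move=> *; subst;
  by rewrite ?eqxx in ij kl h1 h2.
Qed.

Lemma moment4_ge0 : 0 <= K.
Proof.
apply: le_trans (Rintegral_normc4 ord0 ord0); apply: Rintegral_ge0 => w _.
by rewrite exprn_ge0// normc_ge0.
Qed.

(** Only index quadruples with a coincidence contribute, each at most rho^2 K. With N = n + 1, the
    cases j = i and k = l give N^3 quadruples each and the two pairings of {k, l} with {i, j} give
    N^2 each, whence 2 N^3 + 2 N^2 <= 4 N^3. Scaling the entries by N^(-1/2) divides the bound by
    N^2, which leaves O(N). *)
Lemma expectation_sandwich (r : 'I_n.+1 -> R[i]) (rho : R) : 0 <= rho ->
  (forall k, normc (r k) <= rho) ->
  let Q w : R := \sum_i \sum_j normc (\sum_k x w i k * r k * x w k j) ^+ 2 in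
  P.-integrable setT (EFin \o Q) /\
  \int[P]_w Q w <= 4 * rho ^+ 2 * K * n.+1%:R ^+ 3.
Proof.
move=> rho0 rrho Q; have K0 := moment4_ge0.
pose q i j k l w := complex.Re (quad (r k * (r l)^*) (i, k) (k, j) (i, l) (l, j) w).
have QE : Q = fun w => \sum_i \sum_j \sum_k \sum_l q i j k l w.
  apply/funext => w; apply: eq_bigr => i _; apply: eq_bigr => j _.
  have nE (u : R[i]) : normc u ^+ 2 = complex.Re (u * u^*) by rewrite mulc_conj.
  rewrite nE rmorph_sum/= mulr_suml CRe_sum; apply: eq_bigr => k _.
  rewrite mulr_sumr CRe_sum; apply: eq_bigr => l _.
  rewrite /q /quad/=; congr complex.Re; rewrite !rmorphM/=; ring.
have iq i j k l : P.-integrable setT (EFin \o q i j k l) by exact: integrable_quad.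
have s1 i j k := @Rintegral_sum _ _ _ P setT _ (index_enum 'I_n.+1) predT
  (q i j k) measurableT (fun l _ => iq i j k l).
have s2 i j := @Rintegral_sum _ _ _ P setT _ (index_enum 'I_n.+1) predT
  _ measurableT (fun k _ => (s1 i j k).1).
have s3 i := @Rintegral_sum _ _ _ P setT _ (index_enum 'I_n.+1) predT
  _ measurableT (fun j _ => (s2 i j).1).
have s4 := @Rintegral_sum _ _ _ P setT _ (index_enum 'I_n.+1) predT
  _ measurableT (fun i _ => (s3 i).1).
rewrite QE; split; first exact: s4.1.
rewrite s4.2; under eq_bigr do rewrite (s3 _).2.
under eq_bigr do under eq_bigr do rewrite (s2 _ _).2.
under eq_bigr do under eq_bigr do under eq_bigr do rewrite (s1 _ _ _).2.
have N1 : 1 <= n.+1%:R :> R by rewrite ler1n.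
set N : R := n.+1%:R in N1 *.
have sumc (a : R) : \sum_(i < n.+1) a = N * a by rewrite sumr_const card_ord mulr_natl.
have dlt (i : 'I_n.+1) : \sum_(j < n.+1) (j == i)%:R = 1 :> R.
  by rewrite (bigD1 i)//= eqxx big1 ?addr0// => j /negbTE ->//.
have dlt' (i : 'I_n.+1) : \sum_(j < n.+1) (i == j)%:R = 1 :> R.
  by apply: etrans (dlt i); apply: eq_bigr => j _; rewrite eq_sym.
(* The bracket counts the coincidences that hold: if it is positive the crude moment bound is used,
   otherwise the expectation vanishes. *)
have bq i j k l : \int[P]_w q i j k l w <= rho ^+ 2 * K *
    ((j == i)%:R + (k == l)%:R + (k == i)%:R * (l == j)%:R
      + (k == j)%:R * (l == i)%:R).
  have q0 : 0 <= rho ^+ 2 * K by rewrite mulr_ge0// sqr_ge0.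
  have qle : \int[P]_w q i j k l w <= rho ^+ 2 * K.
    apply: le_trans (ler_norm _) _; apply: le_trans (expectation_quad_le _ _ _ _ _) _.
    rewrite ler_wpM2r// ComplexField.Normc.normcM normc_conj expr2.
    by apply: ler_pM; rewrite ?normc_ge0.
  have pos (b : bool) : 0 <= b%:R :> R by exact: ler0n.
  have [ji|ji] := eqVneq j i.
    apply: le_trans qle _; rewrite -[leLHS]mulr1 ler_wpM2l// -!addrA lerDl.
    by rewrite !addr_ge0// mulr_ge0.
  have [kl|kl] := eqVneq k l.
    apply: le_trans qle _; rewrite -[leLHS]mulr1 ler_wpM2l// add0r -addrA lerDl.
    by rewrite addr_ge0// mulr_ge0.
  rewrite !add0r -!natrM !mulnb.
  case: (boolP ((k == i) && (l == j))) => h1.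
    by apply: le_trans qle _; rewrite -[leLHS]mulr1 ler_wpM2l// lerDl.
  case: (boolP ((k == j) && (l == i))) => h2.
    by apply: le_trans qle _; rewrite -[leLHS]mulr1 ler_wpM2l// lerDr.
  rewrite addr0 mulr0 le_eqVlt; apply/orP; left; apply/eqP.
  by apply: expectation_quad0; apply: uniq_upper_index => //; rewrite eq_sym.
apply: (@le_trans _ _ (\sum_(i < n.+1) \sum_(j < n.+1) \sum_(k < n.+1)
    \sum_(l < n.+1) rho ^+ 2 * K *
    ((j == i)%:R + (k == l)%:R + (k == i)%:R * (l == j)%:R
      + (k == j)%:R * (l == i)%:R))).
  by do 4!(apply: ler_sum => ? _).
have inner i j : \sum_(k < n.+1) \sum_(l < n.+1) rho ^+ 2 * K *
    ((j == i)%:R + (k == l)%:R + (k == i)%:R * (l == j)%:R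
      + (k == j)%:R * (l == i)%:R) = rho ^+ 2 * K * ((j == i)%:R * N ^+ 2 + N + 2).
  under eq_bigr do rewrite -mulr_sumr.
  rewrite -mulr_sumr; congr (_ * _).
  under eq_bigr do rewrite !big_split/= -!mulr_sumr !dlt dlt' sumc !mulr1.
  by rewrite !big_split/= !sumc !dlt; ring.
under eq_bigr do under eq_bigr do rewrite inner.
under eq_bigr do rewrite -mulr_sumr !big_split/= -mulr_suml dlt !sumc.
rewrite sumc.
rewrite (_ : N * _ = rho ^+ 2 * K * (N * (N ^+ 2 + N * N + 2 * N))); last by ring.
rewrite (_ : 4 * _ * _ * _ = rho ^+ 2 * K * (4 * N ^+ 3)); last by ring.
apply: ler_wpM2l; first by rewrite mulr_ge0// sqr_ge0.
have N2 : N ^+ 2 <= N ^+ 3 by rewrite ler_weXn2l.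
rewrite !exprS expr0 in N2 *; lra.
Qed.

(** Disposes of the term of order sqrt t in the trace, which is linear in the centered diagonal
    entries. *)
Lemma expectation_diag0 (a : 'I_n.+1 -> R[i]) :
  let L w := \sum_i complex.Re (a i * x w i i) in
  P.-integrable setT (EFin \o L) /\ \int[P]_w L w = 0.
Proof.
move=> L.
have ie i : P.-integrable setT (EFin \o (fun w => complex.Re (a i * x w i i))) /\
    \int[P]_w complex.Re (a i * x w i i) = 0.
  have [i1 i2] := integrable_entry i i.
  have [c1 c2] := x_centered i i; rewrite unlock in c1; rewrite unlock in c2.
  have j1 : P.-integrable setT (EFin \o
    (fun w => complex.Re (a i) * complex.Re (x w i i))) by exact: integrableZl i1.
  have j2 : P.-integrable setT (EFin \o
    (fun w => complex.Im (a i) * complex.Im (x w i i))) by exact: integrableZl i2.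
  have -> : (fun w => complex.Re (a i * x w i i)) = (fun w =>
      complex.Re (a i) * complex.Re (x w i i) - complex.Im (a i) * complex.Im (x w i i)).
    by apply/funext => w; rewrite CReM.
  split; first exact: (integrableB measurableT j1 j2).
  rewrite RintegralB// RintegralZl// RintegralZl//.
  by rewrite /Rintegral c1 c2 /= !mulr0 subrr.
have [iS ES] := @Rintegral_sum _ _ _ P setT _ (index_enum 'I_n.+1) predT
  _ measurableT (fun i _ => (ie i).1).
by split=> //; rewrite ES big1// => i _; exact: (ie i).2.
Qed.

Lemma expectation_normc2_sum (a : 'I_n.+1 -> 'I_n.+1 -> R) :
  let F w := \sum_i \sum_j a i j * normc (x w i j) ^+ 2 in
  P.-integrable setT (EFin \o F) /\
  \int[P]_w F w = \sum_i \sum_j a i j * \int[P]_w (normc (x w i j) ^+ 2).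
Proof.
move=> F.
have ia i j : P.-integrable setT (EFin \o (fun w => a i j * normc (x w i j) ^+ 2)).
  exact: (integrableZl measurableT (a i j) (integrable_normc2 i j).1).
have s1 i := @Rintegral_sum _ _ _ P setT _ (index_enum 'I_n.+1) predT
  _ measurableT (fun j _ => ia i j).
have s2 := @Rintegral_sum _ _ _ P setT _ (index_enum 'I_n.+1) predT
  _ measurableT (fun i _ => (s1 i).1).
split; first exact: s2.1.
rewrite s2.2; apply: eq_bigr => i _; rewrite (s1 i).2; apply: eq_bigr => j _.
by rewrite RintegralZl//; have [] := integrable_normc2 i j.
Qed.

Lemma hermitian_scale (a : R) w : toC a *: x w \is hermsymmx.
Proof.
apply/is_hermitianmxP; rewrite expr0 scale1r; apply/matrixP => i j.
rewrite !mxE x_conj rmorphM/=; congr (_ * _).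
by apply: Complex_eq; rewrite ?CRe_conj ?CIm_conj//= oppr0.
Qed.

Lemma perturbedE (lam : 'I_n.+1 -> R) w t : perturbed lam (x w) t =
  diag_mx (\row_i toC (lam i)) +
  toC (Num.sqrt t) *: (toC ((Num.sqrt n.+1%:R)^-1) *: x w).
Proof. by []. Qed.

Lemma perturbed_hermitian (lam : 'I_n.+1 -> R) w t (z : R[i]) : complex.Im z != 0 ->
  perturbed lam (x w) t \is hermsymmx.
Proof.
move=> z0; rewrite perturbedE.
by have [] := resolvent_expansion lam (Num.sqrt t)
  (hermitian_scale (Num.sqrt n.+1%:R)^-1 w) z0.
Qed.

Lemma Cmeasurable_resolvent (lam : 'I_n.+1 -> R) (z : R[i]) t : complex.Im z != 0 ->
  Cmeasurable (fun w => \tr (invmx (z%:M - perturbed lam (x w) t))).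
Proof.
move=> z0; apply: Cmeasurable_mxtrace_inv.
  move=> i j; apply: (@Cmeasurable_eq _ _ _ (fun w =>
    (z%:M - diag_mx (\row_i toC (lam i)) : 'M[R[i]]_n.+1) i j +
     - (toC (Num.sqrt t) * toC ((Num.sqrt n.+1%:R)^-1) * x w i j))).
    by move=> w; rewrite perturbedE !mxE; ring.
  apply: CmeasurableD; first exact: Cmeasurable_cst.
  apply: CmeasurableN; apply: CmeasurableM; first exact: Cmeasurable_cst.
  exact: Cmeasurable_entry.
by move=> w; apply: resolvent_unitmx => //; exact: perturbed_hermitian z0.
Qed.

Section expected_resolvent.
Variables (lam : 'I_n.+1 -> R) (z c : R[i]) (t : R).
Let N : R := n.+1%:R.
Let y : R := `|complex.Im z|.
Let r i := (z - toC (lam i))^-1.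

(** The expansion of [resolvent_expansion], integrated and divided by the dimension. Both Frobenius
    terms of the remainder are of the order of the dimension in expectation, so the bound does not
    depend on n. *)
Lemma expected_resolvent : complex.Im z != 0 -> normc c <= 1 -> 0 <= t ->
  `| \int[P]_w (N^-1 * complex.Re (c * \tr (invmx (z%:M - perturbed lam (x w) t))))
     - (N^-1 * complex.Re (c * \sum_i r i) + t * (N ^- 2 * \sum_i \sum_j
          complex.Re (c * (r i ^+ 2 * r j)) * \int[P]_w (normc (x w i j) ^+ 2))) |
  <= Num.sqrt t ^+ 3 * (y ^- 2 * (1 + K + y ^- 2 * (4 * y ^- 2 * K))).
Proof.
move=> z0 c1 t0.
have y0 : 0 < y by rewrite normr_gt0.
have N0 : 0 < N by rewrite ltr0n.
have K0 := moment4_ge0.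
set S := Num.sqrt t; have S0 : 0 <= S by exact: sqrtr_ge0.
have St : S ^+ 2 = t by rewrite sqr_sqrtr.
pose a : R := (Num.sqrt N)^-1.
have a2 : a ^+ 2 = N^-1 by rewrite /a exprVn sqr_sqrtr// ltW.
pose h w := N^-1 * complex.Re (c * \tr (invmx (z%:M - perturbed lam (x w) t))).
pose kap := N^-1 * complex.Re (c * \sum_i r i).
pose L w := \sum_i complex.Re (c * r i ^+ 2 * x w i i).
pose Q w := \sum_i \sum_j complex.Re (c * (r i ^+ 2 * r j)) * normc (x w i j) ^+ 2.
pose F2 w := \sum_i \sum_j 1 * normc (x w i j) ^+ 2.
pose F4 w := \sum_i \sum_j normc (\sum_k x w i k * r k * x w k j) ^+ 2.
(* What is left of h after the terms through order t: N^-1 S^3 times the real part of c times the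
   cubic remainder. *)
pose E w := h w - (kap + (S * (N^-1 * a)) * L w + (t * N ^- 2) * Q w).
(* Powers of N: one N^-1 normalizes the trace, then the two factors a in F2 give N^-1 and the four
   factors a in F4 give N^-2. *)
pose B w := (S ^+ 3 * (y ^- 2 * N ^- 2)) * F2 w
  + (S ^+ 3 * (y ^- 2 * y ^- 2 * N ^- 3)) * F4 w.
have EB w : `|E w| <= B w.
  pose Xw := toC a *: x w.
  have [_ Etr Hrem] := resolvent_expansion lam S (hermitian_scale a w) z0.
  set rem := resolvent_remainder _ _ _ _ in Etr Hrem.
  have -> : E w = N^-1 * S ^+ 3 * complex.Re (c * rem).
    rewrite /E /h perturbedE -/N -/a -/S Etr.
    rewrite !mulrDr !CReD.
    rewrite ![c * (toC _ * _)]mulrCA !CReZ.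
    have -> : complex.Re (c * (\sum_i r i ^+ 2 * (toC a *: x w) i i)) = a * L w.
      rewrite /L !mulr_sumr CRe_sum; apply: eq_bigr => i _.
      rewrite mxE -CReZ; congr complex.Re; ring.
    have -> : complex.Re (c * (\sum_i \sum_j r i ^+ 2 * r j *
        toC (normc ((toC a *: x w) i j) ^+ 2))) = N^-1 * Q w.
      rewrite /Q !mulr_sumr CRe_sum; apply: eq_bigr => i _.
      rewrite !mulr_sumr CRe_sum; apply: eq_bigr => j _.
      rewrite mxE ComplexField.Normc.normcM normc_toC exprMn real_normK ?num_real// a2.
      by rewrite [c * (_ * toC _)]mulrA [_ * toC _]mulrC CReZ; ring.
    by rewrite St /kap; field; rewrite lt0r_neq0.
  rewrite normrM ger0_norm; last by rewrite mulr_ge0 ?exprn_ge0// invr_ge0 ltW.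
  have crem : `|complex.Re (c * rem)| <= normc rem.
    apply: le_trans (CRe_le_normc _) _; rewrite ComplexField.Normc.normcM.
    by rewrite -[leRHS]mul1r ler_wpM2r// normc_ge0.
  apply: (@le_trans _ _ (N^-1 * S ^+ 3 * normc rem)).
    by rewrite ler_wpM2l// mulr_ge0 ?exprn_ge0// invr_ge0 ltW.
  apply: (@le_trans _ _ (N^-1 * S ^+ 3 * (y ^- 2 * (N^-1 * F2 w + y ^- 2 * (N ^- 2 * F4 w))))).
    rewrite ler_wpM2l//; first by rewrite mulr_ge0 ?exprn_ge0// invr_ge0 ltW.
    apply: le_trans Hrem _; rewrite -/y le_eqVlt; apply/orP; left; apply/eqP.
    congr (_ * (_ + _ * _)).
      rewrite /frob2 /F2 mulr_sumr; apply: eq_bigr => i _.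
      rewrite mulr_sumr; apply: eq_bigr => j _.
      by rewrite mxE ComplexField.Normc.normcM normc_toC exprMn real_normK ?num_real// a2 mul1r.
    rewrite /F4 mulr_sumr; apply: eq_bigr => i _.
    rewrite mulr_sumr; apply: eq_bigr => j _.
    have -> : \sum_k (toC a *: x w) i k * (z - toC (lam k))^-1 * (toC a *: x w) k j
        = toC (a ^+ 2) * \sum_k x w i k * r k * x w k j.
      rewrite mulr_sumr; apply: eq_bigr => k _; rewrite !mxE expr2 toCM /r; ring.
    rewrite ComplexField.Normc.normcM normc_toC exprMn real_normK ?num_real// a2.
    by rewrite exprVn.
  rewrite /B le_eqVlt; apply/orP; left; apply/eqP.
  by field; rewrite !lt0r_neq0.
have [iL L0] := expectation_diag0 (fun i => c * r i ^+ 2).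
have [iQ EQ] := expectation_normc2_sum (fun i j => complex.Re (c * (r i ^+ 2 * r j))).
have [iF2 EF2] := expectation_normc2_sum (fun _ _ => 1).
have [iF4 EF4] := @expectation_sandwich r y^-1 (ltac:(by rewrite invr_ge0 ltW))
  (fun k => normc_resolvent (lam k) z0).
rewrite -/L in iL L0; rewrite -/Q in iQ EQ; rewrite -/F2 in iF2 EF2; rewrite -/F4 in iF4 EF4.
have iZ (k : R) (f : T -> R) : P.-integrable setT (EFin \o f) ->
    P.-integrable setT (EFin \o (fun w => k * f w)) by move=> fi; exact: integrableZl fi.
have iD (f g : T -> R) : P.-integrable setT (EFin \o f) ->
    P.-integrable setT (EFin \o g) ->
    P.-integrable setT (EFin \o (fun w => f w + g w)).
  by move=> fi gi; exact: (integrableD measurableT fi gi).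
have iB : P.-integrable setT (EFin \o B) by apply: iD; exact: iZ.
have ic : P.-integrable setT (EFin \o (fun _ : T => kap)).
  exact: finite_measure_integrable_cst.
have iM : P.-integrable setT (EFin \o
   (fun w => kap + (S * (N^-1 * a)) * L w + (t * N ^- 2) * Q w)).
  exact: (iD _ _ (iD _ _ ic (iZ _ _ iL)) (iZ _ _ iQ)).
have mh : measurable_fun setT h.
  have [mr mi] := Cmeasurable_resolvent lam t z0.
  have -> : h = fun w => N^-1 * complex.Re c * complex.Re (\tr (invmx (z%:M - perturbed lam (x w) t)))
     - N^-1 * complex.Im c * complex.Im (\tr (invmx (z%:M - perturbed lam (x w) t))).
    by apply/funext => w; rewrite /h CReM; ring.
  exact: (measurable_funB (measurable_funM (measurable_cst _) mr)
     (measurable_funM (measurable_cst _) mi)).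
have mE : measurable_fun setT E.
  apply: measurable_funB => //; apply/measurable_EFinP.
  by have /integrableP[] := iM.
have iE : P.-integrable setT (EFin \o E).
  by apply: (Rintegrable_le _ mE iB) => // w _; exact: EB.
have hE : h = fun w => E w + (kap + (S * (N^-1 * a)) * L w + (t * N ^- 2) * Q w).
  by apply/funext => w; rewrite /E subrK.
rewrite -/(h _) -/h (_ : \int[P]_w h w =
   \int[P]_w E w + (kap + t * (N ^- 2 * \int[P]_w Q w))); last first.
  rewrite hE RintegralD//; congr (_ + _).
  rewrite RintegralD//; [|exact: (iD _ _ ic (iZ _ _ iL))|exact: iZ].
  rewrite RintegralD//; [|exact: iZ].
  rewrite (RintegralZl _ measurableT iL) (RintegralZl _ measurableT iQ) L0 mulr0 addr0 mulrA; congr (_ + _).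
  rewrite Rintegral_cst// -[RHS]mulr1; congr (_ * _).
  by have /(congr1 fine)/= -> := probability_setT P.
rewrite EQ -/kap addrK.
apply: le_trans (normr_Rintegral_le _ mE iB (fun w _ => EB w)) _ => //.
rewrite /B RintegralD//; [|exact: iZ|exact: iZ].
rewrite (RintegralZl _ measurableT iF2) (RintegralZl _ measurableT iF4) EF2.
have sumc (u : R) : \sum_(i < n.+1) u = N * u by rewrite sumr_const card_ord mulr_natl.
have F2le : \sum_i \sum_j 1 * \int[P]_w (normc (x w i j) ^+ 2) <= N ^+ 2 * (1 + K).
  apply: (@le_trans _ _ (\sum_(i < n.+1) \sum_(j < n.+1) (1 + K))).
    apply: ler_sum => i _; apply: ler_sum => j _; rewrite mul1r.
    by have [] := integrable_normc2 i j.
  by rewrite !sumc expr2 mulrA.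
have e1 : S ^+ 3 * (y ^- 2 * N ^- 2) * (\sum_i \sum_j 1 * \int[P]_w (normc (x w i j) ^+ 2))
    <= S ^+ 3 * (y ^- 2 * (1 + K)).
  apply: (@le_trans _ _ (S ^+ 3 * (y ^- 2 * N ^- 2) * (N ^+ 2 * (1 + K)))).
    rewrite ler_wpM2l// !mulr_ge0// ?exprn_ge0// invr_ge0 exprn_ge0//; exact: ltW.
  by rewrite le_eqVlt; apply/orP; left; apply/eqP; field; rewrite !lt0r_neq0.
have e2 : S ^+ 3 * (y ^- 2 * y ^- 2 * N ^- 3) * \int[P]_w F4 w <=
    S ^+ 3 * (y ^- 2 * (y ^- 2 * (4 * y ^- 2 * K))).
  apply: (@le_trans _ _ (S ^+ 3 * (y ^- 2 * y ^- 2 * N ^- 3) * (4 * y^-1 ^+ 2 * K * N ^+ 3))).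
    rewrite ler_wpM2l// !mulr_ge0// ?exprn_ge0// invr_ge0 exprn_ge0//; exact: ltW.
  by rewrite le_eqVlt; apply/orP; left; apply/eqP; field; rewrite !lt0r_neq0.
by apply: le_trans (lerD e1 e2) _; rewrite -mulrDr -mulrDr.
Qed.

End expected_resolvent.

End hermitian_entries.

(** * Measures with a density *)

Section integral_off_null_set.
Local Open Scope ereal_scope.
Context d (T : measurableType d) (R : realType) (mu : {measure set T -> \bar R}).

(** The integral of a nonnegative function is a supremum over simple functions below it, hence
    monotone even without measurability. *)
Lemma ge0_le_integral_nomeas (f g : T -> \bar R) :
  (forall x, 0 <= f x) -> (forall x, f x <= g x) ->
  \int[mu]_x f x <= \int[mu]_x g x.
Proof.
move=> f0 fg; rewrite !ge0_integralTE//; last by move=> x; exact: le_trans (fg x).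
apply: le_ereal_sup => _ [h hf <-]; exists h => // x.
exact: le_trans (hf x) (fg x).
Qed.

(* Sandwich f between g set to 0 on N and g set to +oo on N: both are
   measurable even though f need not be. *)
Lemma ge0_integral_off_null (N : set T) (f g : T -> \bar R) :
  measurable N -> mu N = 0 -> measurable_fun setT g ->
  (forall x, 0 <= f x) -> (forall x, 0 <= g x) -> (forall x, ~ N x -> f x = g x) ->
  \int[mu]_x f x = \int[mu]_x g x.
Proof.
move=> mN N0 mg f0 g0 fg.
pose lo x := if x \in N then 0 else g x.
pose up x := if x \in N then +oo else g x.
have mpatch (c : \bar R) : measurable_fun setT (fun x => if x \in N then c else g x).
  apply: measurable_fun_ifT => //; apply: (measurable_fun_bool true).
  rewrite setTI (_ : _ @^-1` _ = N)//.
  by apply/seteqP; split=> x /= => [/set_mem|/mem_set].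
have eqI (c : \bar R) : 0 <= c ->
    \int[mu]_x (if x \in N then c else g x) = \int[mu]_x g x.
  move=> c0; apply: ge0_ae_eq_integral => //.
    by move=> x _; case: ifP.
  exists N; split => // x /=; apply: contra_notP => xN _.
  by rewrite ifF//; apply/negbTE; rewrite notin_setE.
apply/eqP; rewrite eq_le; apply/andP; split.
- rewrite -(eqI +oo)//; apply: ge0_le_integral_nomeas => // x.
  case: ifPn => [_|]; first exact: leey.
  by rewrite notin_setE => /fg ->.
- rewrite -(eqI 0)//; apply: ge0_le_integral_nomeas => x; first by case: ifP.
  case: ifPn => // ; by rewrite notin_setE => /fg ->.
Qed.

(** Signed version, through positive and negative parts. It serves for integrands containing [tau],
    which agree with measurable functions only off a null set. *)
Lemma integral_off_null (N : set T) (f g : T -> \bar R) :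
  measurable N -> mu N = 0 -> measurable_fun setT g ->
  (forall x, ~ N x -> f x = g x) -> \int[mu]_x f x = \int[mu]_x g x.
Proof.
move=> mN N0 mg fg; rewrite integralE [RHS]integralE; congr (_ - _).
- apply: (ge0_integral_off_null mN) => //; first exact: measurable_funepos.
  by move=> x /fg; rewrite !funeposE => ->.
- apply: (ge0_integral_off_null mN) => //; first exact: measurable_funeneg.
  by move=> x /fg; rewrite !funenegE => ->.
Qed.

End integral_off_null_set.

(** The Radon-Nikodym derivative and [rho] have equal integrals over every measurable set, hence
    agree almost everywhere; the change of variables known for the former passes to the latter. *)
Lemma ge0_integral_density d (T : measurableType d) (R : realType)
    (nu : {finite_measure set T -> \bar R}) (mu : {sigma_finite_measure set T -> \bar R})
    (rho : T -> R) : measurable_fun setT rho ->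
  (forall A, measurable A -> nu A = (\int[mu]_(s in A) (rho s)%:E)%E) ->
  forall h : T -> \bar R, measurable_fun setT h -> (forall s, 0 <= h s)%E ->
  (\int[nu]_s h s = \int[mu]_s (h s * (rho s)%:E))%E.
Proof.
move=> mrho nuE h mh h0.
have dom : nu `<< mu.
  apply/null_content_dominatesP => A mA A0; rewrite nuE// null_set_integral//.
  exact/measurable_funTS/measurable_EFinP.
rewrite -(Radon_Nikodym_SigmaFinite.change_of_variables dom h0 measurableT mh).
have irn := Radon_Nikodym_SigmaFinite.f_integrable dom.
apply: ae_eq_integral => //.
- by apply: emeasurable_funM => //; by case/integrableP: irn.
- by apply: emeasurable_funM => //; exact/measurable_EFinP.
have : ae_eq mu setT (Radon_Nikodym_SigmaFinite.f nu mu) (EFin \o rho).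
  apply: integral_ae_eq => //; first exact/measurable_EFinP.
  move=> A _ mA; rewrite -(Radon_Nikodym_SigmaFinite.f_integral dom)//; exact: nuE.
by apply: filterS => x /= e /e ->.
Qed.

Section density.
Context (R : realType) (nu : probability (measurableTypeR R) R) (rho : R -> R).
Hypothesis nu_rho : has_density nu rho.

Let mrho : measurable_fun [set: measurableTypeR R] rho. Proof. by case: nu_rho. Qed.
Let rho0 s : 0 <= rho s. Proof. by case: nu_rho. Qed.
Let nuE A : measurable A ->
  nu A = (\int[lebesgue_measure]_(s in A) (rho s)%:E)%E.
Proof. by case: nu_rho => _ _; apply. Qed.

Lemma density_dominated A : measurable A -> lebesgue_measure A = 0%E -> nu A = 0%E.
Proof.
by move=> mA A0; rewrite nuE// null_set_integral//; exact/measurable_funTS/measurable_EFinP.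
Qed.

Lemma Rintegral_density (h : R -> R) : nu.-integrable setT (EFin \o h) ->
  lebesgue_measure.-integrable setT (EFin \o (fun s => h s * rho s)) /\
  \int[nu]_s h s = \int[lebesgue_measure]_s (h s * rho s).
Proof.
move=> ih; have /integrableP[/measurable_EFinP mh hoo] := ih.
have mhr : measurable_fun [set: measurableTypeR R] (fun s => h s * rho s) by exact: measurable_funM.
split.
  apply/integrableP; split; first exact/measurable_EFinP.
  move: hoo; rewrite (ge0_integral_density mrho nuE)//; last first.
    exact/measurableT_comp/measurable_EFinP.
  congr (_ < _)%E; apply: eq_integral => s _ /=.
  by rewrite -EFinM normrM (ger0_norm (rho0 s)).
rewrite /Rintegral; congr fine; rewrite integralE [in RHS]integralE.
have mE : measurable_fun setT (EFin \o h) by exact/measurable_EFinP.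
congr (_ - _)%E.
  rewrite (ge0_integral_density mrho nuE)//; last exact: measurable_funepos.
  apply: eq_integral => s _; rewrite !funeposE /=.
  by rewrite -!EFin_max -EFinM maxr_pMl// mul0r.
rewrite (ge0_integral_density mrho nuE)//; last exact: measurable_funeneg.
apply: eq_integral => s _; rewrite !funenegE /=.
by rewrite -!EFin_max -EFinM maxr_pMl// mul0r mulNr.
Qed.

Lemma density_set1 s : nu [set s] = 0%E.
Proof. by apply: density_dominated => //; exact: lebesgue_measure_set1. Qed.

End density.

(** * Principal values and the velocity field *)

Section principal_value.
Context (R : realType).
Local Notation mu := (@lebesgue_measure R).

Lemma FTC2_closed (F f : R -> R) (a b : R) : a < b ->
  (forall x, a <= x <= b -> is_derive x 1 F (f x)) ->
  (forall x, a <= x <= b -> {for x, continuous f}) ->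
  mu.-integrable `[a, b] (EFin \o f) /\
  (\int[mu]_(x in `[a, b]) (f x)%:E = (F b - F a)%:E)%E.
Proof.
move=> ab dF cf.
have cfw : {within `[a, b], continuous f}.
  apply: continuous_in_subspaceT => x; rewrite inE/= in_itv/= => xab; exact: cf.
split; first by apply: continuous_compact_integrable => //; exact: segment_compact.
have cF x : a <= x <= b -> {for x, continuous F}.
  move=> xab; apply: differentiable_continuous; apply/derivable1_diffP.
  by have [] := dF x xab.
rewrite EFinB; apply: (continuous_FTC2 ab cfw).
- split.
  + by move=> x; rewrite in_itv/= => /andP[ax xb]; have [] := dF x _; rewrite ?ltW.
  + by apply: cvg_at_right_filter; apply: cF; rewrite lexx ltW.
  + by apply: cvg_at_left_filter; apply: cF; rewrite lexx ltW.
- move=> x; rewrite in_itv/= => /andP[ax xb]; rewrite derive1E.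
  by apply: derive_val; apply: dF; rewrite !ltW.
Qed.

Variables (s alpha : R).
Hypothesis alpha0 : 0 < alpha.

(** This is |t - s|^(alpha - 1): a Hoelder bound divided by the denominator of the Cauchy kernel.
    The exponential form is what [powR] unfolds to at a nonzero base, and it is easy to
    differentiate. *)
Definition hoelder_kernel (t : R) : R := expR (alpha * ln `|t - s|) / `|t - s|.

Lemma hoelder_kernel_ge0 t : 0 <= hoelder_kernel t.
Proof. by rewrite /hoelder_kernel divr_ge0// expR_ge0. Qed.

(** The sign [sg] selects the side of s on which sg (t - s) = |t - s|, so one computation gives the
    primitives of the Hoelder kernel and of the Cauchy kernel on both sides. *)
Let side (sg : R) : sg = 1 \/ sg = -1 -> forall t, 0 < sg * (t - s) ->
  [/\ is_derive t 1 (fun t => sg / alpha * expR (alpha * ln (sg * (t - s))))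
        (expR (alpha * ln (sg * (t - s))) / (sg * (t - s))),
      is_derive t 1 (fun t => - ln (sg * (t - s))) (s - t)^-1,
      {for t, continuous (fun t => expR (alpha * ln (sg * (t - s))) / (sg * (t - s)))} &
      {for t, continuous (fun t => (s - t)^-1)}].
Proof.
move=> hsg t t0.
have sg2 : sg * sg = 1 by case: hsg => ->; rewrite ?mulr1// mulrNN mulr1.
have ts : t - s != 0 by apply: contraTneq t0 => ->; rewrite mulr0 ltxx.
have sg0 : sg != 0 by apply: contraTneq t0 => ->; rewrite mul0r ltxx.
have dv : is_derive t 1 (fun t : R => sg * (t - s)) sg.
  have := is_deriveZ sg (is_deriveB (is_derive_id t (1 : R)) (is_derive_cst s t (1 : R))).
  by rewrite subr0 => H; apply: is_derive_eq H _; rewrite /GRing.scale/= mulr1.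
have dln : is_derive t 1 (fun t => ln (sg * (t - s))) ((sg * (t - s))^-1 * sg).
  exact: (@is_derive1_comp R (@ln R) (fun t => sg * (t - s)) t _ _ (is_derive1_ln t0) dv).
have daln : is_derive t 1 (fun t => alpha * ln (sg * (t - s)))
    (alpha * ((sg * (t - s))^-1 * sg)) by exact: (is_deriveZ alpha dln).
have dexp : is_derive t 1 (fun t => expR (alpha * ln (sg * (t - s))))
    (expR (alpha * ln (sg * (t - s))) * (alpha * ((sg * (t - s))^-1 * sg))).
  exact: (@is_derive1_comp R (@expR R) (fun t => alpha * ln (sg * (t - s))) t _ _
    (is_derive_expR _) daln).
have cts f l : is_derive t (1 : R) f l -> {for t, continuous f}.
  by case=> df _; apply: differentiable_continuous; apply/derivable1_diffP.
split.
- have H := is_deriveZ (sg / alpha) dexp; apply: is_derive_eq H _.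
  have a0 : alpha != 0 by rewrite gt_eqF.
  rewrite /GRing.scale/=.
  have -> : sg / alpha * (expR (alpha * ln (sg * (t - s))) * (alpha * ((sg * (t - s))^-1 * sg)))
    = (sg * sg) * (expR (alpha * ln (sg * (t - s))) / (sg * (t - s))).
    by field; rewrite a0 sg0 ts.
  by rewrite sg2 mul1r.
- have H := is_deriveN dln; apply: is_derive_eq H _.
  by rewrite invfM mulrAC mulVf// mul1r -invrN opprB.
- apply: continuousM; first exact: cts dexp.
  by apply: continuousV; [rewrite gt_eqF|exact: cts dv].
- apply: continuousV; first by rewrite -opprB oppr_eq0.
  by apply: continuousB; [exact: cst_continuous|exact: cvg_id].
Qed.

(** The value for the Cauchy kernel is opposite to the one in [ring_left]; this is the cancellation
    behind the principal value. *)
Lemma ring_right (a b : R) : 0 < a -> a < b ->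
  [/\ mu.-integrable `[s + a, s + b] (EFin \o hoelder_kernel),
      (\int[mu]_(t in `[(s + a)%R, (s + b)%R]) (hoelder_kernel t)%:E =
        ((expR (alpha * ln b) - expR (alpha * ln a)) / alpha)%R%:E)%E,
      mu.-integrable `[s + a, s + b] (EFin \o (fun t : R => (s - t)^-1)) &
      (\int[mu]_(t in `[(s + a)%R, (s + b)%R]) ((s - t)^-1)%R%:E = (ln a - ln b)%R%:E)%E].
Proof.
move=> a0 ab; have h t : s + a <= t <= s + b -> 0 < 1 * (t - s).
  by move=> /andP[sat _]; lra.
have sd t H := side (or_introl erefl) (h t H).
have sab : s + a < s + b by rewrite ltrD2l.
have [i1 e1] := FTC2_closed sab (fun t H => let: And4 p _ _ _ := sd t H in p)
  (fun t H => let: And4 _ _ p _ := sd t H in p).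
have [i2 e2] := FTC2_closed sab (fun t H => let: And4 _ p _ _ := sd t H in p)
  (fun t H => let: And4 _ _ _ p := sd t H in p).
have kE : {in `[s + a, s + b]%classic, (EFin \o (fun t =>
    expR (alpha * ln (1 * (t - s))) / (1 * (t - s)))) =1 EFin \o hoelder_kernel}.
  move=> t; rewrite inE/= in_itv/= => /h; rewrite mul1r => t0.
  by rewrite /hoelder_kernel /= gtr0_norm// mul1r.
split => //.
- by apply: eq_integrable i1.
- transitivity (\int[mu]_(t in `[(s + a)%R, (s + b)%R])
    (expR (alpha * ln (1 * (t - s))) / (1 * (t - s)))%R%:E)%E.
    by apply: eq_integral => t /kE /esym.
  rewrite [LHS]e1; congr EFin.
  by rewrite !mul1r !(addrC s) !addrK; ring.
- by rewrite e2; congr EFin; rewrite !mul1r !(addrC s) !addrK; ring.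
Qed.

Lemma ring_left (a b : R) : 0 < a -> a < b ->
  [/\ mu.-integrable `[s - b, s - a] (EFin \o hoelder_kernel),
      (\int[mu]_(t in `[(s - b)%R, (s - a)%R]) (hoelder_kernel t)%:E =
        ((expR (alpha * ln b) - expR (alpha * ln a)) / alpha)%R%:E)%E,
      mu.-integrable `[s - b, s - a] (EFin \o (fun t : R => (s - t)^-1)) &
      (\int[mu]_(t in `[(s - b)%R, (s - a)%R]) ((s - t)^-1)%R%:E = (ln b - ln a)%R%:E)%E].
Proof.
move=> a0 ab; have h t : s - b <= t <= s - a -> 0 < -1 * (t - s).
  by move=> /andP[_ sat]; lra.
have sd t H := side (or_intror erefl) (h t H).
have sab : s - b < s - a by rewrite ltrD2l ltrN2.
have [i1 e1] := FTC2_closed sab (fun t H => let: And4 p _ _ _ := sd t H in p)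
  (fun t H => let: And4 _ _ p _ := sd t H in p).
have [i2 e2] := FTC2_closed sab (fun t H => let: And4 _ p _ _ := sd t H in p)
  (fun t H => let: And4 _ _ _ p := sd t H in p).
have kE : {in `[s - b, s - a]%classic, (EFin \o (fun t =>
    expR (alpha * ln (-1 * (t - s))) / (-1 * (t - s)))) =1 EFin \o hoelder_kernel}.
  move=> t; rewrite inE/= in_itv/= => /h; rewrite mulN1r => t0.
  by rewrite /hoelder_kernel /= -normrN gtr0_norm// mulN1r.
have e u : -1 * (s - u - s) = u by rewrite mulN1r addrAC subrr add0r opprK.
split => //.
- by apply: eq_integrable i1.
- transitivity (\int[mu]_(t in `[(s - b)%R, (s - a)%R])
    (expR (alpha * ln (-1 * (t - s))) / (-1 * (t - s)))%R%:E)%E.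
    by apply: eq_integral => t /kE /esym.
  rewrite [LHS]e1; congr EFin.
  by rewrite !e; ring.
- by rewrite e2; congr EFin; rewrite !e; ring.
Qed.

End principal_value.

Section near_singularity.
Context (R : realType).
Local Notation mu := (@lebesgue_measure R).
Implicit Types s e : R.

Lemma measurable_invr : measurable_fun [set: measurableTypeR R] (fun x : R => x^-1).
Proof.
(* The power function agrees with the inverse on nonnegative arguments only, hence the passage
   through x^2. *)
have -> : (fun x : R => x^-1) = (fun x => x * (x ^+ 2) `^ (-1)).
  apply/funext => x; rewrite powR_inv1 ?sqr_ge0//.
  have [->|x0] := eqVneq x 0; first by rewrite invr0 mul0r.
  by rewrite expr2 invfM mulrA mulfV// mul1r.
apply: measurable_funM => //.
have mid : measurable_fun [set: measurableTypeR R] (fun x : measurableTypeR R => x : R).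
  exact: measurable_id.
exact: (measurableT_comp (measurable_powR (-1)) (measurable_funX 2 mid)).
Qed.

Lemma measurable_hoelder_kernel s (alpha : R) :
  measurable_fun [set: measurableTypeR R] (hoelder_kernel s alpha).
Proof.
have mn : measurable_fun [set: measurableTypeR R] (fun t : R => `|t - s|).
  by apply: measurableT_comp => //; exact: measurable_funB.
apply: measurable_funM; last exact: (measurableT_comp measurable_invr mn).
apply: measurableT_comp => //; apply: measurable_funM => //.
exact: (measurableT_comp (@measurable_ln R) mn).
Qed.

Lemma punctured_ball s e : [set t | 0 < `|t - s| <= e] = `[s - e, s[ `|` `]s, s + e].
Proof.
apply/seteqP; split => t /=.
  move=> /andP[]; rewrite normr_gt0 subr_eq0 ler_distl => ts /andP[h1 h2].
  rewrite !in_itv/= h1 h2 andbT /=.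
  by case: (ltgtP t s) ts => // ? _; [left|right].
rewrite !in_itv/= normr_gt0 subr_eq0 ler_distl.
by move=> [/andP[h1 h2]|/andP[h1 h2]]; apply/andP; (split; [lra|apply/andP; split; lra]).
Qed.

(** Exhaustion by closed intervals that avoid s. The shift by 2 keeps e / (k + 2) strictly below e,
    as [ring_left] requires. *)
Lemma bigcup_left s e : 0 < e ->
  `[s - e, s[%classic = \bigcup_k `[s - e, s - e / k.+2%:R]%classic :> set R.
Proof.
move=> e0; have ek0 (k : nat) : 0 < e / k.+2%:R by rewrite divr_gt0.
apply/seteqP; split => t /=.
  rewrite in_itv/= => /andP[h1 h2].
  have st0 : 0 < s - t by lra.
  exists (Num.truncn (e / (s - t))) => //=; rewrite in_itv/= h1/= lerBrDr -lerBrDl.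
  rewrite ler_pdivrMr// mulrC -ler_pdivrMr//.
  by rewrite ltW// (lt_le_trans (truncnS_gt _))// ler_nat.
move=> [k _] /=; rewrite !in_itv/= => /andP[-> h] /=.
by apply: le_lt_trans h _; rewrite gtrBl.
Qed.

Lemma bigcup_right s e : 0 < e ->
  `]s, s + e]%classic = \bigcup_k `[s + e / k.+2%:R, s + e]%classic :> set R.
Proof.
move=> e0; have ek0 (k : nat) : 0 < e / k.+2%:R by rewrite divr_gt0.
apply/seteqP; split => t /=.
  rewrite in_itv/= => /andP[h1 h2].
  have st0 : 0 < t - s by lra.
  exists (Num.truncn (e / (t - s))) => //=; rewrite in_itv/= h2 andbT -lerBrDl.
  rewrite ler_pdivrMr// mulrC -ler_pdivrMr//.
  by rewrite ltW// (lt_le_trans (truncnS_gt _))// ler_nat.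
move=> [k _] /=; rewrite !in_itv/= => /andP[h ->] /=.
by rewrite andbT; apply: lt_le_trans h; rewrite ltrDl.
Qed.

(** Monotone convergence along the exhaustions of the two sides: alpha > 0 makes the primitive
    bounded near s, and each side contributes at most e^alpha / alpha. *)
Lemma hoelder_kernel_near s (alpha e : R) : 0 < alpha -> 0 < e ->
  (\int[mu]_(t in [set t | (0 < `|t - s| <= e)%R]) (hoelder_kernel s alpha t)%:E <=
   (2 * (expR (alpha * ln e) / alpha))%R%:E)%E.
Proof.
move=> a0 e0; have mk := measurable_hoelder_kernel s alpha.
have k0 := hoelder_kernel_ge0 s alpha.
have mEk D : measurable_fun D (fun t : measurableTypeR R => (hoelder_kernel s alpha t)%:E).
  by apply/measurable_EFinP; exact: measurable_funTS.
have ek k : e / k.+2%:R < e by rewrite ltr_pdivrMr// ltr_pMr// ltr1n.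
have ek0 k : 0 < e / k.+2%:R :> R by rewrite divr_gt0.
have ekd k l : (k <= l)%N -> e / l.+2%:R <= e / k.+2%:R.
  by move=> kl; rewrite ler_pM2l// lef_pV2 ?posrE// ler_nat !ltnS.
have half (F : nat -> set (measurableTypeR R)) (A : set (measurableTypeR R)) :
    nondecreasing_seq F -> (forall k, measurable (F k)) -> A = \bigcup_k F k ->
    (forall k, \int[mu]_(t in F k) (hoelder_kernel s alpha t)%:E =
      ((expR (alpha * ln e) - expR (alpha * ln (e / k.+2%:R))) / alpha)%R%:E)%E ->
    (\int[mu]_(t in A) (hoelder_kernel s alpha t)%:E <=
      (expR (alpha * ln e) / alpha)%R%:E)%E.
  move=> ndF mF -> intF.
  have cv := @ge0_nondecreasing_set_cvg_integral _ _ R F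
    (fun t => (hoelder_kernel s alpha t)%:E) mu ndF mF (fun i => mEk (F i))
    (fun i x _ => k0 x).
  rewrite -(cvg_lim _ cv)//; apply: lime_le; first by apply/cvg_ex; eexists; exact: cv.
  apply: nearW => k; rewrite intF lee_fin ler_pM2r ?invr_gt0//.
  by rewrite gerBl expR_ge0.
rewrite punctured_ball ge0_integral_setU//=; last 2 first.
- by move=> t _; rewrite lee_fin.
- rewrite disj_set2E; apply/eqP/seteqP; split => // t [] /=.
  by rewrite !in_itv/= => /andP[_ h1] /andP[h2 _]; lra.
rewrite mulr_natl mulr2n EFinD; apply: leeD.
- apply: (half (fun k => `[s - e, s - e / k.+2%:R]%classic)).
  + move=> k l kl; apply/subsetPset => t /=; rewrite !in_itv/= => /andP[-> h] /=.
    by apply: le_trans h _; rewrite lerD2l lerN2; exact: ekd.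
  + by move=> k; exact: measurable_itv.
  + exact: bigcup_left.
  + by move=> k; have [] := @ring_left R s alpha a0 _ _ (ek0 k) (ek k).
- apply: (half (fun k => `[s + e / k.+2%:R, s + e]%classic)).
  + move=> k l kl; apply/subsetPset => t /=; rewrite !in_itv/= => /andP[h ->] /=.
    by rewrite andbT; apply: le_trans h; rewrite lerD2l; exact: ekd.
  + by move=> k; exact: measurable_itv.
  + exact: bigcup_right.
  + by move=> k; have [] := @ring_right R s alpha a0 _ _ (ek0 k) (ek k).
Qed.

(** The points with e < |s - t| <= eta, as two intervals on which the fundamental theorem of
    calculus applies. *)
Definition ring s e eta : set R := `[s - eta, s - e[ `|` `]s + e, s + eta].

Lemma ring_disjoint s e eta : 0 < e ->
  [disjoint `[s - eta, s - e[%classic & `]s + e, s + eta]%classic].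
Proof.
move=> e0; rewrite disj_set2E; apply/eqP/seteqP; split => // t [] /=.
by rewrite !in_itv/= => /andP[_ h1] /andP[h2 _]; lra.
Qed.

Lemma measurable_ring s e eta : measurable (ring s e eta : set (measurableTypeR R)).
Proof. by apply: measurableU; exact: measurable_itv. Qed.

Lemma measurable_subinv s :
  measurable_fun [set: measurableTypeR R] (fun t : R => (s - t)^-1).
Proof.
have ms : measurable_fun [set: measurableTypeR R] (fun t : R => s - t).
  exact: measurable_funB.
exact: (measurableT_comp measurable_invr ms).
Qed.

(** The Cauchy kernel is odd about s and the ring is symmetric. *)
Lemma ring_inv s e eta : 0 < e -> e < eta ->
  mu.-integrable (ring s e eta) (EFin \o (fun t : R => (s - t)^-1)) /\
  \int[mu]_(t in ring s e eta) (s - t)^-1 = 0.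
Proof.
move=> e0 ee.
have [_ _ il el] := ring_left s (@ltr01 R) e0 ee.
have [_ _ ir er] := ring_right s (@ltr01 R) e0 ee.
have il' : mu.-integrable `[s - eta, s - e[ (EFin \o (fun t : R => (s - t)^-1)).
  apply: (integrableS _ _ _ il) => // t /=; rewrite !in_itv/=.
  by move=> /andP[-> /ltW ->].
have ir' : mu.-integrable `]s + e, s + eta] (EFin \o (fun t : R => (s - t)^-1)).
  apply: (integrableS _ _ _ ir) => // t /=; rewrite !in_itv/=.
  by move=> /andP[/ltW -> ->].
have ii : mu.-integrable (ring s e eta) (EFin \o (fun t : R => (s - t)^-1)).
  have mS := measurable_subinv s.
  apply/integrableP; split; first by apply/measurable_EFinP; exact: measurable_funTS.
  rewrite ge0_integral_setU//=; last 2 first.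
  - apply/measurable_EFinP; apply: measurable_funTS.
    by apply: measurableT_comp.
  - exact: ring_disjoint.
  by rewrite lte_add_pinfty//; [case/integrableP: il'|case/integrableP: ir'].
split => //; rewrite Rintegral_setU//; last exact: ring_disjoint.
rewrite Rintegral_itv_bndo_bndc// Rintegral_itv_obnd_cbnd//.
by rewrite /Rintegral el er /= -opprB addNr.
Qed.

End near_singularity.

Section bounded_convergence.
Context d (T : measurableType d) (R : realType) (P : probability T R).

Lemma bounded_Rintegrable (f : T -> R) (c : R) : measurable_fun setT f ->
  (forall x, `|f x| <= c) -> P.-integrable setT (EFin \o f).
Proof.
move=> mf fc; by apply: (Rintegrable_le _ mf (finite_measure_integrable_cst P c measurableT)).
Qed.

Lemma bounded_normr_Rintegral (f : T -> R) (c : R) : measurable_fun setT f ->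
  (forall x, `|f x| <= c) -> `|\int[P]_x f x| <= c.
Proof.
move=> mf fc.
apply: le_trans (normr_Rintegral_le _ mf (finite_measure_integrable_cst P c measurableT) _) _ => //.
rewrite Rintegral_cst//.
by have /(congr1 fine)/= -> := probability_setT P; rewrite mulr1.
Qed.

Lemma bounded_convergence (f_ : nat -> T -> R) (f : T -> R) (c : R) :
  (forall n, measurable_fun setT (f_ n)) -> measurable_fun setT f ->
  {ae P, forall x, f_ n x @[n --> \oo] --> f x} ->
  {ae P, forall x, forall n, `|f_ n x| <= c} ->
  P.-integrable setT (EFin \o f) /\
  \int[P]_x f_ n x @[n --> \oo] --> \int[P]_x f x.
Proof.
move=> mf_ mf cf bf.
have cfE x : f_ n x @[n --> \oo] --> f x ->
    setT x -> (fun n => (f_ n x)%:E) @ \oo --> (f x)%:E.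
  by move=> h _; apply/fine_cvgP; split; [exact: nearW|exact: h].
have [i1 _ cv] := @dominated_convergence _ _ R P setT measurableT
  (fun n => EFin \o f_ n) (EFin \o f) (cst c%:E)
  (fun n => (@measurable_EFinP _ _ _ _ _).2 (mf_ n)) ((@measurable_EFinP _ _ _ _ _).2 mf)
  (filterS cfE cf)
  (finite_measure_integrable_cst P c measurableT)
  (filterS (fun x h n _ => h n) bf).
split => //; apply: fine_cvg; rewrite fineK//.
exact: integrable_fin_num.
Qed.

End bounded_convergence.

Section principal_value_exists.
Context (R : realType) (s alpha eta u0 C M : R) (u : R -> R) (N : set R).
Local Notation mu := (@lebesgue_measure R).
Local Notation Rm := (measurableTypeR R).
Hypotheses (alpha0 : 0 < alpha) (eta0 : 0 < eta) (C0 : 0 <= C).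
Hypothesis mu_u : measurable_fun [set: Rm] u.
Hypothesis iu : mu.-integrable [set: Rm] (EFin \o u).
Hypothesis uM : \int[mu]_(t in [set: Rm]) `|u t| <= M.
Hypotheses (mN : measurable (N : set Rm)) (N0 : mu N = 0%E).
Hypothesis u_hoelder : forall t : R, ~ N t -> 0 < `|t - s| <= eta ->
  `|u t - u0| <= C * expR (alpha * ln `|t - s|).

Let near (e : R) : set R := [set t | 0 < `|t - s| <= e].
Let away (e : R) : set R := [set t | e < `|s - t|].
(** The desingularized integrand, u0 standing for the value of u at s: by the Hoelder bound it is
    absolutely integrable near s. *)
Let w (t : R) := (u t - u0) * (s - t)^-1.
Let bnd (e : R) := C * (2 * (expR (alpha * ln e) / alpha)).

Let mnear e : measurable (near e : set Rm).
Proof. by rewrite /near punctured_ball; apply: measurableU; exact: measurable_itv. Qed.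

Let maway e : measurable (away e : set Rm).
Proof.
rewrite -[X in measurable X]setTI.
have mn : measurable_fun [set: Rm] (fun t : R => `|s - t|).
  by apply: measurableT_comp => //; exact: measurable_funB.
have -> : away e = (fun t : R => `|s - t|) @^-1` `]e, +oo[%classic.
  by apply/seteqP; split => t /=; rewrite in_itv/= andbT.
by apply: mn => //; exact: measurable_itv.
Qed.

Let mw : measurable_fun [set: Rm] w.
Proof.
apply: measurable_funM; last exact: measurable_subinv.
exact: (measurable_funB mu_u (measurable_cst u0)).
Qed.

Let w_near e : 0 < e -> e <= eta ->
  mu.-integrable (near e) (EFin \o w) /\ `|\int[mu]_(t in near e) w t| <= bnd e.
Proof.
move=> e0 ee.
have k0 t : 0 <= C * hoelder_kernel s alpha t by rewrite mulr_ge0// hoelder_kernel_ge0.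
have mk := measurable_hoelder_kernel s alpha.
have le : (\int[mu]_(t in near e) `|w t|%:E <= (bnd e)%:E)%E.
  apply: (@le_trans _ _ (\int[mu]_(t in near e) (C * hoelder_kernel s alpha t)%:E)%E).
    apply: ae_ge0_le_integral => //.
    - apply/measurable_EFinP; apply: measurable_funTS.
      by apply: measurableT_comp => //; exact: mw.
    - by move=> t _; rewrite lee_fin.
    - by apply/measurable_EFinP; apply: measurable_funTS; apply: measurable_funM.
    exists N; split => // t /=; apply: contra_notP => Nt; rewrite /near /= => /andP[t0 te].
    rewrite lee_fin /w normrM normrV ?unitfE; last first.
      by rewrite -normr_gt0 distrC.
    rewrite /hoelder_kernel mulrA [`|s - t|]distrC ler_wpM2r ?invr_ge0//.
    by apply: u_hoelder => //; rewrite t0 (le_trans te).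
  under eq_integral do rewrite EFinM.
  rewrite ge0_integralZl//; last 2 first.
  - by apply/measurable_EFinP; exact: measurable_funTS.
  - by move=> t _; rewrite lee_fin hoelder_kernel_ge0.
  rewrite /bnd EFinM; apply: lee_wpmul2l; first by rewrite lee_fin.
  exact: hoelder_kernel_near.
have iw : mu.-integrable (near e) (EFin \o w).
  apply/integrableP; split; first by apply/measurable_EFinP; exact: measurable_funTS.
  exact: le_lt_trans le (ltry _).
split => //; apply: le_trans (le_normr_Rintegral _ iw) _ => //.
rewrite /Rintegral -lee_fin fineK//.
rewrite ge0_fin_numE; first exact: le_lt_trans le (ltry _).
by apply: integral_ge0 => t _; rewrite lee_fin.
Qed.

Let ui t := u t / (s - t).

Let mui : measurable_fun [set: Rm] ui.
Proof. by apply: measurable_funM => //; exact: measurable_subinv. Qed.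

Let ui_le e t : 0 < e -> away e t -> `|ui t| <= `|u t| / e.
Proof.
move=> e0 et; rewrite /ui normrM ler_wpM2l// normrV ?unitfE; last first.
  by rewrite -normr_gt0 (lt_trans e0).
by rewrite lef_pV2 ?posrE// ?ltW// (lt_trans e0).
Qed.

Let iu_abs e : mu.-integrable (away e) (EFin \o (fun t => `|u t|)).
Proof.
have h : mu.-integrable [set: Rm] (EFin \o (fun t => `|u t|)) by exact: integrable_norm.
by apply: (integrableS _ _ _ h).
Qed.

Let iui e : 0 < e -> mu.-integrable (away e) (EFin \o ui).
Proof.
move=> e0; apply: (@Rintegrable_le _ _ _ mu _ _ (fun t => e^-1 * `|u t|)) => //.
- exact: measurable_funTS.
- exact: (integrableZl (maway e) e^-1 (iu_abs e)).
- by move=> t /(ui_le e0); rewrite mulrC.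
Qed.

Let far_le : `|\int[mu]_(t in away eta) ui t| <= M / eta.
Proof.
have h := @normr_Rintegral_le _ _ _ mu (away eta) ui (fun t => eta^-1 * `|u t|)
  (maway eta) (measurable_funTS mui) (integrableZl (maway eta) eta^-1 (iu_abs eta)).
apply: le_trans (h _) _; first by move=> t /(ui_le eta0); rewrite mulrC.
rewrite (RintegralZl _ (maway eta) (iu_abs eta)) [M / eta]mulrC ler_wpM2l ?invr_ge0 ?(ltW eta0)//.
apply: le_trans uM; rewrite /Rintegral fine_le//.
- by apply: integrable_fin_num => //; exact: iu_abs.
- by apply: integrable_fin_num => //; exact: integrable_norm.
by apply: ge0_subset_integral => //; apply/measurable_EFinP; exact: measurableT_comp.
Qed.

Let away_split e : 0 < e -> e < eta -> away e = away eta `|` ring s e eta.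
Proof.
move=> e0 ee; apply/seteqP; split => t; rewrite /away /ring /= ?in_itv/=.
- have [ts|ts] := leP t s.
  + rewrite ger0_norm ?subr_ge0// => h.
    by case: (ltP eta (s - t)) => h2; [left|right; left; apply/andP; split; lra].
  + rewrite ltr0_norm ?subr_lt0// => h.
    by case: (ltP eta (- (s - t))) => h2; [left|right; right; apply/andP; split; lra].
- move=> [|[/andP[h1 h2]|/andP[h1 h2]]]; first exact: lt_trans.
  + by rewrite ger0_norm; lra.
  + by rewrite ltr0_norm; lra.
Qed.

Let near_split e : 0 < e -> e < eta -> near eta = ring s e eta `|` near e.
Proof.
move=> e0 ee; apply/seteqP; split => t; rewrite /near /ring /= ?in_itv/=.
- have [ts|ts] := leP t s.
  + rewrite ler0_norm ?subr_le0// => /andP[h1 h2].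
    case: (leP (- (t - s)) e) => h3; first by right; rewrite h1.
    by left; left; apply/andP; split; lra.
  + rewrite gtr0_norm ?subr_gt0// => /andP[h1 h2].
    case: (leP (t - s) e) => h3; first by right; rewrite h1.
    by left; right; apply/andP; split; lra.
- move=> [[/andP[h1 h2]|/andP[h1 h2]]|/andP[-> h2]] /=; last by lra.
  + by rewrite ltr0_norm; lra.
  + by rewrite gtr0_norm; lra.
Qed.

(** On the ring between e and eta the integrand may be replaced by [w]: they differ by a multiple of
    the Cauchy kernel, which integrates to 0 there. All dependence on e is then in the integral of
    [w] over a shrinking neighborhood. *)
Let truncated e : 0 < e -> e < eta ->
  \int[mu]_(t in away e) ui t = \int[mu]_(t in away eta) ui t +
    (\int[mu]_(t in near eta) w t - \int[mu]_(t in near e) w t).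
Proof.
move=> e0 ee; have [i1 z1] := ring_inv s e0 ee.
have [iw _] := w_near eta0 (lexx _).
have mr := measurable_ring s e eta.
rewrite away_split// Rintegral_setU//; first last.
- rewrite disj_set2E; apply/eqP/seteqP; split => // t [].
  rewrite /away /ring /= !in_itv/= => h [/andP[h1 h2]|/andP[h1 h2]]; move: h.
    by rewrite ger0_norm; lra.
  by rewrite ltr0_norm; lra.
- by rewrite -away_split//; exact: iui.
congr (_ + _).
have eN : \int[mu]_(t in near eta) w t =
    \int[mu]_(t in ring s e eta) w t + \int[mu]_(t in near e) w t.
  rewrite (near_split e0 ee); apply: (@Rintegral_setU _ _ _ mu (ring s e eta)) => //.
    by rewrite -near_split.
  rewrite disj_set2E; apply/eqP/seteqP; split => // t [].
  rewrite /near /ring /= !in_itv/= => -[/andP[h1 h2]|/andP[h1 h2]] /andP[_].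
    by rewrite ltr0_norm; lra.
  by rewrite gtr0_norm; lra.
rewrite eN addrK.
have iwr : mu.-integrable (ring s e eta) (EFin \o w).
  by apply: (integrableS _ _ _ iw) => //; rewrite (near_split e0 ee); left.
have i2 : mu.-integrable (ring s e eta) (EFin \o (fun t => u0 * (s - t)^-1)).
  exact: (integrableZl mr u0 i1).
transitivity (\int[mu]_(t in ring s e eta) (w t + u0 * (s - t)^-1)).
  by apply: eq_Rintegral => t _; rewrite /w /ui -mulrDl subrK.
by rewrite RintegralD// RintegralZl// z1 mulr0 addr0.
Qed.

Let bnd_mono e : 0 < e -> e <= eta -> bnd e <= bnd eta.
Proof.
move=> e0 ee; rewrite /bnd ler_wpM2l// ler_pM2l// ler_pM2r ?invr_gt0//.
by rewrite ler_expR ler_pM2l// ler_ln.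
Qed.

Lemma pv_exists : exists l : R,
  \int[mu]_(t in [set t | e < `|s - t|]) (u t / (s - t)) @[e --> 0^'+] --> l /\
  forall e, 0 < e -> e < eta ->
    `|\int[mu]_(t in [set t | e < `|s - t|]) (u t / (s - t))| <=
    M / eta + 2 * (C * (2 * (expR (alpha * ln eta) / alpha))).
Proof.
exists (\int[mu]_(t in away eta) ui t + \int[mu]_(t in near eta) w t); split.
(* The added 1 keeps [c1] positive when C = 0, and [del] solves c1 del^alpha = d. *)
- apply/cvgrPdist_lt => d d0.
  pose c1 := C * 2 / alpha + 1.
  have c0 : 0 < c1 by rewrite ltr_wpDl// divr_ge0 ?mulr_ge0// ltW.
  pose del := expR (ln (d / c1) / alpha).
  near=> e.
  have e0 : 0 < e by near: e; exact: nbhs_right_gt.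
  have ee : e < eta by near: e; exact: nbhs_right_lt.
  have ed : e < del by near: e; apply: nbhs_right_lt; exact: expR_gt0.
  rewrite -/(away e) -/(ui _) (truncated e0 ee) addrA subKr.
  have [_ h] := w_near e0 (ltW ee); apply: le_lt_trans h _.
  have he : expR (alpha * ln e) < d / c1.
    rewrite -[ltRHS]lnK ?posrE ?divr_gt0// ltr_expR mulrC -ltr_pdivlMr//.
    by rewrite -ltr_expR lnK.
  have -> : bnd e = C * 2 / alpha * expR (alpha * ln e).
    by rewrite /bnd; field; rewrite gt_eqF.
  apply: (@le_lt_trans _ _ (c1 * expR (alpha * ln e))).
    by rewrite ler_wpM2r ?expR_ge0// lerDl.
  by rewrite mulrC -ltr_pdivlMr.
- move=> e e0 ee; rewrite -/(away e) -/(ui _) (truncated e0 ee).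
  have [_ h1] := w_near eta0 (lexx _); have [_ h2] := w_near e0 (ltW ee).
  have h3 := bnd_mono e0 (ltW ee).
  rewrite -/(bnd eta); apply: le_trans (ler_normD _ _) _; apply: lerD; first exact: far_le.
  by apply: le_trans (ler_normB _ _) _; lra.
Unshelve. all: by end_near.
Qed.

End principal_value_exists.

Section bounded_fubini.
Context d1 d2 (T1 : measurableType d1) (T2 : measurableType d2) (R : realType).
Variables (m1 : probability T1 R) (m2 : probability T2 R).
Variables (f : T1 * T2 -> R) (c : R).
Hypotheses (mf : measurable_fun setT f) (fc : forall p, `|f p| <= c).

Let imf : (m1 \x m2)%E.-integrable setT (EFin \o f).
Proof. exact: bounded_Rintegrable fc. Qed.

Let FE x : (\int[m2]_y f (x, y))%:E = (\int[m2]_y (f (x, y))%:E)%E.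
Proof.
rewrite /Rintegral fineK//; apply: integrable_fin_num => //.
apply: (@bounded_Rintegrable _ _ _ m2 (fun y => f (x, y)) c) => //.
exact: measurableT_comp.
Qed.

Let GE y : (\int[m1]_x f (x, y))%:E = (\int[m1]_x (f (x, y))%:E)%E.
Proof.
rewrite /Rintegral fineK//; apply: integrable_fin_num => //.
apply: (@bounded_Rintegrable _ _ _ m1 (fun x => f (x, y)) c) => //.
exact: measurableT_comp.
Qed.

Lemma bounded_fubini1 : \int[m1]_x \int[m2]_y f (x, y) = \int[(m1 \x m2)%E]_p f p.
Proof.
rewrite {1}/Rintegral /Rintegral; congr fine.
under eq_integral do rewrite FE.
by rewrite -(integral12_prod_meas1 imf).
Qed.

Lemma bounded_fubini2 : \int[m2]_y \int[m1]_x f (x, y) = \int[(m1 \x m2)%E]_p f p.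
Proof.
rewrite {1}/Rintegral /Rintegral; congr fine.
under eq_integral do rewrite GE.
by rewrite -(integral21_prod_meas1 imf).
Qed.

Lemma measurable_bounded_fubini : measurable_fun setT (fun x => \int[m2]_y f (x, y)).
Proof.
apply/measurable_EFinP; apply: eq_measurable_fun (measurable_fubini_F imf) => x _.
by rewrite /= FE.
Qed.

End bounded_fubini.

(** Fubini in one order for f and in the other order for its transpose. *)
Lemma bounded_swap d (T : measurableType d) (R : realType) (m : probability T R)
    (f : T * T -> R) (c : R) : measurable_fun setT f -> (forall p, `|f p| <= c) ->
  \int[(m \x m)%E]_p f (p.2, p.1) = \int[(m \x m)%E]_p f p.
Proof.
move=> mf fc.
have mf' : measurable_fun setT (fun p : T * T => f (p.2, p.1)).
  apply: (measurableT_comp mf).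
  exact: (measurable_fun_pair measurable_snd measurable_fst).
rewrite -(bounded_fubini1 _ _ mf fc).
by rewrite -(@bounded_fubini2 _ _ _ _ _ m m _ c mf')// => p; exact: fc.
Qed.

(** * Truncation and symmetrization of the velocity integral *)

Section velocity.
Context (R : realType).
Local Notation mu := (@lebesgue_measure R).
Local Notation Rm := (measurableTypeR R).
Variables (nu : probability Rm R) (rho : R -> R) (tau : R -> R -> R).
Hypothesis nu_rho : has_density nu rho.
Variables (T : Rm * Rm -> R) (K : R) (E : set Rm).
Hypotheses (mT : measurable_fun setT T) (TK : forall p, `|T p| <= K).
Hypothesis T_sym : forall s t : Rm, T (s, t) = T (t, s).
Hypotheses (mE : measurable E) (nuE : nu (~` E) = 0%E).
Hypothesis tauT : forall s t : Rm, E s -> E t -> s <> t -> tau s t = T (s, t).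
Variables (eta alpha C : R).
Hypotheses (eta0 : 0 < eta) (alpha0 : 0 < alpha).
Hypothesis hoelder : {ae mu, forall s : R, forall t : R, s - eta <= t <= s + eta ->
  `|tau s t * rho t - tau s s * rho s| <= C * `|t - s| `^ alpha}.
Variables (k : Rm -> R) (kappa : Rm * Rm -> R) (c : R).
Hypotheses (mk : measurable_fun setT k) (kc : forall s, `|k s| <= c).
Hypotheses (mkap : measurable_fun setT kappa) (kapc : forall p, `|kappa p| <= c).
Hypothesis kappa_sym : forall s t : R, s <> t ->
  kappa (s, t) + kappa (t, s) = (k s - k t) / (s - t).

Let mrho : measurable_fun [set: Rm] rho. Proof. by case: nu_rho. Qed.
Let rho0 s : 0 <= rho s. Proof. by case: nu_rho. Qed.
Let K0 : 0 <= K. Proof. exact: le_trans (TK (0, 0)). Qed.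
Let c0 : 0 <= c. Proof. exact: le_trans (kc 0). Qed.

Let irho : mu.-integrable [set: Rm] (EFin \o rho) /\ \int[mu]_t rho t = 1.
Proof.
have i1 : nu.-integrable setT (EFin \o (fun _ => 1)).
  exact: finite_measure_integrable_cst.
have [i2 e2] := Rintegral_density nu_rho i1.
have e : (fun s => 1 * rho s) = rho by apply/funext => s; rewrite mul1r.
rewrite e in i2 e2; split => //; rewrite -e2 Rintegral_cst//.
by have /(congr1 fine)/= -> := probability_setT nu; rewrite mulr1.
Qed.

(** As nu gives no mass to the complement of E, [rho] vanishes almost everywhere there; hence tau s
    t * rho t and T (s, t) * rho t agree for almost every t as soon as s is in E. *)
Let null_rho : exists N0 : set Rm, [/\ measurable N0, mu N0 = 0%E &
  forall t, ~ N0 t -> ~ E t -> rho t = 0].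
Proof.
have mnE : measurable (~` E) by exact: measurableC.
have [_ _ nuA] := nu_rho.
have : (\int[mu]_(t in ~` E) `|(rho t)%:E| = 0)%E.
  rewrite -nuE nuA//; apply: eq_integral => t _.
  by rewrite gee0_abs// lee_fin.
have mEr : measurable_fun (~` E) (EFin \o rho) by exact/measurable_EFinP/measurable_funTS.
move=> /(proj1 (ae_eq_integral_abs mu mnE mEr)) [N0 [mN0 N00 sub]]; exists N0; split => // t Nt Et.
by apply: contrapT => r0; apply: Nt; apply: sub => /= /(_ Et) [].
Qed.

Let D (e : R) : set (Rm * Rm) := [set p | e < `|p.1 - p.2|].
Let h (e : R) (p : Rm * Rm) : R := \1_(D e) p * (T p / (p.1 - p.2)).

Let mD e : measurable (D e).
Proof.
rewrite -[X in measurable X]setTI.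
have mn : measurable_fun [set: Rm * Rm] (fun p : Rm * Rm => `|p.1 - p.2| : R).
  by apply: measurableT_comp => //; exact: (measurable_funB measurable_fst measurable_snd).
have -> : D e = (fun p : Rm * Rm => `|p.1 - p.2| : R) @^-1` `]e, +oo[%classic.
  by apply/seteqP; split => t /=; rewrite in_itv/= andbT.
by apply: mn => //; exact: measurable_itv.
Qed.

Let mh e : measurable_fun setT (h e).
Proof.
apply: measurable_funM; first exact: measurable_indic.
apply: measurable_funM => //; apply: (measurableT_comp (@measurable_invr R)).
exact: (measurable_funB measurable_fst measurable_snd).
Qed.

Let h_le e p : 0 < e -> `|h e p| <= K / e.
Proof.
move=> e0; rewrite /h indicE; case: (boolP (p \in D e)) => [/set_mem pD|_]; last first.
  by rewrite mul0r normr0 divr_ge0// ltW.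
rewrite mul1r normrM ler_pM// normrV ?unitfE; last first.
  by rewrite -normr_gt0 (lt_trans e0).
by rewrite lef_pV2 ?posrE// ?ltW// (lt_trans e0).
Qed.

(** The truncated Hilbert integral of T (s, t) rho t, written against nu: its kernel is then
    bounded, and Fubini gives measurability in s. *)
Let G e s := \int[nu]_t h e (s, t).

Let mG e : 0 < e -> measurable_fun setT (G e).
Proof.
by move=> e0; apply: (@measurable_bounded_fubini _ _ _ _ _ nu nu _ (K / e)) => // p; exact: h_le.
Qed.

Let u s t := T (s, t) * rho t.

Let mu_u s : measurable_fun [set: Rm] (u s).
Proof. by apply: measurable_funM => //; exact: measurableT_comp. Qed.

Let iu s : mu.-integrable [set: Rm] (EFin \o u s) /\ \int[mu]_t `|u s t| <= K.
Proof.
have [ir er] := irho.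
have iKr : mu.-integrable [set: Rm] (EFin \o (fun t => K * rho t)) by exact: integrableZl ir.
have le t : `|u s t| <= K * rho t by rewrite normrM (ger0_norm (rho0 t)) ler_wpM2r.
have i1 : mu.-integrable [set: Rm] (EFin \o u s) by apply: (Rintegrable_le _ _ iKr).
split => //; have i2 := integrable_norm i1.
apply: (@le_trans _ _ (\int[mu]_t (K * rho t))); first by apply: le_Rintegral.
by rewrite RintegralZl// er mulr1.
Qed.

Let away_density (s : Rm) (e : R) : 0 < e ->
  \int[mu]_(t in [set t : R | e < `|s - t|]) (u s t / (s - t)) = G e s.
Proof.
move=> e0; rewrite /G.
have ih : nu.-integrable setT (EFin \o (fun t => h e (s, t))).
  apply: (@bounded_Rintegrable _ _ _ nu (fun t => h e (s, t)) (K / e)).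
    by apply: measurable_fun_pair2; exact: mh.
  by move=> t; exact: h_le.
have [_ ->] := Rintegral_density nu_rho ih.
rewrite Rintegral_mkcond; apply: eq_Rintegral => t _.
rewrite patchE /h indicE.
have -> : (t \in [set t : R | e < `|s - t|]) = ((s, t) \in D e).
  by apply/idP/idP => /set_mem ht; apply/mem_set.
by case: (_ \in _); rewrite ?mul0r// mul1r /u; ring.
Qed.

Let tau_away s e : E s -> 0 < e ->
  \int[mu]_(t in [set t : R | e < `|s - t|]) (tau s t * rho t / (s - t)) = G e s.
Proof.
move=> Es e0; rewrite -away_density//.
have [N0 [mN0 N00 rN]] := null_rho.
rewrite Rintegral_mkcond [RHS]Rintegral_mkcond /Rintegral; congr fine.
apply: (@integral_off_null _ _ _ mu (N0 `|` [set s])).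
- exact: measurableU.
- by apply: null_set_setU => //; exact: lebesgue_measure_set1.
- apply/measurable_EFinP; apply/(measurable_restrictT _ _).1 => //.
    have := @mD e; rewrite /D => mDe.
    have := measurable_xsection s mDe; congr measurable.
    by apply/seteqP; split => t; rewrite /xsection /= inE.
  apply: measurable_funTS; apply: measurable_funM; first exact: mu_u.
  exact: measurable_subinv.
- move=> t /not_orP[Nt st]; congr EFin; rewrite !patchE; case: ifP => // _.
  congr (_ / _); rewrite /u; have [Et|nEt] := pselect (E t).
    by rewrite tauT// => e1; apply: st; rewrite e1.
  by rewrite rN// !mulr0.
Qed.

(** The bound of [pv_exists] with M = K, and |C| in place of C, whose sign is unknown. *)
Let B0 : R := K / eta + 2 * (`|C| * (2 * (expR (alpha * ln eta) / alpha))).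

Let pv_good s : E s -> (forall t : R, s - eta <= t <= s + eta ->
    `|tau s t * rho t - tau s s * rho s| <= C * `|t - s| `^ alpha) ->
  exists l, [/\ G e s @[e --> 0^'+] --> l,
    hilbert (fun t => tau s t * rho t) s = l &
    forall e, 0 < e -> e < eta -> `|G e s| <= B0].
Proof.
move=> Es hs; have [N0 [mN0 N00 rN]] := null_rho; have [i1 i2] := iu s.
have hol (t : R) : ~ (N0 `|` [set s : Rm]) t -> 0 < `|t - s| <= eta ->
    `|u s t - tau s s * rho s| <= `|C| * expR (alpha * ln `|t - s|).
  move=> /not_orP[Nt st] /andP[t0 te].
  have -> : u s t = tau s t * rho t.
    rewrite /u; have [Et|nEt] := pselect (E t).
      by rewrite tauT// => e1; apply: st; rewrite e1.
    by rewrite rN// !mulr0.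
  have := hs t; rewrite -ler_distl => /(_ te) /le_trans; apply.
  rewrite /powR gt_eqF// ler_wpM2r ?expR_ge0//; exact: ler_norm.
have mN : measurable (N0 `|` [set s : Rm]) by exact: measurableU.
have NN : mu (N0 `|` [set s : Rm]) = 0%E.
  by apply: null_set_setU => //; exact: lebesgue_measure_set1.
have [l [cl bl]] := pv_exists alpha0 eta0 (normr_ge0 C) (mu_u s) i1 i2 mN NN hol.
have cG : G e s @[e --> 0^'+] --> l.
  apply: cvg_trans cl; apply: near_eq_cvg; near=> e.
  by rewrite away_density.
exists l; split => //.
- rewrite /hilbert; apply/cvg_lim => //; apply: cvg_trans cG.
  by apply: near_eq_cvg; near=> e; rewrite tau_away.
- by move=> e e0 ee; rewrite -away_density//; exact: bl.
Unshelve. all: by end_near.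
Qed.

Let ep (n : nat) : R := eta / n.+2%:R.

Let ep0 n : 0 < ep n. Proof. by rewrite divr_gt0. Qed.

Let ep_lt n : ep n < eta.
Proof. by rewrite ltr_pdivrMr// ltr_pMr// ltr1n. Qed.

Let ep_cvg : ep n @[n --> \oo] --> 0.
Proof.
rewrite -[X in _ --> X](mulr0 eta); apply: cvgMr.
by have := @cvg_harmonic R; rewrite -cvg_shiftS.
Qed.

(** Add the integral with s and t exchanged. T is symmetric and 1 / (s - t) antisymmetric, so k s
    becomes k s - k t; the quotient by s - t is the symmetrization of [kappa], and the singularity
    is gone. The cutoff keeps the integrands bounded before the exchange. *)
Let symmetrized e : 0 < e ->
  \int[nu]_s (k s * G e s) = \int[(nu \x nu)%E]_p (\1_(D e) p * (kappa p * T p)).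
Proof.
move=> e0; set P2 := (nu \x nu)%E.
pose f1 p := k p.1 * h e p; pose f2 p := \1_(D e) p * (kappa p * T p).
have mf1 : measurable_fun setT f1.
  by apply: measurable_funM => //; exact: measurableT_comp.
have f1c p : `|f1 p| <= c * (K / e).
  by rewrite normrM ler_pM//; exact: h_le.
have mf2 : measurable_fun setT f2.
  apply: measurable_funM; first exact: measurable_indic.
  exact: measurable_funM.
have f2c p : `|f2 p| <= c * K.
  rewrite !normrM -[leRHS]mul1r ler_pM ?mulr_ge0//; last exact: ler_pM.
  by rewrite indicE; case: (_ \in _); rewrite ?normr1 ?normr0.
have -> : \int[nu]_s (k s * G e s) = \int[P2]_p f1 p.
  rewrite -(bounded_fubini1 _ _ mf1 f1c); apply: eq_Rintegral => s _.
  rewrite /f1 /= RintegralZl//.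
  apply: (@bounded_Rintegrable _ _ _ nu _ (K / e)); first exact: measurableT_comp.
  by move=> t; exact: h_le.
have sw1 := bounded_swap nu mf1 f1c; have sw2 := bounded_swap nu mf2 f2c.
have i1 : P2.-integrable setT (EFin \o f1) by exact: bounded_Rintegrable f1c.
have i2 : P2.-integrable setT (EFin \o f2) by exact: bounded_Rintegrable f2c.
have msw : measurable_fun setT (fun p : Rm * Rm => (p.2, p.1)).
  exact: (measurable_fun_pair measurable_snd measurable_fst).
have i1' : P2.-integrable setT (EFin \o (fun p => f1 (p.2, p.1))).
  by apply: (@bounded_Rintegrable _ _ _ P2 _ (c * (K / e))) => //; exact: (measurableT_comp mf1 msw).
have i2' : P2.-integrable setT (EFin \o (fun p => f2 (p.2, p.1))).
  by apply: (@bounded_Rintegrable _ _ _ P2 _ (c * K)) => //; exact: (measurableT_comp mf2 msw).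
have main : \int[P2]_p (f1 p + f1 (p.2, p.1)) = \int[P2]_p (f2 p + f2 (p.2, p.1)).
  apply: eq_Rintegral => -[s t] _; rewrite /f1 /f2 /h /=.
  have Dsym : ((t, s) \in D e) = ((s, t) \in D e).
    by apply/idP/idP => /set_mem ht; apply/mem_set; move: ht; rewrite /D /= distrC.
  rewrite !indicE Dsym T_sym; case: (boolP (_ \in D e)) => [/set_mem|_]; last first.
    by rewrite !mul0r !mulr0.
  rewrite /D /= => st; have st0 : s - t != 0 by rewrite -normr_gt0 (lt_trans e0).
  have ts0 : t - s != 0 by rewrite -opprB oppr_eq0.
  have := @kappa_sym s t; rewrite !mul1r -mulrDl => ->; last first.
    by move=> e1; rewrite e1 subrr eqxx in st0.
  by rewrite -(T_sym s t); field; rewrite ts0 st0.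
rewrite !RintegralD// sw1 sw2 in main.
lra.
Qed.

(** The limit e -> 0 in [symmetrized]: the left side converges by the uniform bound on the truncated
    integrals, the right side because its integrand is bounded by c K. *)
Lemma velocity_integral :
  \int[mu]_s (k s * Fvel tau rho s) = - \int[(nu \x nu)%E]_p (kappa p * T p).
Proof.
have [N0 [mN0 N00 rN]] := null_rho.
have [N1 [mN1 N10 hN1]] := hoelder.
(* The points where the Hoelder condition holds and [tau] may be replaced by [T]; nu does not charge
   the complement. *)
pose A : set Rm := E `\` N1.
have mA : measurable A by exact: measurableD.
have nuA0 : nu (~` A) = 0%E.
  have -> : ~` A = ~` E `|` N1.
    by apply/seteqP; split => x; rewrite /A /= not_andP notK.
  apply: null_set_setU => //; first exact: measurableC.
  exact: (density_dominated nu_rho).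
have good s : A s -> exists l, [/\ G e s @[e --> 0^'+] --> l,
    hilbert (fun t => tau s t * rho t) s = l &
    forall e, 0 < e -> e < eta -> `|G e s| <= B0].
  move=> [Es Ns]; apply: pv_good => //.
  by apply: contrapT => hs; apply: Ns; apply: hN1.
(* After the cut by A, convergence and bound hold at every s, so the limit L is measurable, whereas
   [hilbert] takes default values where no limit exists. *)
pose Gn n s := \1_A s * G (ep n) s.
pose L s := \1_A s * hilbert (fun t => tau s t * rho t) s.
have GL s : Gn n s @[n --> \oo] --> L s.
  rewrite /Gn /L indicE; case: (boolP (s \in A)) => [/set_mem As|_]; last first.
    by rewrite mul0r; under eq_fun do rewrite mul0r; exact: cvg_cst.
  under eq_fun do rewrite mul1r; rewrite mul1r.
  have [l [cl -> _]] := good s As.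
  by move/cvg_at_rightP: cl; apply; split; [exact: ep0|exact: ep_cvg].
have mGn n : measurable_fun setT (Gn n).
  by apply: measurable_funM; [exact: measurable_indic|exact: mG].
have mL : measurable_fun setT L.
  by apply: (@measurable_fun_cvg _ _ _ _ Gn) => // s _; exact: GL.
have GnB n s : `|Gn n s| <= `|B0|.
  rewrite /Gn indicE; case: (boolP (s \in A)) => [/set_mem As|_]; last first.
    by rewrite mul0r normr0.
  rewrite mul1r; have [l [_ _ b]] := good s As.
  by apply: le_trans (ler_norm _); apply: b.
have aeA : {ae nu, forall s, A s}.
  by exists (~` A); split => //; exact: measurableC.
have kGB n s : `|k s * Gn n s| <= c * `|B0| by rewrite normrM ler_pM.
have [iL cL] := @bounded_convergence _ _ _ nu (fun n s => k s * Gn n s)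
  (fun s => k s * L s) (c * `|B0|)
  (fun n => measurable_funM mk (mGn n)) (measurable_funM mk mL)
  (aeW _ (fun s => cvgM (cvg_cst (k s)) (GL s)))
  (aeW _ (fun s n => kGB n s)).
have eqn n : \int[nu]_s (k s * Gn n s) =
    \int[(nu \x nu)%E]_p (\1_(D (ep n)) p * (kappa p * T p)).
  rewrite -symmetrized// /Rintegral; congr fine.
  apply: (@integral_off_null _ _ _ nu (~` A)) => //.
  - exact: measurableC.
  - by apply/measurable_EFinP; apply: measurable_funM => //; exact: mG.
  - by move=> s /contrapT As; rewrite /Gn indicE mem_set// mul1r.
have mKT : measurable_fun setT (fun p => kappa p * T p) by exact: measurable_funM.
(* The diagonal is null for the product measure since nu has no atoms; off it, the cutoff indicators
   are eventually 1. *)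
have offdiag : {ae (nu \x nu)%E, forall p : Rm * Rm, p.1 - p.2 != 0 :> R}.
  exists [set p : Rm * Rm | p.1 - p.2 == 0 :> R].
  have md : measurable [set p : Rm * Rm | p.1 - p.2 == 0 :> R].
    rewrite -[X in measurable X]setTI.
    have mB : measurable_fun [set: Rm * Rm] (fun p : Rm * Rm => p.1 - p.2 : R).
      exact: (measurable_funB measurable_fst measurable_snd).
    have -> : [set p : Rm * Rm | p.1 - p.2 == 0 :> R] =
        (fun p : Rm * Rm => p.1 - p.2 : R) @^-1` [set 0].
      by apply/seteqP; split => p /= /eqP.
    by apply: mB => //; exact: measurable_set1.
  split => //; last by move=> p /= /negP; rewrite negbK.
  rewrite /product_measure1 -[RHS](@integral0 _ _ _ nu setT).
  apply: eq_integral => s _ /=.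
  have -> : xsection [set p : Rm * Rm | p.1 - p.2 == 0 :> R] s = [set s].
    apply/seteqP; split => t; rewrite /xsection /= inE/= subr_eq0.
      by move=> /eqP.
    by move=> ->.
  exact: (density_set1 nu_rho).
have cR : \int[(nu \x nu)%E]_p (\1_(D (ep n)) p * (kappa p * T p)) @[n --> \oo] -->
    \int[(nu \x nu)%E]_p (kappa p * T p).
  have mDKT n : measurable_fun setT (fun p => \1_(D (ep n)) p * (kappa p * T p)).
    by apply: measurable_funM => //; exact: measurable_indic.
  have cvD : {ae (nu \x nu)%E, forall p,
      \1_(D (ep n)) p * (kappa p * T p) @[n --> \oo] --> kappa p * T p}.
    apply: filterS offdiag => p p0; apply: cvg_near_cst; near=> n.
    rewrite indicE mem_set ?mul1r// /D /=.
    by near: n; apply: (cvgr_lt _ ep_cvg); rewrite normr_gt0.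
  have bD : {ae (nu \x nu)%E, forall p, forall n,
      `|\1_(D (ep n)) p * (kappa p * T p)| <= c * K}.
    apply: aeW => p n; rewrite !normrM -[leRHS]mul1r ler_pM ?mulr_ge0//; last exact: ler_pM.
    by rewrite indicE; case: (_ \in _); rewrite ?normr1 ?normr0.
  exact: (bounded_convergence mDKT mKT cvD bD).2.
have key : \int[nu]_s (k s * L s) = \int[(nu \x nu)%E]_p (kappa p * T p).
  have e : (fun n => \int[nu]_s (k s * Gn n s)) =
      (fun n => \int[(nu \x nu)%E]_p (\1_(D (ep n)) p * (kappa p * T p))).
    by apply/funext => n; exact: eqn.
  rewrite -(cvg_lim (@Rhausdorff _) cL) e; exact: cvg_lim.
have [_ dL] := Rintegral_density nu_rho iL.
rewrite -key dL.
have mm : measurable_fun [set: Rm] (fun s => k s * L s * rho s).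
  by apply: measurable_funM => //; exact: measurable_funM.
have idL := (Rintegral_density nu_rho iL).1.
transitivity (\int[mu]_s (-1 * (k s * L s * rho s))); last by rewrite RintegralZl// mulN1r.
(* The velocity equals -L rho off a null set: by definition of L on E, and because [rho] vanishes
   outside E. *)
rewrite /Rintegral; congr fine; apply: (@integral_off_null _ _ _ mu (N0 `|` N1)).
- exact: measurableU.
- exact: null_set_setU.
- apply/measurable_EFinP; exact: measurable_funM.
- move=> s /not_orP[s0 s1]; congr EFin; rewrite /Fvel /L indicE.
  have [Es|nEs] := pselect (E s).
    have As : A s by split.
    by rewrite (mem_set As) /= mulr1n; ring.
  by rewrite (rN s s0 nEs); ring.
Unshelve. all: by end_near.
Qed.

End velocity.

(** * A measurable right inverse *)

Section measurable_selection.
Context (R : realType).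
Local Notation mu := (@lebesgue_measure R).
Local Notation Rm := (measurableTypeR R).

(** A nonempty fiber of f in K is compact and so has a least point. Choosing this point makes the
    selection below measurable. *)
Lemma compact_fiber_min (K : set R) (f : R -> R) (t : R) : compact K ->
  {within K, continuous f} -> (f @` K) t ->
  exists x, [/\ K x, f x = t & forall x', K x' -> f x' = t -> x <= x'].
Proof.
move=> cK cf [x0 Kx0 fx0].
have c1 : closed [set t] by apply: compact_closed; [exact: Rhausdorff|exact: compact_set1].
have cl : closed (f @^-1` [set t] : set (subspace K)).
  exact: ((continuous_closedP (f : subspace K -> R)).1 cf [set t] c1).
have [W cW WE] := (closed_subspaceP _ _).1 cl.
have cKW : compact (K `&` W) by exact: compact_closedI.
have mem x : (K `&` W) x <-> K x /\ f x = t.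
  have := congr1 (fun A : set R => A x) WE; rewrite /= => E.
  split=> [[Kx Wx]|[Kx fx]].
    by have : W x /\ K x by []; rewrite E => -[].
  by have : f x = t /\ K x by []; rewrite -E => -[].
have ne : (K `&` W) !=set0 by exists x0; apply/mem.
have cid : {within K `&` W, continuous (@id R)}.
  by apply: continuous_subspaceT => ?; exact: cvg_id.
have [x xin xmin] := compact_EVT_min ne cKW cid.
have [Kx fx] := (mem x).1 (set_mem xin).
by exists x; split => // x' Kx' fx'; apply: xmin; apply/mem_set/mem.
Qed.

(** Lusin's theorem gives compact sets [K m] almost filling [0, 1] on which f is continuous. On each
    image the least preimage in [K m] is a measurable choice; the choices are glued along disjoint
    pieces of the union E of the images. *)
Lemma measurable_right_inverse (f : R -> R) : measurable_fun [set: Rm] f ->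
  exists (E : set Rm) (g : Rm -> R), [/\ measurable E, measurable_fun setT g,
    forall t, E t -> 0 <= g t <= 1 /\ f (g t) = t &
    mu (`[0, 1] `\` f @^-1` E) = 0%E].
Proof.
move=> mf.
have A1 : (mu `[0%R, 1%R]%classic < +oo)%E.
  by rewrite lebesgue_measure_itv/= lte_fin ltr01 ltry.
have mA : measurable (`[0, 1]%classic : set Rm) by exact: measurable_itv.
have exK (m : nat) : exists K : set R, [/\ compact K, K `<=` `[0, 1],
    (mu (`[0%R, 1%R] `\` K) < (m.+1%:R^-1)%:E)%E & {within K, continuous f}].
  by apply: measurable_almost_continuous => //; exact: measurable_funTS.
have [K hK] := choice exK.
pose F m := f @` (K m).
have cF m : compact (F m) by have [cK _ _ cf] := hK m; exact: continuous_compact.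
have mF m : measurable (F m : set Rm) by exact: compact_measurable.
pose gm m t := xget 0 [set x | [/\ K m x, f x = t &
  forall x', K m x' -> f x' = t -> x <= x']].
have gmP m t : F m t -> [/\ K m (gm m t), f (gm m t) = t &
    forall x', K m x' -> f x' = t -> gm m t <= x'].
  move=> Ft; have [cK _ _ cf] := hK m.
  have [x hx] := compact_fiber_min cK cf Ft.
  exact: (@xgetPex _ 0 [set x | [/\ K m x, f x = t &
    forall x', K m x' -> f x' = t -> x <= x']] (ex_intro _ x hx)).
have mgm m : measurable_fun (F m : set Rm) (gm m).
  move=> mD; apply: (measurability _ (RGenOInfty.measurableE R)) => //.
  move=> /= _ [_ [a ->] <-].
  have [cK _ _ cf] := hK m.
  have cI : compact (f @` (K m `&` `]-oo, a])).
    apply: continuous_compact; last exact: compact_closedI.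
    by apply: continuous_subspaceW cf; exact: subIsetl.
  (* The least preimage exceeds a exactly when no preimage in [K m] is at most a, so this set is a
     difference of two compact images. *)
  have -> : F m `&` gm m @^-1` `]a, +oo[ = F m `\` f @` (K m `&` `]-oo, a]).
    apply/seteqP; split => t /=; rewrite in_itv/= andbT => -[Ft].
      move=> ag; split => // -[x [Kx]]; rewrite /= in_itv/= => xa fx.
      have [_ _ /(_ x Kx fx) gx] := gmP m t Ft.
      by have := lt_le_trans ag (le_trans gx xa); rewrite ltxx.
    move=> h; split => //; rewrite ltNge; apply/negP => ga; apply: h.
    have [Kg fg _] := gmP m t Ft.
    by exists (gm m t) => //; split => //=; rewrite in_itv.
  by apply: measurableD => //; exact: compact_measurable.
pose E := \bigcup_m F m.
have mE : measurable (E : set Rm) by exact: bigcup_measurable.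
(* [seqDU] makes the images disjoint, so each point of E has a single index. *)
pose idx t := xget 0%N [set m | seqDU F m t].
pose g t := gm (idx t) t.
have idxP t m : seqDU F m t -> idx t = m.
  move=> h; have h2 : seqDU F (idx t) t by exact: (@xgetPex _ 0%N [set m | seqDU F m t] (ex_intro _ m h)).
  have := @trivIset_seqDU _ F; move=> /(_ (idx t) m Logic.I Logic.I); apply.
  by exists t.
have mDU m : measurable (seqDU F m : set Rm).
  by apply: measurableD => //; exact: bigsetU_measurable.
have mg : measurable_fun (E : set Rm) g.
  rewrite /E seqDU_bigcup_eq; apply/(measurable_fun_bigcup _ _).2 => // m.
  apply: (@eq_measurable_fun _ _ _ _ _ (gm m)).
    by move=> t /set_mem/idxP; rewrite /g => ->.
  apply: measurable_funS (mgm m) => //; exact: subDsetl.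
exists E, (g \_ E); split => //.
- exact/(measurable_restrictT _ _).1.
- move=> t Et; rewrite patchE mem_set//.
  have [m _ hm] : (\bigcup_m seqDU F m) t by rewrite -seqDU_bigcup_eq.
  rewrite /g (idxP t m hm); have [Ft _] := hm.
  have [Kg fg _] := gmP m t Ft; have [_ KA _ _] := hK m.
  by split => //; have := KA _ Kg; rewrite /= in_itv.
- have mAE : measurable (`[0, 1] `\` f @^-1` E : set Rm).
    apply: measurableD => //; rewrite -[X in measurable X]setTI.
    exact: mf.
  (* Each [K m] is mapped into E, so the exceptional set lies in [0, 1] minus [K m] for every m. *)
  apply/eqP; rewrite eq_le measure_ge0 andbT; apply/lee_addgt0Pr => e e0.
  rewrite add0e; have [m hm] : exists m : nat, m.+1%:R^-1 < e.
    by exists (Num.truncn e^-1); rewrite -[ltRHS]invrK ltf_pV2 ?posrE ?invr_gt0// truncnS_gt.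
  have [cK _ /ltW hmu _] := hK m.
  apply: (@le_trans _ _ (mu (`[0%R, 1%R] `\` K m))).
    apply: le_measure; rewrite ?inE//.
      by apply: measurableD => //; exact: compact_measurable.
    move=> x [Ax nE]; split => // Kx; apply: nE; exists m => //; exists x => //.
  by apply: le_trans hmu _; rewrite lee_fin ltW.
Qed.

End measurable_selection.

(** * Spectral distributions and Riemann sums *)

Section spectral_distribution.
Context (R : realType).

Lemma esd_Rintegral n (A : 'M[R[i]]_n.+1) (g : R -> R) : measurable_fun setT g ->
  \int[esd A]_x g x = n.+1%:R^-1 * \sum_(k < n.+1) g (eigval A k).
Proof.
move=> mg.
have ge (h : R -> R) : measurable_fun setT h -> (forall x, 0 <= h x) ->
    (\int[esd A]_x (h x)%:E = (n.+1%:R^-1 * \sum_(k < n.+1) h (eigval A k))%:E)%E.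
  move=> mh h0; have mEh : measurable_fun setT (EFin \o h) by exact/measurable_EFinP.
  rewrite /esd ge0_integral_mscale//=; last by move=> x _; rewrite lee_fin.
  rewrite ge0_integral_measure_sum//=; last by move=> x _; rewrite lee_fin.
  rewrite EFinM; congr (_ * _)%E; rewrite -sumEFin; apply: eq_bigr => k _.
  by rewrite integral_dirac// diracT mul1e.
have mp : measurable_fun setT (fun x => Num.max (g x) 0) by exact: measurable_maxr.
have mn : measurable_fun setT (fun x => Num.max (- g x) 0).
  by apply: measurable_maxr => //; exact: measurable_funN.
rewrite /Rintegral integralE.
have -> : ((EFin \o g)^\+)%E = EFin \o (fun x => Num.max (g x) 0).
  by apply/funext => x; rewrite funeposE /= -EFin_max.
have -> : ((EFin \o g)^\-)%E = EFin \o (fun x => Num.max (- g x) 0).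
  by apply/funext => x; rewrite funenegE /= -EFin_max.
rewrite (ge _ mp); last by move=> x; rewrite le_max lexx orbT.
rewrite (ge _ mn); last by move=> x; rewrite le_max lexx orbT.
rewrite -EFinB /= -mulrBr -sumrB; congr (_ * _); apply: eq_bigr => k _.
by case: (lerP (g (eigval A k)) 0) => h; case: (lerP (- g (eigval A k)) 0) => h'; lra.
Qed.

(** With c = 1 or c = -i this is the real or imaginary part of 1 / (z - l), a bounded continuous
    real function, as weak convergence tests require. *)
Definition resolvent_kernel (c z : R[i]) (l : R) : R := complex.Re (c * (z - toC l)^-1).

Lemma resolvent_kernelE (c z : R[i]) l : complex.Im z != 0 -> resolvent_kernel c z l =
  (complex.Re c * (complex.Re z - l) + complex.Im c * complex.Im z) /
  ((complex.Re z - l) ^+ 2 + complex.Im z ^+ 2).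
Proof.
move=> z0; rewrite /resolvent_kernel; case: z c z0 => [a b] [p q] /= b0.
rewrite subr0; set D := _ + b ^+ 2; ring.
Qed.

Lemma resolvent_kernel_continuous (c z : R[i]) : complex.Im z != 0 ->
  continuous (resolvent_kernel c z).
Proof.
move=> z0.
have -> : resolvent_kernel c z = fun l : R =>
  (complex.Re c * (complex.Re z - l) + complex.Im c * complex.Im z) *
  ((complex.Re z - l) * (complex.Re z - l) + complex.Im z ^+ 2)^-1.
  by apply/funext => l; rewrite resolvent_kernelE// expr2.
move=> l.
have cl : {for l, continuous (fun l : R => complex.Re z - l)}.
  by apply: continuousB; [exact: cst_continuous|exact: cvg_id].
have cst (r : R) : {for l, continuous (fun _ : R => r)} by exact: cst_continuous.
have cA : {for l, continuous (fun l : R =>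
    complex.Re c * (complex.Re z - l) + complex.Im c * complex.Im z)}.
  exact: (continuousD (continuousM (cst _) cl) (cst _)).
have cB : {for l, continuous (fun l : R =>
    (complex.Re z - l) * (complex.Re z - l) + complex.Im z ^+ 2)}.
  exact: (continuousD (continuousM cl cl) (cst _)).
have B0 : (complex.Re z - l) * (complex.Re z - l) + complex.Im z ^+ 2 != 0.
  by rewrite -expr2 gt_eqF// ltr_wpDl ?sqr_ge0// exprn_even_gt0.
have cV := cvgV B0 cB.
exact: (cvgM cA (cV _)).
Qed.

Lemma normc_re_kernel (c z : R[i]) l : complex.Im z != 0 -> normc c <= 1 ->
  `|resolvent_kernel c z l| <= `|complex.Im z|^-1.
Proof.
move=> z0 c1; apply: le_trans (CRe_le_normc _) _.
rewrite ComplexField.Normc.normcM -[leRHS]mul1r.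
by apply: ler_pM; rewrite ?normc_ge0// normc_resolvent.
Qed.

Lemma esd_resolvent_kernel n (A : 'M[R[i]]_n.+1) (c z : R[i]) : A \is hermsymmx ->
  complex.Im z != 0 ->
  \int[esd A]_l resolvent_kernel c z l =
  n.+1%:R^-1 * complex.Re (c * \tr (invmx (z%:M - A))).
Proof.
move=> hA z0; rewrite esd_Rintegral; last first.
  by apply: continuous_measurable_fun; exact: resolvent_kernel_continuous.
congr (_ * _); rewrite -resolvent_trace// [c * _]mulr_sumr CRe_sum.
by apply: eq_bigr => k _; rewrite /resolvent_kernel /eigval inord_val.
Qed.

End spectral_distribution.

Section convergence_of_means.
Context (R : realType) (d : nat -> measure_display).
Variables (T : forall n, measurableType (d n)) (P : forall n, probability (T n) R).

Lemma means_cvg (X : forall n, T n -> R) (M m : R) :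
  (forall n, measurable_fun setT (X n)) -> (forall n w, `|X n w| <= M) ->
  `|m| <= M ->
  (forall e : R, 0 < e ->
    P n [set w | e <= `|X n w - m|] @[n --> \oo] --> 0%E) ->
  \int[P n]_w X n w @[n --> \oo] --> m.
Proof.
move=> mX XM mM cP; apply/cvgrPdist_le => e e0.
have M0 : 0 <= M by exact: le_trans mM.
have e2 : 0 < e / 2 by rewrite divr_gt0.
have := cP _ e2; move/fine_cvgP => [_ /cvgrPdist_lt].
(* Off the event A the deviation is below e / 2, and on A it is at most 2 M. The threshold makes 2 M
   times the probability of A less than e / 2; the added 1 covers M = 0. *)
move=> /(_ (e / 2 / (2 * M + 1))); have d0 : 0 < e / 2 / (2 * M + 1).
  by rewrite divr_gt0// ltr_wpDl// mulr_ge0.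
move=> /(_ d0); apply: filterS => n; rewrite sub0r normrN => hn.
rewrite /= in hn; set A := (X in P n X) in hn.
have mXm : measurable_fun setT (fun w => X n w - m) by exact: measurable_funB.
have mA : measurable A.
  rewrite -[Y in measurable Y]setTI.
  have -> : A = (fun w => `|X n w - m|) @^-1` `[e / 2, +oo[%classic.
    by apply/seteqP; split => w /=; rewrite in_itv/= andbT.
  have mn : measurable_fun setT (fun w => `|X n w - m|) by exact: measurableT_comp.
  by apply: mn => //; exact: measurable_itv.
have ic (r : R) : (P n).-integrable setT (EFin \o (fun _ => r)).
  exact: finite_measure_integrable_cst.
have iA : (P n).-integrable setT (EFin \o (fun w => (2 * M) * \1_A w)).
  exact: (integrableZl measurableT (2 * M) (integrable_indic (P n) mA)).
have iX : (P n).-integrable setT (EFin \o X n) by exact: bounded_Rintegrable (XM n).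
have P1 (r : R) : \int[P n]_w r = r.
  rewrite Rintegral_cst//; by have /(congr1 fine)/= -> := probability_setT (P n); rewrite mulr1.
have -> : m - \int[P n]_w X n w = - \int[P n]_w (X n w - m).
  by rewrite RintegralB// P1 opprB.
rewrite normrN.
apply: (@le_trans _ _ (\int[P n]_w (e / 2 + 2 * M * \1_A w))).
  apply: normr_Rintegral_le => //.
    by have := integrableD measurableT (ic (e / 2)) iA; apply.
  move=> w _; rewrite indicE; case: (boolP (w \in A)) => wA.
    rewrite mulr1; apply: le_trans (ler_normB _ _) _.
    by have := XM n w; lra.
  rewrite mulr0 addr0 ltW// ltNge; apply: contra wA => h; exact: mem_set.
rewrite RintegralD// P1 RintegralZl//; last exact: integrable_indic.
have -> : \int[P n]_w \1_A w = fine (P n A).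
  by rewrite /Rintegral integral_indic// setIT.
have hA : fine (P n A) < e / 2 / (2 * M + 1) by apply: le_lt_trans hn; exact: ler_norm.
have : (2 * M + 1) * fine (P n A) < e / 2.
  by rewrite mulrC -ltr_pdivlMr// ltr_wpDl// mulr_ge0.
have : 0 <= fine (P n A) by rewrite fine_ge0.
by rewrite mulrDl mul1r; lra.
Qed.

End convergence_of_means.

Section grid_sums.
Context (R : realType) (n : nat).
Local Notation mu := (@lebesgue_measure R).
Local Notation Rm := (measurableTypeR R).
Local Notation U := (uniform_prob (@ltr01 R) : probability Rm R).
Local Notation N := (n.+1%:R : R).

Lemma uniform_probE (A : set Rm) : measurable A -> U A = mu (A `&` `[0, 1]).
Proof.
move=> mA; transitivity (\int[mu]_(x in A) (uniform_pdf 0 1 x)%:E)%E => //.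
rewrite integral_uniform_pdf.
rewrite (eq_integral (cst 1%E)); last first.
  move=> x; rewrite inE/= in_itv/= => -[_ x01].
  by rewrite /uniform_pdf x01 subr0 invr1.
by rewrite integral_cst ?mul1e//; exact: measurableI.
Qed.

(** Holds for arbitrary sets. It will be applied to preimages under f, whose values outside [0, 1]
    are arbitrary. *)
Lemma uniform_prob_eq (A B : set Rm) : A `&` `[0, 1] = B `&` `[0, 1] ->
  uniform_prob (@ltr01 R) A = uniform_prob (@ltr01 R) B.
Proof. by move=> AB; rewrite /uniform_prob integral_uniform_pdf AB -integral_uniform_pdf. Qed.

Let cell (i : 'I_n.+1) : set Rm := [set x : R | grididx n x = i].

Let mtrunc (m : nat) : measurable ([set x : R | Num.truncn (N * x) = m] : set Rm).
Proof.
have mB (l : nat) : measurable ([set x : R | (l < Num.truncn (N * x))%N] : set Rm).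
  have -> : [set x : R | (l < Num.truncn (N * x))%N] = `[l.+1%:R / N, +oo[%classic.
    apply/seteqP; split => x; rewrite /= truncn_gt_nat in_itv/= andbT.
      by rewrite ler_pdivrMr// mulrC.
    by rewrite ler_pdivrMr// mulrC.
  exact: measurable_itv.
case: m => [|m].
  have -> : [set x : R | Num.truncn (N * x) = 0%N] =
      ~` [set x : R | (0 < Num.truncn (N * x))%N].
    by apply/seteqP; split => x /=; [move=> ->|move/negP; rewrite lt0n negbK => /eqP].
  exact: measurableC.
have -> : [set x : R | Num.truncn (N * x) = m.+1] =
    [set x : R | (m < Num.truncn (N * x))%N] `\` [set x : R | (m.+1 < Num.truncn (N * x))%N].
  apply/seteqP; split => x /=; first by move=> ->; rewrite ltnn.
  by move=> [h /negP]; rewrite -leqNgt => h2; apply/eqP; rewrite eqn_leq h2.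
exact: measurableD.
Qed.

Let mcell i : measurable (cell i).
Proof.
have -> : cell i = \bigcup_(m in [set m : nat | inord m.-1 = i :> 'I_n.+1])
    [set x : R | Num.truncn (N * x) = m].
  apply/seteqP; split => x; rewrite /cell /grididx /=.
    by move=> h; exists (Num.truncn (N * x)).
  by move=> [m /= h ->].
by apply: bigcup_measurable => m _; exact: mtrunc.
Qed.

Let grid_fun (a : 'I_n.+1 -> R) :
  (fun x : Rm => a (grididx n (x : R))) = (fun x => \sum_i a i * \1_(cell i) x).
Proof.
apply/funext => x; rewrite (bigD1 (grididx n (x : R)))//= big1.
  by rewrite addr0 indicE mem_set ?mulr1.
move=> i /eqP ni; rewrite indicE memNset ?mulr0// /cell /= => e.
by apply: ni; rewrite e.
Qed.

Lemma measurable_grid_fun (a : 'I_n.+1 -> R) :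
  measurable_fun [set: Rm] (fun x : Rm => a (grididx n (x : R))).
Proof.
rewrite grid_fun; apply: measurable_sum => i.
by apply: measurable_funM => //; exact: measurable_indic.
Qed.

Let wgt i : R := fine (U (cell i)).

Let wgt_int (a : 'I_n.+1 -> R) :
  \int[U]_x a (grididx n (x : R)) = \sum_i a i * wgt i.
Proof.
rewrite grid_fun.
have ii i : U.-integrable setT (EFin \o (fun x => a i * \1_(cell i) x)).
  exact: (integrableZl measurableT (a i) (integrable_indic U (mcell i))).
rewrite (@Rintegral_sum _ _ _ U setT _ (index_enum 'I_n.+1) predT _ measurableT (fun i _ => ii i)).2.
apply: eq_bigr => i _; rewrite RintegralZl//; last exact: integrable_indic.
by rewrite /Rintegral integral_indic// setIT.
Qed.

(** For the zero-based index i < n, the cell contains the interval where the floor of (n + 1) x is i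
    + 1, which lies in [0, 1] and has length 1 / (n + 1). For n > 0 the first cell also receives the
    floor value 0, while the last one meets [0, 1] only at x = 1. *)
Let wgt_ge (i : 'I_n.+1) : (i < n)%N -> N^-1 <= wgt i.
Proof.
move=> lin; rewrite /wgt -lee_fin fineK ?fin_num_measure// uniform_probE//.
have -> : (N^-1)%:E = mu `[i.+1%:R / N, i.+2%:R / N[%classic.
  rewrite lebesgue_measure_itv/= lte_fin ltr_pM2r ?invr_gt0// ltr_nat ltnSn.
  by rewrite -EFinB -mulrBl -natrB// subSnn mul1r.
apply: le_measure; rewrite ?inE; [exact: measurable_itv|exact: measurableI|].
move=> x /=; rewrite in_itv/= => /andP[h1 h2]; split.
  rewrite /cell /grididx /= (@truncn_def _ _ i.+1) ?inord_val//=.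
  by move: h1 h2; rewrite ler_pdivrMr// ltr_pdivlMr// mulrC => -> ->.
rewrite in_itv/=; apply/andP; split; first by apply: le_trans h1; rewrite divr_ge0.
apply: le_trans (ltW h2) _; rewrite ler_pdivrMr// mul1r ler_nat.
by rewrite ltnS.
Qed.

(** All cells but the last have weight at least 1 / N, so their absolute deviations sum without
    absolute values; since the total mass is 1 this sum is 1 / N - w, with w the last weight, and
    the last cell adds at most 1 / N + w. *)
Let wgt_l1 : \sum_i `|N^-1 - wgt i| <= 2 / N.
Proof.
have s1 : \sum_i wgt i = 1.
  have := wgt_int (fun=> 1); under [RHS]eq_bigr do rewrite mul1r.
  move=> <-; rewrite Rintegral_cst//.
  by have /(congr1 fine)/= -> := probability_setT U; rewrite mulr1.
have w0 i : 0 <= wgt i by rewrite fine_ge0.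
rewrite big_ord_recr/= in s1; rewrite big_ord_recr/=.
have -> : \sum_(i < n) `|N^-1 - wgt (widen_ord (leqnSn n) i)| =
    \sum_(i < n) wgt (widen_ord (leqnSn n) i) - n%:R / N.
  rewrite (eq_bigr (fun i : 'I_n => wgt (widen_ord (leqnSn n) i) - N^-1)).
    by rewrite sumrB sumr_const card_ord -[_ *+ n]mulr_natl.
  by move=> i _; rewrite distrC ger0_norm// subr_ge0 wgt_ge//=.
have : `|N^-1 - wgt ord_max| <= N^-1 + wgt ord_max.
  by apply: le_trans (ler_normB _ _) _; rewrite !ger0_norm// invr_ge0.
have nN : n%:R / N = 1 - N^-1.
  by rewrite -[n%:R](addrK 1) natr1 mulrBl divff// mul1r.
rewrite nN; have : 2 / N = N^-1 + N^-1 by rewrite mulr_natl mulr2n.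
move=> -> h; move: h s1; move: (\sum_(i < n) _) => A; move: (`|_ - _|) => B.
by move: (wgt ord_max) (N^-1) => w q h s1; lra.
Qed.

(** Sum and integral are weighted sums of the same values, with weights 1 / N and [wgt i]; [wgt_l1]
    compares the weights. *)
Lemma grid_sum1 (a : 'I_n.+1 -> R) (M : R) : (forall i, `|a i| <= M) ->
  `|N^-1 * \sum_i a i - \int[U]_x a (grididx n (x : R))| <= 2 * M / N.
Proof.
move=> aM; rewrite wgt_int mulr_sumr -sumrB.
apply: le_trans (ler_norm_sum _ _ _) _.
apply: (@le_trans _ _ (\sum_i M * `|N^-1 - wgt i|)).
  apply: ler_sum => i _; rewrite mulrC -mulrBr normrM.
  by rewrite ler_wpM2r.
have M0 : 0 <= M by exact: le_trans (aM ord0).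
rewrite -mulr_sumr (_ : 2 * M / N = M * (2 / N)); last by rewrite -mulrA mulrCA.
by rewrite ler_wpM2l// wgt_l1.
Qed.

(** [grid_sum1] in the second index for each first index, then in the first index: two errors of 2 M
    / N. *)
Lemma grid_sum2 (a : 'I_n.+1 -> 'I_n.+1 -> R) (M : R) : (forall i j, `|a i j| <= M) ->
  `|N ^- 2 * \sum_i \sum_j a i j -
    \int[U]_x \int[U]_y a (grididx n (x : R)) (grididx n (y : R))| <= 4 * M / N.
Proof.
move=> aM; pose b i := N^-1 * \sum_j a i j.
have bM i : `|b i| <= M.
  rewrite /b normrM ger0_norm ?invr_ge0// mulrC ler_pdivrMr//.
  apply: le_trans (ler_norm_sum _ _ _) _.
  apply: le_trans (ler_sum _ (fun j _ => aM i j)) _.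
  by rewrite sumr_const card_ord mulr_natr.
have h1 := grid_sum1 bM.
pose e i := \int[U]_y a i (grididx n (y : R)).
have h2 i : `|b i - e i| <= 2 * M / N := grid_sum1 (aM i).
have -> : N ^- 2 * \sum_i \sum_j a i j = N^-1 * \sum_i b i.
  by rewrite /b -mulr_sumr mulrA -invfM -expr2.
have h3 : `|\int[U]_x b (grididx n (x : R)) - \int[U]_x e (grididx n (x : R))| <= 2 * M / N.
  rewrite !wgt_int -sumrB.
  have s1 : \sum_i wgt i = 1.
    have := wgt_int (fun=> 1); under [RHS]eq_bigr do rewrite mul1r.
    move=> <-; rewrite Rintegral_cst//.
    by have /(congr1 fine)/= -> := probability_setT U; rewrite mulr1.
  apply: le_trans (ler_norm_sum _ _ _) _.
  apply: (@le_trans _ _ (\sum_i 2 * M / N * wgt i)).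
    apply: ler_sum => i _; rewrite -mulrBl normrM (@ger0_norm _ (wgt i)) ?fine_ge0//.
    by rewrite ler_wpM2r ?fine_ge0.
  by rewrite -mulr_sumr s1 mulr1.
rewrite -/(e _); apply: le_trans (ler_distD (\int[U]_x b (grididx n (x : R))) _ _) _.
apply: le_trans (lerD h1 h3) _.
by rewrite (_ : 4 * M / N = 2 * M / N + 2 * M / N) //; ring.
Qed.

End grid_sums.

(** * Derivatives of complex-valued functions of a real variable *)

Section complex_derivatives.
Context (R : realType).

Lemma C_cvg (F : set_system R) (FF : Filter F) (g : R -> R[i]) (L : R[i]) :
  (forall e : R, 0 < e -> \forall h \near F, normc (L - g h) < e) ->
  (g h : R[i]^o) @[h --> F] --> (L : R[i]^o).
Proof.
(* Radii of balls in [R[i]] are themselves complex; positivity makes the imaginary part 0 and the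
   real part positive. *)
move=> H; apply/cvgrPdist_lt => -[e e'] /=; rewrite ltcE/= => /andP[/eqP -> e0].
apply: filterS (H e e0) => h hh.
by rewrite normc_def -normc_sqr sqrtr_sqr ger0_norm ?normc_ge0// ltcE/= eqxx.
Qed.

Lemma toCV (h : R) : toC (h^-1) = (toC h)^-1.
Proof. exact: (fmorphV (real_complex R)). Qed.

(** Divided by t, the error is at most C sqrt t. The threshold (e / (C + 1))^2 makes this less than
    e, also when C = 0. *)
Lemma right_Cderive_sqrt3 (g : R -> R[i]) (L : R[i]) (C : R) : 0 <= C ->
  (forall t, 0 <= t -> normc (g t - g 0 - toC t * L) <= C * Num.sqrt t ^+ 3) ->
  is_right_Cderive g 0 L.
Proof.
move=> C0 H; apply: C_cvg => e e0; near=> h.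
have h0 : 0 < h by near: h; exact: nbhs_right_gt.
have hC : h < (e / (C + 1)) ^+ 2.
  by near: h; apply: nbhs_right_lt; rewrite exprn_gt0// divr_gt0// ltr_wpDl.
have hz : toC h != 0 :> R[i] by apply/eqP => -[] /eqP; rewrite gt_eqF.
have -> : L - toC (h^-1) * (g (0 + h) - g 0) = - (toC (h^-1) * (g h - g 0 - toC h * L)).
  by rewrite add0r toCV [in RHS]mulrBr mulKf// opprB.
rewrite normcN ComplexField.Normc.normcM normc_toC gtr0_norm ?invr_gt0//.
have s0 : 0 < Num.sqrt h by rewrite sqrtr_gt0.
have sh : Num.sqrt h ^+ 2 = h by rewrite sqr_sqrtr// ltW.
apply: (@le_lt_trans _ _ (C * Num.sqrt h)).
  rewrite mulrC ler_pdivrMr//; apply: le_trans (H _ (ltW h0)) _.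
  by rewrite -mulrA ler_wpM2l// exprS sh.
have : Num.sqrt h < e / (C + 1).
  have ec : 0 < e / (C + 1) by rewrite divr_gt0// ltr_wpDl.
  by rewrite -(@ltr_pXn2r _ 2%N)// ?nnegrE ?ltW// sh.
rewrite ltr_pdivlMr ?ltr_wpDl// => h1.
by apply: le_lt_trans h1; rewrite mulrDr mulr1 [C * _]mulrC lerDl ltW.
Unshelve. all: by end_near.
Qed.

(** With w = z - l, the error of the difference quotient is exactly -h / (w^2 (w - h)), of modulus
    at most |h| / |Im z|^3. *)
Lemma Cderive_resolvent (z : R[i]) (l : R) : complex.Im z != 0 ->
  Cderive (fun l' => (z - toC l')^-1) l = ((z - toC l) ^+ 2)^-1.
Proof.
move=> z0.
suff h : (toC h^-1 * ((z - toC (l + h))^-1 - (z - toC l)^-1) : R[i]^o) @[h --> (0 : R)^'] -->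
    (((z - toC l) ^+ 2)^-1 : R[i]^o).
  exact: (cvg_lim (@norm_hausdorff _ (R[i]^o : normedModType R[i])) h).
apply: C_cvg => e e0; set w := z - toC l.
have y0 : 0 < `|complex.Im z| by rewrite normr_gt0.
near=> h.
have h0 : h != 0 by near: h; exact: nbhs_dnbhs_neq.
have he : `|h| < e * `|complex.Im z| ^+ 3.
  near: h; apply: (@dnbhs0_lt _ R); rewrite mulr_gt0// exprn_gt0//.
have w0 : w != 0 by exact: subC_neq0.
have wh : z - toC (l + h) = w - toC h.
  by rewrite /w; apply: Complex_eq; rewrite !(CReD, CImD, CReN, CImN)/=; ring.
have wh0 : w - toC h != 0 by rewrite -wh subC_neq0.
have hz : toC h != 0 :> R[i] by apply/eqP => -[] /eqP; rewrite (negbTE h0).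
have -> : (w ^+ 2)^-1 - toC (h^-1) * ((z - toC (l + h))^-1 - w^-1) =
    - (toC h * (w^-1 * w^-1 * (w - toC h)^-1)).
  by rewrite wh toCV; field; rewrite w0 wh0 hz.
rewrite normcN !ComplexField.Normc.normcM normc_toC -wh.
have b1 : normc w^-1 <= `|complex.Im z|^-1 by exact: normc_resolvent.
have b2 : normc (z - toC (l + h))^-1 <= `|complex.Im z|^-1 by exact: normc_resolvent.
apply: (@le_lt_trans _ _ (`|h| * `|complex.Im z| ^- 3)).
  rewrite ler_wpM2l// -exprVn !exprS expr0 mulr1 mulrA.
  by rewrite ler_pM ?mulr_ge0 ?normc_ge0// ler_pM ?normc_ge0.
by rewrite ltr_pdivrMr// exprn_gt0.
Unshelve. all: by end_near.
Qed.

End complex_derivatives.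

(** * The limit of the second-order term *)

Section deterministic_limit.
Context (R : realType).
Local Notation mu := (@lebesgue_measure R).
Local Notation Rm := (measurableTypeR R).
Local Notation U := (uniform_prob (@ltr01 R) : probability Rm R).

Lemma measurable_grid_fun2 d (T : measurableType d) n (g h : T -> Rm)
    (a : 'I_n.+1 -> 'I_n.+1 -> R) :
  measurable_fun setT g -> measurable_fun setT h ->
  measurable_fun setT (fun p => a (grididx n (g p : R)) (grididx n (h p : R))).
Proof.
move=> mg mh.
have -> : (fun p => a (grididx n (g p : R)) (grididx n (h p : R))) =
    (fun p => \sum_i \sum_j a i j *
      ((grididx n (g p : R) == i)%:R * (grididx n (h p : R) == j)%:R)).
  apply/funext => p; rewrite (bigD1 (grididx n (g p : R)))//= [X in _ + X]big1 ?addr0.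
    rewrite (bigD1 (grididx n (h p : R)))//= big1 ?addr0 ?eqxx ?mulr1//.
    by move=> j /negbTE nj; rewrite eq_sym nj !mulr0.
  by move=> i /negbTE ni; rewrite big1// => j _; rewrite eq_sym ni mul0r mulr0.
apply: measurable_sum => i; apply: measurable_sum => j.
apply: measurable_funM => //; apply: measurable_funM.
  exact: (measurableT_comp (measurable_grid_fun (fun k => (k == i)%:R)) mg).
exact: (measurableT_comp (measurable_grid_fun (fun k => (k == j)%:R)) mh).
Qed.

Lemma Rintegral_pushforward_prob d d' (T : measurableType d) (T' : measurableType d')
    (P : probability T R) (P' : probability T' R) (phi : T -> T') (h : T' -> R) (c : R) :
  measurable_fun setT phi -> P' = pushforward P phi :> (set T' -> \bar R) ->
  measurable_fun setT h -> (forall s, `|h s| <= c) ->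
  \int[P']_s h s = \int[P]_x h (phi x).
Proof.
move=> mphi PE mh hc; rewrite /Rintegral; congr fine.
transitivity (\int[pushforward P phi]_(s in setT) (h s)%:E)%E.
  apply: eq_measure_integral => A mA _.
  exact: (congr1 (fun m : set T' -> \bar R => m A) PE).
rewrite integral_pushforward//; first exact/measurable_EFinP.
rewrite preimage_setT; apply: (bounded_Rintegrable P (c := c)) => //.
exact: measurableT_comp.
Qed.

Variables (z c : R[i]).
Hypotheses (z0 : complex.Im z != 0) (c1 : normc c <= 1).
Local Notation y := `|complex.Im z|.
Local Notation r := (fun l : R => (z - toC l)^-1).

(** The two kernels are the [k] and [kappa] to which [velocity_integral] will be applied; [kernel2]
    comes from the second-order trace. *)
Definition kernel1 (s : R) : R := complex.Re (c * r s ^+ 2).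
Definition kernel2 (p : Rm * Rm) : R := complex.Re (c * (r (p.1 : R) ^+ 2 * r (p.2 : R))).

(** The added 1 makes y1 at least 1, so that y1 ^+ 3 bounds both kernels at once. *)
Let y1 : R := y^-1 + 1.
Let y1_ge1 : 1 <= y1. Proof. by rewrite lerDr invr_ge0. Qed.
Let r_le (l : R) : normc (r l) <= y1.
Proof. by apply: le_trans (normc_resolvent l z0) _; rewrite lerDl. Qed.
Let re_le (w : R[i]) k : normc w <= y1 ^+ k -> (k <= 3)%N ->
  `|complex.Re (c * w)| <= y1 ^+ 3.
Proof.
move=> wk k3; apply: le_trans (CRe_le_normc _) _.
rewrite ComplexField.Normc.normcM -[leRHS]mul1r; apply: ler_pM; rewrite ?normc_ge0//.
by apply: le_trans wk _; rewrite ler_weXn2l.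
Qed.

Lemma kernel1_bound s : `|kernel1 s| <= y1 ^+ 3.
Proof.
apply: (@re_le _ 2) => //; rewrite normcX; apply: lerXn2r; rewrite ?nnegrE ?normc_ge0//.
by rewrite (le_trans ler01).
Qed.

Lemma kernel2_bound p : `|kernel2 p| <= y1 ^+ 3.
Proof.
apply: (@re_le _ 3) => //; rewrite ComplexField.Normc.normcM normcX [leRHS]exprSr.
apply: ler_pM; rewrite ?exprn_ge0 ?normc_ge0//; apply: lerXn2r; rewrite ?nnegrE ?normc_ge0//.
by rewrite (le_trans ler01).
Qed.

(** Writing the coordinates of 1 / (z - l) as instances of [resolvent_kernel] gives their
    continuity, hence measurability of both kernels. *)
Let p1 (l : R) : R := resolvent_kernel 1 z l.
Let p2 (l : R) : R := resolvent_kernel (Complex 0 (-1)) z l.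
Let rE l : r l = Complex (p1 l) (p2 l).
Proof.
by apply: Complex_eq; rewrite /p1 /p2 /resolvent_kernel /= ?mul1r// CReM /= mul0r sub0r mulN1r opprK.
Qed.

Let kernel1E s : kernel1 s = complex.Re c * (p1 s * p1 s - p2 s * p2 s) -
  complex.Im c * (2 * (p1 s * p2 s)).
Proof. by rewrite /kernel1 rE expr2 CReM CReM CImM /=; ring. Qed.

Let kernel2E p : kernel2 p =
  complex.Re c * ((p1 p.1 * p1 p.1 - p2 p.1 * p2 p.1) * p1 p.2 - 2 * (p1 p.1 * p2 p.1) * p2 p.2) -
  complex.Im c * ((p1 p.1 * p1 p.1 - p2 p.1 * p2 p.1) * p2 p.2 + 2 * (p1 p.1 * p2 p.1) * p1 p.2).
Proof.
rewrite /kernel2 (rE p.1) (rE p.2).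
move: (p1 p.1) (p2 p.1) (p1 p.2) (p2 p.2) => a b a' b'.
by rewrite expr2 !(CReM, CImM) /=; ring.
Qed.

Let cp1 : continuous p1. Proof. exact: resolvent_kernel_continuous. Qed.
Let cp2 : continuous p2. Proof. exact: resolvent_kernel_continuous. Qed.
Let mp1 : measurable_fun [set: Rm] p1. Proof. exact: continuous_measurable_fun. Qed.
Let mp2 : measurable_fun [set: Rm] p2. Proof. exact: continuous_measurable_fun. Qed.

Lemma measurable_kernel1 : measurable_fun [set: Rm] kernel1.
Proof.
rewrite (_ : kernel1 = fun s => complex.Re c * (p1 s * p1 s - p2 s * p2 s) -
  complex.Im c * (2 * (p1 s * p2 s))); last by apply/funext => s; exact: kernel1E.
apply: measurable_funB; apply: measurable_funM => //.
  by apply: measurable_funB; exact: measurable_funM.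
by apply: measurable_funM => //; exact: measurable_funM.
Qed.

Lemma measurable_kernel2 : measurable_fun setT kernel2.
Proof.
rewrite (funext kernel2E).
have m1 : measurable_fun [set: Rm * Rm] (fun p => p1 p.1) by exact: measurableT_comp.
have m2 : measurable_fun [set: Rm * Rm] (fun p => p2 p.1) by exact: measurableT_comp.
have m3 : measurable_fun [set: Rm * Rm] (fun p => p1 p.2) by exact: measurableT_comp.
have m4 : measurable_fun [set: Rm * Rm] (fun p => p2 p.2) by exact: measurableT_comp.
have mA : measurable_fun [set: Rm * Rm] (fun p => p1 p.1 * p1 p.1 - p2 p.1 * p2 p.1).
  by apply: measurable_funB; exact: measurable_funM.
have mB : measurable_fun [set: Rm * Rm] (fun p => 2 * (p1 p.1 * p2 p.1)).
  by apply: measurable_funM => //; exact: measurable_funM.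
apply: measurable_funB; apply: measurable_funM => //.
  by apply: measurable_funB; exact: measurable_funM.
by apply: measurable_funD; exact: measurable_funM.
Qed.

Lemma kernel2_cvg (u v : nat -> R) (s t : R) : u n @[n --> \oo] --> s ->
  v n @[n --> \oo] --> t -> kernel2 (u n, v n) @[n --> \oo] --> kernel2 (s, t).
Proof.
move=> us vt; rewrite (funext kernel2E).
have u1 : p1 (u n) @[n --> \oo] --> p1 s by apply: continuous_cvg; [exact: cp1|exact: us].
have u2 : p2 (u n) @[n --> \oo] --> p2 s by apply: continuous_cvg; [exact: cp2|exact: us].
have v1 : p1 (v n) @[n --> \oo] --> p1 t by apply: continuous_cvg; [exact: cp1|exact: vt].
have v2 : p2 (v n) @[n --> \oo] --> p2 t by apply: continuous_cvg; [exact: cp2|exact: vt].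
by repeat first [exact: u1 | exact: u2 | exact: v1 | exact: v2 | exact: cvg_cst |
  apply: cvgM | apply: cvgB | apply: cvgD].
Qed.

(* With a = 1/(z-s) and b = 1/(z-t): a - b = (s - t) a b, so that
   a^2 b + b^2 a = a b (a + b) = (a^2 - b^2) / (s - t). *)
Lemma kernel2_sym (s t : R) : s <> t ->
  kernel2 (s, t) + kernel2 (t, s) = (kernel1 s - kernel1 t) / (s - t).
Proof.
move=> /eqP st; have st0 : s - t != 0 by rewrite subr_eq0.
apply: (mulIf st0); rewrite divfK// mulrC /kernel1 /kernel2 /=.
rewrite -CReD -CReZ -CReN -CReD; congr complex.Re.
have zs : z - toC s != 0 by exact: subC_neq0.
have zt : z - toC t != 0 by exact: subC_neq0.
have -> : toC (s - t) = (z - toC t) - (z - toC s).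
  by apply: Complex_eq; rewrite !(CReD, CReN, CImD, CImN) /=; ring.
by move: (z - toC s) (z - toC t) zs zt => a b a0 b0; field; rewrite a0 b0.
Qed.

Variables (lam : forall n, 'I_n.+1 -> R) (v : forall n, 'I_n.+1 -> 'I_n.+1 -> R)
  (f : R -> R) (sigma : R -> R -> R) (rho : R -> R) (tau : R -> R -> R) (V : R).
Hypothesis v_bound : forall n i j, `|@v n i j| <= V.
Hypothesis lam_lim : forall s : R, 0 <= s <= 1 -> @lam n (grididx n s) @[n --> \oo] --> f s.
Hypothesis var_lim : forall s t : R, 0 <= s <= 1 -> 0 <= t <= 1 -> s != t ->
  @v n (grididx n s) (grididx n t) @[n --> \oo] --> sigma s t ^+ 2.
Hypothesis rho_density : has_density (pushforward (uniform_prob (@ltr01 R)) f) rho.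
Hypothesis tau_sym : forall s t : R, tau s t = tau t s.
Hypothesis sigma_tau : forall s t : R, 0 <= s <= 1 -> 0 <= t <= 1 -> s != t ->
  sigma s t ^+ 2 = tau (f s) (f t).

(** f is constrained on [0, 1] only. Set to 0 elsewhere it becomes a pointwise limit of step
    functions, hence measurable. *)
Let ft (s : Rm) : Rm := (\1_(`[0, 1]%classic : set R) (s : R) * f s : R).

Let ftE (s : R) : 0 <= s <= 1 -> ft s = f s.
Proof. by move=> s01; rewrite /ft indicE mem_set ?mul1r//= in_itv. Qed.

Let mft : measurable_fun [set: Rm] ft.
Proof.
apply: (@measurable_fun_cvg _ Rm R setT
  (fun n (s : Rm) => \1_(`[0, 1]%classic : set R) (s : R) * @lam n (grididx n (s : R)))).
  move=> n; apply: measurable_funM; last exact: measurable_grid_fun.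
  by apply: measurable_indic; exact: measurable_itv.
move=> s _; rewrite /ft indicE; have [/set_mem|_] := boolP (_ \in _).
  rewrite /= in_itv/= => s01; rewrite mul1r; under eq_fun do rewrite mul1r.
  exact: lam_lim.
by rewrite mul0r; under eq_fun do rewrite mul0r; exact: cvg_cst.
Qed.

(** The normalized double sum is close to the integral of a step function on the square, which
    converges by bounded convergence; [velocity_integral] identifies the limit. *)
Lemma sandwich_limit (eta alpha C : R) : 0 < eta -> 0 < alpha ->
  {ae mu, forall s : R, forall t : R, s - eta <= t <= s + eta ->
     `|tau s t * rho t - tau s s * rho s| <= C * `|t - s| `^ alpha} ->
  n.+1%:R ^- 2 * (\sum_i \sum_j
     complex.Re (c * (r (@lam n i) ^+ 2 * r (@lam n j))) * @v n i j) @[n --> \oo] -->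
  - \int[mu]_s (kernel1 s * Fvel tau rho s).
Proof.
move=> eta0 alpha0 hoelder.
have [nu nuE] := pushforward_probabilityE U mft.
have nu_rho : has_density nu rho.
  have [mrho rho0 rhoE] := rho_density; split => // A mA.
  rewrite -rhoE// nuE /pushforward; apply: uniform_prob_eq.
  by apply/seteqP; split => s [/= hs s01]; split => //; move: hs;
    rewrite /= ftE//; move: s01; rewrite in_itv.
have [E [g [mE mg gE E0]]] := measurable_right_inverse mft.
pose A1 : set Rm := `[0, 1]%classic `&` ft @^-1` E.
have mA1 : measurable A1.
  apply: measurableI; first exact: measurable_itv.
  by rewrite -[X in measurable X]setTI; exact: mft.
have A1E s : A1 s -> 0 <= (s : R) <= 1 /\ E (f s).
  by move=> [/=]; rewrite in_itv/= => s01; rewrite ftE.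
have UA1 : U (~` A1) = 0%E.
  rewrite uniform_probE; last exact: measurableC.
  rewrite -E0; congr (mu _); apply/seteqP; split => s /=.
    by move=> [nA s01]; split => // fE; apply: nA; split.
  by move=> [s01 nE]; split => // -[].
have nuEC : nu (~` E) = 0%E.
  rewrite nuE /pushforward; apply/eqP; rewrite eq_le measure_ge0 andbT -UA1.
  have mfE : measurable (ft @^-1` (~` E)).
    by rewrite -[X in measurable X]setTI; apply: mft => //; exact: measurableC.
  apply: le_measure; rewrite ?inE//; first exact: measurableC.
  by move=> s /= nE [].
have mdiag : measurable [set p : Rm * Rm | p.1 = p.2].
  rewrite -[X in measurable X]setTI.
  have mB : measurable_fun [set: Rm * Rm] (fun p : Rm * Rm => p.1 - p.2 : R).
    exact: (measurable_funB measurable_fst measurable_snd).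
  have -> : [set p : Rm * Rm | p.1 = p.2] =
      (fun p : Rm * Rm => p.1 - p.2 : R) @^-1` [set 0].
    apply/seteqP; split => p /=; first by move=> ->; rewrite subrr.
    by move/eqP; rewrite subr_eq0 => /eqP.
  by apply: mB => //; exact: measurable_set1.
(* The diagonal is removed because [var_lim] and [sigma_tau] speak of distinct points only. *)
pose D : set (Rm * Rm) := (E `*` E) `\` [set p | p.1 = p.2].
have mD : measurable D by apply: measurableD => //; exact: measurableX.
(* The measurable version of [tau]: a pair of values in E is pulled back by the section g, where
   sigma^2 is a limit of variances, so T is a pointwise limit of measurable step functions. *)
pose T (p : Rm * Rm) : R := \1_D p * sigma (g p.1) (g p.2) ^+ 2.
have DE p : D p -> [/\ 0 <= (g p.1 : R) <= 1, 0 <= (g p.2 : R) <= 1 & (g p.1 : R) != g p.2].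
  move=> [[/= E1 E2] p12]; have [g1 h1] := gE _ E1; have [g2 h2] := gE _ E2.
  by split => //; apply/eqP => e; apply: p12; rewrite /= -h1 -h2 e.
have Tcvg p : (\1_D p * @v n (grididx n (g p.1 : R)) (grididx n (g p.2 : R)) : R)
    @[n --> \oo] --> T p.
  rewrite /T indicE; have [/set_mem Dp|_] := boolP (p \in D).
    rewrite mul1r; under eq_fun do rewrite mul1r.
    by have [? ? ?] := DE _ Dp; exact: var_lim.
  by rewrite mul0r; under eq_fun do rewrite mul0r; exact: cvg_cst.
have mT : measurable_fun setT T.
  apply: (@measurable_fun_cvg _ _ R setT
    (fun n p => \1_D p * @v n (grididx n (g p.1 : R)) (grididx n (g p.2 : R)))) => //.
  move=> n; apply: measurable_funM; first exact: measurable_indic.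
  by apply: measurable_grid_fun2; exact: measurableT_comp.
have V0 : 0 <= V by exact: le_trans (normr_ge0 _) (v_bound (n := 0) ord0 ord0).
have TV p : `|T p| <= V.
  have hn : `|\1_D p * @v n (grididx n (g p.1 : R)) (grididx n (g p.2 : R)) : R|
      @[n --> \oo] --> `|T p| by apply: cvg_norm; exact: Tcvg.
  apply: (ler_cvg_to hn (cvg_cst V : (fun=> V) @ \oo --> V)); apply: nearW => n.
  rewrite /= normrM -[leRHS]mul1r.
  apply: ler_pM; [exact: normr_ge0|exact: normr_ge0| |exact: v_bound].
  by rewrite indicE; case: (_ \in _); rewrite ?normr1 ?normr0.
have tauT s t : E s -> E t -> s <> t -> tau s t = T (s, t).
  move=> Es Et st; have Dp : D (s, t) by split.
  have [/= g1 g2 g12] := DE _ Dp; rewrite /T indicE mem_set// mul1r sigma_tau//=.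
  have [_ h1] := gE _ Es; have [_ h2] := gE _ Et.
  by rewrite -(ftE g1) -(ftE g2) h1 h2.
have Tsym s t : T (s, t) = T (t, s).
  have [[[/= E1 E2] st]|nD] := pselect (D (s, t)).
    by rewrite -!tauT//; move=> e; apply: st.
  have nD' : ~ D (t, s).
    by move=> [[/= E2 E1] st]; apply: nD; split => // e; apply: st.
  by rewrite /T !indicE !memNset ?mul0r.
(* The limit to be reached becomes the double integral of [kernel2] times T, which is then
   transported from nu to the unit square. *)
rewrite (velocity_integral nu_rho mT TV Tsym mE nuEC tauT eta0 alpha0 hoelder
  measurable_kernel1 kernel1_bound measurable_kernel2 kernel2_bound kernel2_sym) opprK.
pose KT p := kernel2 p * T p.
have mKT : measurable_fun setT KT by exact: (measurable_funM measurable_kernel2 mT).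
have KTb p : `|KT p| <= y1 ^+ 3 * V.
  by rewrite normrM; apply: ler_pM => //; exact: kernel2_bound.
pose ft2 (p : Rm * Rm) := (ft p.1, ft p.2).
have mft1 : measurable_fun [set: Rm * Rm] (fun p => ft p.1) by exact: measurableT_comp.
have mft2 : measurable_fun [set: Rm * Rm] (fun p => ft p.2) by exact: measurableT_comp.
have mKT2 : measurable_fun setT (KT \o ft2).
  by apply: measurableT_comp => //; exact: measurable_fun_pair.
have -> : \int[(nu \x nu)%E]_p (kernel2 p * T p) = \int[(U \x U)%E]_p (KT (ft2 p)).
  rewrite -(bounded_fubini1 nu nu mKT KTb) -(bounded_fubini1 U U mKT2 (fun p => KTb (ft2 p))).
  rewrite (Rintegral_pushforward_prob mft nuE (measurable_bounded_fubini nu nu mKT KTb)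
    (c := y1 ^+ 3 * V)); last first.
    move=> s; apply: bounded_normr_Rintegral => //.
    by apply: (measurableT_comp mKT); exact: measurable_pair1.
  apply: eq_Rintegral => x _.
  rewrite (Rintegral_pushforward_prob mft nuE (h := fun t => KT (ft x, t)) (c := y1 ^+ 3 * V))//.
  by apply: (measurableT_comp mKT); exact: measurable_pair1.
pose a n (i j : 'I_n.+1) := kernel2 (@lam n i, @lam n j) * @v n i j.
have ab n i j : `|@a n i j| <= y1 ^+ 3 * V.
  by rewrite normrM; apply: ler_pM => //; exact: kernel2_bound.
pose Phi n (p : Rm * Rm) := @a n (grididx n (p.1 : R)) (grididx n (p.2 : R)).
have mPhi n : measurable_fun setT (Phi n).
  exact: (measurable_grid_fun2 (@a n) measurable_fst measurable_snd).
have ae1 : {ae (U \x U)%E, forall p : Rm * Rm, A1 p.1}.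
  exists ((~` A1) `*` setT); split.
  - by apply: measurableX => //; exact: measurableC.
  - transitivity (U (~` A1) * U setT)%E; last by rewrite UA1 mul0e.
    by apply: product_measure1E => //; exact: measurableC.
  - by move=> p /= h; split.
have ae2 : {ae (U \x U)%E, forall p : Rm * Rm, A1 p.2}.
  exists (setT `*` (~` A1)); split.
  - by apply: measurableX => //; exact: measurableC.
  - transitivity (U setT * U (~` A1))%E; last by rewrite UA1 mule0.
    by apply: product_measure1E => //; exact: measurableC.
  - by move=> p /= h; split.
(* nu has no atoms, so f separates almost every pair of points; T represents [tau] only at distinct
   values. *)
have ae3 : {ae (U \x U)%E, forall p : Rm * Rm, ft p.1 <> ft p.2}.
  exists (ft2 @^-1` [set p | p.1 = p.2]); split.
  - rewrite -[X in measurable X]setTI.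
    by apply: (measurable_fun_pair mft1 mft2).
  - rewrite /product_measure1 -[RHS](@integral0 _ _ _ U setT).
    apply: eq_integral => s _ /=.
    have -> : xsection (ft2 @^-1` [set p | p.1 = p.2]) s = ft @^-1` [set ft s].
      by apply/seteqP; split => t; rewrite /xsection /= inE/= => ->.
    have := density_set1 nu_rho (ft s); rewrite nuE; exact.
  - by move=> p /= /contrapT.
have cPhi : {ae (U \x U)%E, forall p, Phi n p @[n --> \oo] --> KT (ft2 p)}.
  apply: filterS (filterI ae1 (filterI ae2 ae3)) => p [/A1E[x01 Ex] [/A1E[y01 Ey] ne]].
  rewrite /ft2 !ftE//; rewrite !ftE// in ne.
  apply: cvgM; first by apply: kernel2_cvg; exact: lam_lim.
  have n12 : (p.1 : R) != (p.2 : R) by apply/negP => /eqP e; apply: ne; rewrite e.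
  rewrite -tauT// -sigma_tau//.
  exact: var_lim.
have [_ cI] := bounded_convergence mPhi mKT2 cPhi (aeW _ (fun p n => @ab n _ _)).
(* By [grid_sum2] the gap between sum and integral is of order 1 / n. *)
have cG : (fun n => n.+1%:R ^- 2 * (\sum_i \sum_j @a n i j) -
    \int[(U \x U)%E]_p Phi n p) @ \oo --> (0 : R).
  apply/cvgr0Pnorm_lt => e e0; near=> n.
  rewrite -(bounded_fubini1 U U (mPhi n) (fun p => @ab n _ _)).
  apply: le_lt_trans (grid_sum2 (@ab n)) _.
  rewrite ltr_pdivrMr// [e * _]mulrC -ltr_pdivrMr//.
  apply: lt_le_trans (truncnS_gt _) _; rewrite ler_nat ltnS.
  by near: n; exact: nbhs_infty_ge.
have cS : (fun n => n.+1%:R ^- 2 * (\sum_i \sum_j @a n i j) : R) @ \oo -->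
    0 + \int[(U \x U)%E]_p KT (ft2 p).
  have -> : (fun n => n.+1%:R ^- 2 * (\sum_i \sum_j @a n i j) : R) =
      (fun n => (n.+1%:R ^- 2 * (\sum_i \sum_j @a n i j) -
        \int[(U \x U)%E]_p Phi n p) + \int[(U \x U)%E]_p Phi n p).
    by apply/funext => n; rewrite subrK.
  by apply: cvgD; [exact: cG|exact: cI].
by rewrite add0r in cS; exact: cS.
Unshelve. all: by end_near.
Qed.

End deterministic_limit.

Section moments.
Context (R : realType).

Lemma normc_le_coords (w : R[i]) : normc w <= `|complex.Re w| + `|complex.Im w|.
Proof.
rewrite -(@ler_pXn2r _ 2%N)// ?nnegrE ?normc_ge0 ?addr_ge0//.
rewrite normc_sqr -(real_normK (num_real (complex.Re w))) -(real_normK (num_real (complex.Im w))).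
have := mulr_ge0 (normr_ge0 (complex.Re w)) (normr_ge0 (complex.Im w)).
by move: `|complex.Re w| `|complex.Im w| => a b ab; rewrite sqrrD lerD2r lerDl mulrn_wge0.
Qed.

(** From u <= 1 + u^2 with u = |Y|^4. *)
Lemma moment4_le d (T : measurableType d) (P : probability T R) (Y : T -> R[i]) (M : R) :
  Cmeasurable Y -> ('E_P[fun w => (normc (Y w) ^+ 8)%R] <= M%:E)%E ->
  (\int[P]_w (normc (Y w) ^+ 4)%:E <= (1 + `|M|)%:E)%E.
Proof.
move=> mY; rewrite unlock => hM.
have mN k : measurable_fun setT (fun w => normc (Y w) ^+ k).
  by apply: measurable_funX; exact: Cmeasurable_normc.
have n0 k w : 0 <= normc (Y w) ^+ k by rewrite exprn_ge0 ?normc_ge0.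
apply: (@le_trans _ _ (\int[P]_w (1 + (normc (Y w) ^+ 8)%:E))%E).
  apply: ge0_le_integral => //.
  - by move=> w _; rewrite lee_fin.
  - exact/measurable_EFinP.
  - by apply: emeasurable_funD; [exact: measurable_cst|exact/measurable_EFinP].
  - move=> w _; rewrite -EFinD lee_fin (_ : 8%N = (4 * 2)%N)// exprM.
    move: (normc (Y w) ^+ 4) (n0 4%N w) => a a0; have := sqr_ge0 (a - 1).
    by rewrite expr2 mulrBl !mulrBr; nra.
rewrite ge0_integralD//; [|by move=> w _; rewrite lee_fin|exact/measurable_EFinP].
apply: (@le_trans _ _ (1 + M%:E)%E); last by rewrite -EFinD lee_fin lerD2l ler_norm.
by apply: leeD => //; rewrite integral_cst// mul1e; exact: probability_le1.
Qed.

End moments.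

(** * Passage to the limit and the derivative at zero *)

Theorem proposition2 (R : realType)
  (* model *)
  (d : nat -> measure_display) (T : forall n, measurableType (d n))
  (P : forall n, probability (T n) R)
  (lam : forall n, 'I_n.+1 -> R)
  (x : forall n, T n -> 'M[R[i]]_n.+1)
  (eps : nat -> R)
  (f sigmad : R -> R) (sigma : R -> R -> R) (rho : R -> R) (tau : R -> R -> R)
  (mu : R -> probability R R)
  (x_herm : forall n w, x n w \is hermsymmx)
  (eps_gt0 : forall n, 0 < eps n)
  (* (a) *)
  (x_meas : forall n i j, measurable_fun setT (fun w => coords (x n w i j)))
  (x_indep : forall n, mutually_independent (P n)
     [set p : 'I_n.+1 * 'I_n.+1 | (p.1 <= p.2)%N]%SET
     (fun p w => coords (x n w p.1 p.2)))
  (x_centered : forall n i j,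
     ('E_(P n)[fun w => complex.Re (x n w i j)] = 0)%E /\
     ('E_(P n)[fun w => complex.Im (x n w i j)] = 0)%E)
  (x_moment8 : exists M : R, forall n i j,
     ('E_(P n)[fun w => (normc (x n w i j) ^+ 8)%R] <= M%:E)%E)
  (* (b) *)
  (lam_lim : forall s : R, 0 <= s <= 1 ->
     lam n (grididx n s) @[n --> \oo] --> f s)
  (var_diag_lim : forall s : R, 0 <= s <= 1 ->
     variance_profile (P n) (x n) (grididx n s) (grididx n s) @[n --> \oo]
       --> sigmad s ^+ 2)
  (var_lim : forall s t : R, 0 <= s <= 1 -> 0 <= t <= 1 -> s != t ->
     variance_profile (P n) (x n) (grididx n s) (grididx n t) @[n --> \oo]
       --> sigma s t ^+ 2)
  (eta_lim :
     profile_gap (eps n) (variance_profile (P n) (x n)) (lam n) sigma f @[n --> \oo]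
       --> (0 : R))
  (* (c) *)
  (f_bounded : exists M : R, forall s : R, 0 <= s <= 1 -> `|f s| <= M)
  (rho_density : has_density (pushforward (uniform_prob (@ltr01 R)) f) rho)
  (supp_compact :
     compact (support_of (pushforward (uniform_prob (@ltr01 R)) f)))
  (* (d) *)
  (tau_sym : forall s t : R, tau s t = tau t s)
  (sigma_tau : forall s t : R, 0 <= s <= 1 -> 0 <= t <= 1 -> s != t ->
     sigma s t ^+ 2 = tau (f s) (f t))
  (* (e) *)
  (tau_rho_holder : exists eta0 alpha C : R, 0 < eta0 /\ 0 < alpha /\
     {ae lebesgue_measure, forall s : R, forall t : R, s - eta0 <= t <= s + eta0 ->
       `|tau s t * rho t - tau s s * rho s| <= C * `|t - s| `^ alpha})
  (* (f) *)
  (lam_dist : exists K : set R, compact K /\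
     \big[maxe/0%E]_(i < n.+1) edist_inf K (lam n i) @[n --> \oo] --> 0%E)
  (* mu t is the limiting empirical eigenvalue distribution *)
  (mu_lim : forall t : R, 0 <= t ->
     weakly_cvg_in_prob P (fun n w => esd (perturbed (lam n) (x n w) t)) (mu t)) :
  forall z : R[i], complex.Im z != 0 ->
    is_right_Cderive (fun t => stieltjes (mu t) z) 0
      (- Cintegral lebesgue_measure
           (fun l => toC (Fvel tau rho l) / (z - toC l) ^+ 2)) /\
    - Cintegral lebesgue_measure
        (fun l => toC (Fvel tau rho l) / (z - toC l) ^+ 2) =
    - Cintegral lebesgue_measure
        (fun l => toC (Fvel tau rho l) *
                  Cderive (fun l' => (z - toC l')^-1) l).
Proof.
move=> z z0.
have [M hM] := x_moment8.
have mx n i j : Cmeasurable (fun w => x n w i j) by exact: Cmeasurable_coords.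
pose K := 1 + `|M|.
have x4 n i j : (\int[P n]_w (normc (x n w i j) ^+ 4)%:E <= K%:E)%E by exact: moment4_le.
pose v n (i j : 'I_n.+1) : R := \int[P n]_w normc (x n w i j) ^+ 2.
have vE n i j : variance_profile (P n) (x n) i j = v n i j.
  by rewrite /variance_profile unlock.
have vb n i j : `|v n i j| <= 1 + K.
  rewrite ger0_norm; first exact: (integrable_normc2 (x_meas n) (x4 n) i j).2.
  by apply: Rintegral_ge0 => w _; rewrite sqr_ge0.
have var_lim' (s t : R) : 0 <= s <= 1 -> 0 <= t <= 1 -> s != t ->
    v n (grididx n s) (grididx n t) @[n --> \oo] --> sigma s t ^+ 2.
  move=> s01 t01 st; have := var_lim s t s01 t01 st.
  by under eq_fun do rewrite vE.
have [eta [alpha [C [eta0 [alpha0 hol]]]]] := tau_rho_holder.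
pose y := `|complex.Im z|.
pose Cst := y ^- 2 * (1 + K + y ^- 2 * (4 / y ^+ 2 * K)).
have K0 : 0 <= K by rewrite addr_ge0.
have Cst0 : 0 <= Cst.
  have y0 : 0 <= y ^- 2 by rewrite invr_ge0 sqr_ge0.
  by rewrite mulr_ge0// addr_ge0 ?addr_ge0// mulr_ge0// mulr_ge0// mulr_ge0.
pose St c t := \int[mu t]_l resolvent_kernel c z l.
(* One coordinate at a time: this is the limit in n of the expansion at fixed t, with the constant
   unchanged. *)
have key c : normc c <= 1 -> forall t, 0 <= t ->
    `|St c t - St c 0 + t * \int[lebesgue_measure]_s (kernel1 z c s * Fvel tau rho s)| <=
    Num.sqrt t ^+ 3 * Cst.
  move=> c1.
  have ck := @resolvent_kernel_continuous _ c _ z0.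
  have mk : measurable_fun setT (resolvent_kernel c z) by exact: continuous_measurable_fun.
  have kb l : `|resolvent_kernel c z l| <= y^-1 by exact: normc_re_kernel.
  pose X t n w := \int[esd (perturbed (@lam n) (x n w) t)]_l resolvent_kernel c z l.
  have XE t n w : X t n w = n.+1%:R^-1 *
      complex.Re (c * \tr (invmx (z%:M - perturbed (@lam n) (x n w) t))).
    apply: esd_resolvent_kernel => //.
    exact: (perturbed_hermitian (x_herm n) (@lam n) w t z0).
  have mX t n : measurable_fun setT (X t n).
    rewrite (funext (XE t n)); apply: measurable_funM => //.
    have [h _] : Cmeasurable (fun w =>
        c * \tr (invmx (z%:M - perturbed (@lam n) (x n w) t))).
      apply: CmeasurableM; first exact: Cmeasurable_cst.
      exact: (Cmeasurable_resolvent (x_herm n) (x_meas n) (@lam n) t z0).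
    exact: h.
  have Xb t n w : `|X t n w| <= y^-1.
    rewrite /X esd_Rintegral// normrM ger0_norm ?invr_ge0// mulrC ler_pdivrMr//.
    apply: le_trans (ler_norm_sum _ _ _) _.
    apply: le_trans (ler_sum _ (fun k _ => kb _)) _.
    by rewrite sumr_const card_ord mulr_natr.
  have Sb t : `|St c t| <= y^-1 by exact: bounded_normr_Rintegral.
  have Xcvg t : 0 <= t -> \int[P n]_w X t n w @[n --> \oo] --> St c t.
    move=> t0; apply: (means_cvg (M := y^-1)) => // e e0.
    exact: (mu_lim t t0 _ ck (ex_intro _ _ kb) e e0).
  pose a n := n.+1%:R^-1 * complex.Re (c * \sum_i (z - toC (@lam n i))^-1).
  pose b n := n.+1%:R ^- 2 * (\sum_i \sum_j
    complex.Re (c * ((z - toC (@lam n i))^-1 ^+ 2 * (z - toC (@lam n j))^-1)) * v n i j).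
  have expansion t n : 0 <= t ->
      `|\int[P n]_w X t n w - (a n + t * b n)| <= Num.sqrt t ^+ 3 * Cst.
    move=> t0; rewrite (funext (XE t n)).
    exact: (expected_resolvent (x_herm n) (x_meas n) (x_indep n) (x_centered n) (x4 n)
      (@lam n) z0 c1 t0).
  (* At t = 0 the error bound is 0, so [a n] is exactly the mean at time 0, and its convergence is
     the case t = 0 of [Xcvg]. *)
  have X0 n : \int[P n]_w X 0 n w = a n.
    have := expansion 0 n (lexx _).
    by rewrite sqrtr0 expr0n/= mul0r mul0r addr0 normr_le0 subr_eq0 => /eqP.
  have bcvg := sandwich_limit z0 c1 vb lam_lim var_lim' rho_density tau_sym sigma_tau
    eta0 alpha0 hol.
  move=> t t0.
  have acvg : a @ \oo --> St c 0.
    have -> : a = (fun n => \int[P n]_w X 0 n w) by apply/funext => n; exact/esym/X0.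
    exact: Xcvg.
  have cv : (fun n => `|\int[P n]_w X t n w - a n - t * b n|) @ \oo -->
      `|St c t - St c 0 -
        t * - \int[lebesgue_measure]_s (kernel1 z c s * Fvel tau rho s)|.
    apply: cvg_norm; apply: cvgB; first by apply: cvgB; [exact: Xcvg|exact: acvg].
    by apply: cvgM; [exact: cvg_cst|exact: bcvg].
  rewrite -[X in _ + X]opprK -mulrN.
  apply: (ler_cvg_to cv
    (cvg_cst (Num.sqrt t ^+ 3 * Cst) : (fun=> Num.sqrt t ^+ 3 * Cst) @ \oo --> _)).
  by apply: nearW => n; have := expansion t n t0; rewrite opprD addrA.
(* The real part of -i w is the imaginary part of w, so c = 1 and c = -i recover the Stieltjes
   transform. *)
have stE t : stieltjes (mu t) z = Complex (St 1 t) (St (Complex 0 (-1)) t).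
  congr Complex; apply: eq_Rintegral => l _; rewrite /resolvent_kernel ?mul1r//.
  by rewrite CReM /= mul0r sub0r mulN1r opprK.
have LE : Cintegral lebesgue_measure (fun l => toC (Fvel tau rho l) / (z - toC l) ^+ 2) =
    Complex (\int[lebesgue_measure]_s (kernel1 z 1 s * Fvel tau rho s))
      (\int[lebesgue_measure]_s (kernel1 z (Complex 0 (-1)) s * Fvel tau rho s)).
  congr Complex; apply: eq_Rintegral => s _; rewrite /kernel1 -exprVn.
    by rewrite CReZ mul1r mulrC.
  by rewrite CImZ mulrC CReM /= mul0r sub0r mulN1r opprK.
have n1 : normc (1 : R[i]) <= 1.
  by change (normc (toC (1 : R)) <= 1); rewrite normc_toC normr1.
have ni : normc (Complex 0 (-1) : R[i]) <= 1.
  by rewrite /= expr0n/= add0r sqrrN expr1n sqrtr1.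
split; last by congr (- Cintegral _ _); apply/funext => l; rewrite Cderive_resolvent.
(* Each coordinate contributes one [Cst], the modulus being at most the sum of the absolute values
   of the coordinates. *)
apply: (@right_Cderive_sqrt3 _ _ _ (Cst + Cst)); first by rewrite addr_ge0.
move=> t t0; apply: le_trans (normc_le_coords _) _; rewrite mulrDl; apply: lerD.
  rewrite !(CReD, CReN, CReZ) !stE LE /= mulrN opprK [leRHS]mulrC.
  exact: key.
rewrite !(CImD, CImN, CImZ) !stE LE /= mulrN opprK [leRHS]mulrC.
exact: key.
Qed.
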